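(* Let $(\psi_x,x\in E)$ be a nonnegative process with $\mathbb{E}(\psi_x)<\infty$ for every $x\in E$. For every $a\in E$ such that $\mathbb{E}(\psi_a)>0$, denote by $(\psi^{(a)}_x,x\in E)$ the process having the law of $(\psi_x,x\in E)$ under the probability $\frac{1}{\mathbb{E}(\psi_a)}\mathbb{E}(\psi_a,\,\cdot\,)$. Then $\psi$ is infinitely divisible if and only if for every $a\in E$ such that $\mathbb{E}(\psi_a)>0$ there exists a process $(l^{(a)}_x,x\in E)$ independent of $\psi$ such that $$\psi^{(a)}\ \stackrel{\text{(law)}}{=}\ \psi+l^{(a)} .$$
   Context: A process is infinitely divisible if all its finite-dimensional marginals are infinitely divisible; equality in law is equality of finite-dimensional distributions. The probability $\frac{1}{\mathbb{E}(\psi_a)}\mathbb{E}(\psi_a,\cdot)$ is the one with density $\psi_a/\mathbb{E}(\psi_a)$ with respect to the original probability. *)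

(* Defs.v *)
From HB Require Import structures.
From mathcomp Require Import all_boot all_order all_algebra.
From mathcomp Require Import all_classical all_reals all_analysis.

Set Implicit Arguments.
Unset Strict Implicit.
Unset Printing Implicit Defensive.

Import Order.TTheory GRing.Theory Num.Theory.

Local Open Scope classical_set_scope.
Local Open Scope ring_scope.

(* A real-valued process indexed by a set E, on a probability space (T, P), is
   a family X : E -> {RV P >-> R}.  R^n is n.-tuple R with its product
   sigma-algebra. *)

Definition marginal (T E : Type) (R : realType) (X : E -> T -> R) (n : nat)
    (x : n.-tuple E) (w : T) : n.-tuple R :=
  [tuple X (tnth x i) w | i < n].

(* mu and nu are set functions so that a process can also be considered under
   another measure than the one its random variables are declared with. *)
Definition eq_law (d1 d2 : measure_display) (T1 : measurableType d1)
    (T2 : measurableType d2) (R : realType) (E : Type)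
    (mu : set T1 -> \bar R) (X : E -> T1 -> R)
    (nu : set T2 -> \bar R) (Y : E -> T2 -> R) : Prop :=
  forall (n : nat) (x : n.-tuple E) (A : set (n.-tuple R)), measurable A ->
    pushforward mu (marginal X x) A = pushforward nu (marginal Y x) A.

Definition sigma_process (T E : Type) (R : realType) (X : E -> T -> R) :
    set (set T) :=
  <<s [set C | exists x : E, exists2 B : set R, measurable B & C = X x @^-1` B] >>.

Definition independent_processes (d : measure_display) (T : measurableType d)
    (R : realType) (P : probability T R) (E1 E2 : Type)
    (X : E1 -> T -> R) (Y : E2 -> T -> R) : Prop :=
  forall A B : set T, sigma_process X A -> sigma_process Y B ->
    P (A `&` B) = (P A * P B)%E.

(* For a finite family the product rule over all of 'I_m contains the one over
   its subfamilies (take A k = setT). *)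
Definition mutually_independent (d d' : measure_display)
    (T : measurableType d) (S : measurableType d') (R : realType)
    (P : probability T R) (m : nat) (Y : 'I_m -> T -> S) : Prop :=
  forall A : 'I_m -> set S, (forall k, measurable (A k)) ->
    P (\bigcap_(k in [set: 'I_m]) (Y k @^-1` A k)) =
    (\prod_(k < m) P (Y k @^-1` A k))%E.

Definition sum_tuple (R : realType) (m n : nat) (y : 'I_m -> n.-tuple R) :
    n.-tuple R :=
  [tuple \sum_(k < m) tnth (y k) i | i < n].

Definition infinitely_divisible_law (R : realType) (n : nat)
    (mu : set (n.-tuple R) -> \bar R) : Prop :=
  forall m : nat, (0 < m)%N ->
    exists (d : measure_display) (T : measurableType d) (P : probability T R)
      (Y : 'I_m -> {RV P >-> n.-tuple R}),
      [/\ mutually_independent P Y,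
          forall (j k : 'I_m) (A : set (n.-tuple R)), measurable A ->
            distribution P (Y j) A = distribution P (Y k) A
        & forall A : set (n.-tuple R), measurable A ->
            mu A = pushforward P (fun w => sum_tuple (fun k => Y k w)) A].

Definition infinitely_divisible (d : measure_display) (T : measurableType d)
    (R : realType) (P : probability T R) (E : Type) (X : E -> T -> R) : Prop :=
  forall (n : nat) (x : n.-tuple E),
    infinitely_divisible_law (pushforward P (marginal X x)).

(* A probability when f >= 0 and 0 < 'E_P[f] < +oo. *)
Definition size_biased (d : measure_display) (T : measurableType d)
    (R : realType) (P : probability T R) (f : T -> R) (A : set T) : \bar R :=
  (\int[P]_(w in A) (f w / fine 'E_P[f])%:E)%E.

(* Main.v *)
(* If psi is infinitely divisible, its restriction to a finite set of indices
   containing a is a sum of m iid nonnegative vectors Y_1, ..., Y_m, so that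
   E[psi_a f(psi)] = m E[Y_1(a) f(Y_1 + S)] with S the sum of the other parts.
   Replacing S by an independent copy of psi costs O(1/m).  Hence l^(a) is the
   limit of Y_1 under the density m Y_1(a) / E[psi_a], along an ultrafilter on
   finite index sets (with m chosen large); the limiting functional is tight,
   hence is the law of a process.

   Conversely l^(a) >= 0 almost surely, since psi^(a) is dominated by psi.  For
   finitely many indices let p_d be the degree d part of the generating series
   of a vector N that is, given psi, made of independent Poisson variables with
   means t psi_i.  As E[psi_i f(psi)] = E[psi_i] E[f(psi + l^(i))], one gets
   (d + 1) p_{d+1} = sum_j r_j p_{d-j} where the r_j have nonnegative
   coefficients; dividing the r_j by m gives an m-th root of the series of p
   with nonnegative coefficients.  So N / t is a sum of m iid vectors, and their
   joint limit as t goes to infinity yields m iid vectors with sum psi. *)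

Require Import Defs.
From HB Require Import structures.
From mathcomp Require Import all_boot all_order all_algebra.
From mathcomp Require Import -(notations) mpoly.
From mathcomp Require Import all_classical all_reals all_analysis.
From mathcomp Require Import ring lra measurable_realfun.

Set Implicit Arguments.
Unset Strict Implicit.
Unset Printing Implicit Defensive.

Import Order.TTheory GRing.Theory Num.Theory.
Import numFieldNormedType.Exports.

Local Open Scope classical_set_scope.
Local Open Scope ring_scope.

(** * Extension of contents on cylinder sets *)

(** The index set [E] is arbitrary and a limit along an ultrafilter is only finitely additive, so
    neither limit taken in the proof is a law by itself. Both are turned into laws in the same way:
    a nonnegative path is coded by the bits telling which dyadic thresholds its values exceed. Bit
    families form a compact space, so a finitely additive content on cylinders is countably additive
    there and extends to a probability; tightness keeps the decoded values finite. The price is that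
    the law agrees with the limit functional on bounded Lipschitz functions of finitely many
    coordinates only, which is why all estimates are made with such functions.

    In the converse the Poisson counts replace the search for a convolution root by algebra on power
    series, where nonnegativity of the root is read off a recursion. The root has to be truncated to
    become a polynomial, so the approximating vectors have a total mass slightly below one. With
    [t = N ^ 2] both this defect and the Poisson fluctuations of the rescaled counts are of order
    [1 / N]. *)

(** Finite sets of coordinates are lists and agreement is a recursion on the list: no decidable
    equality on [K] is assumed. *)
Fixpoint agree (K : Type) (s : seq K) (w w' : K -> bool) : Prop :=
  if s is b :: s' then w b = w' b /\ agree s' w w' else True.

Definition depends_on (K V : Type) (s : seq K) (g : (K -> bool) -> V) : Prop :=
  forall w w', agree s w w' -> g w = g w'.

Definition cylinder (K : Type) (A : set (K -> bool)) : Prop :=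
  exists s, depends_on s A.

Definition set_bit (K : Type) (b : K) (c : bool) (w : K -> bool) : K -> bool :=
  fun b' => if pselect (b' = b) then c else w b'.

Section Cylinders.
Context (K : Type).
Implicit Types (w : K -> bool) (s : seq K).

Lemma agree_cat s s' w w' :
  agree (s ++ s') w w' <-> agree s w w' /\ agree s' w w'.
Proof.
elim: s => [|b s IH] /=; first by split => [|[]].
by split=> [[-> /IH[]]|[[-> h1] h2]]; split=> //; apply/IH.
Qed.

Lemma depends_on_comp (V V' : Type) s (g : (K -> bool) -> V) (f : V -> V') :
  depends_on s g -> depends_on s (f \o g).
Proof. by move=> h w w' /h /= ->. Qed.

Lemma depends_on_pair (V V' : Type) s s' (g : (K -> bool) -> V)
    (g' : (K -> bool) -> V') :
  depends_on s g -> depends_on s' g' ->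
  depends_on (s ++ s') (fun w => (g w, g' w)).
Proof. by move=> h h' w w' /agree_cat[/h -> /h' ->]. Qed.

Lemma depends_on_preimage (V : Type) s (g : (K -> bool) -> V) (B : set V) :
  depends_on s g -> cylinder (g @^-1` B).
Proof. by move=> h; exists s; exact: (@depends_on_comp _ _ s g B). Qed.

Lemma cylinder0 : cylinder (set0 : set (K -> bool)).
Proof. by exists [::]. Qed.

Lemma cylinderC : setC_closed (@cylinder K).
Proof. by move=> A [s As]; exists s; exact: (@depends_on_comp _ _ s A not). Qed.

Lemma cylinderI : setI_closed (@cylinder K).
Proof.
move=> A B [s As] [s' Bs]; exists (s ++ s').
exact: (@depends_on_comp _ _ _ _ (fun p => p.1 /\ p.2) (depends_on_pair As Bs)).
Qed.

Lemma cylinderU : setU_closed (@cylinder K).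
Proof.
move=> A B mA mB; rewrite -(setCK A) -(setCK B) -setCI.
by apply: cylinderC; apply: cylinderI; exact: cylinderC.
Qed.

Lemma cylinder_bigsetU n (F : nat -> set (K -> bool)) :
  (forall k, cylinder (F k)) -> cylinder (\big[setU/set0]_(k < n) F k).
Proof.
move=> cF; elim/big_ind: _ => //; [exact: cylinder0|exact: cylinderU].
Qed.

(** Freezing a bit removes it from the list: the induction step for statements about functions of
    finitely many bits. *)
Lemma depends_on_set_bit (V : Type) b c s (g : (K -> bool) -> V) :
  depends_on (b :: s) g -> depends_on s (g \o set_bit b c).
Proof.
move=> gs w w' ww'; apply: gs; split; first by rewrite /set_bit; case: pselect.
elim: s ww' => //= b' s IH [e /IH h]; split=> //.
by rewrite /set_bit; case: pselect.
Qed.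

Lemma set_bit_id b w : set_bit b (w b) w = w.
Proof. by apply/funext => b'; rewrite /set_bit; case: pselect => //= e; rewrite e. Qed.

(* Compactness of the space of bit families: the ultrafilter containing all the
   F n converges to the family w below. *)
Lemma cylinder_compact (F : nat -> set (K -> bool)) :
  (forall n, cylinder (F n)) -> (forall n, F n !=set0) ->
  (forall m n, (m <= n)%N -> F n `<=` F m) -> \bigcap_n F n !=set0.
Proof.
move=> cF F0 mF.
pose G : set_system (K -> bool) := filter_from setT F.
have GF : ProperFilter G.
  apply: filter_from_proper => //.
  apply: filter_from_filter; first by exists 0%N.
  move=> i j _ _; exists (maxn i j) => // w Fw.
  by split; apply: mF Fw; rewrite ?leq_maxl ?leq_maxr.
have [U [UU GU]] := ultraFilterLemma GF.
pose w b := `[< U [set w' | w' b] >].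
exists w => n _; have [s hs] := cF n.
suff Us : U [set w' | agree s w w'].
  have UF : U (F n) by apply: GU; exists n.
  have [w' [/= ww' Fw']] := filter_ex (filterI Us UF).
  by rewrite (hs w w' ww').
elim: s {hs} => [|b s IH] /=; first exact: filterT.
apply: filterS (filterI IH _); first by move=> w' [h1 h2]; split; [exact: h2|].
rewrite /w; have [/asboolP h|/asboolP h] := boolP `[< U [set w' | w' b] >].
  by apply: filterS h => w'.
have [//|] := in_ultra_setVsetC [set w' : K -> bool | w' b] UU.
by apply: filterS => w' /= /negP /negbTE ->.
Qed.

End Cylinders.

Definition bit_space (K : Type) := K -> bool.
HB.instance Definition _ (K : Type) := Pointed.copy (bit_space K) (K -> bool).
HB.instance Definition _ (K : Type) :=
  @isAlgebraOfSets.Build default_measure_display (bit_space K) (@cylinder K)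
    (@cylinder0 K) (@cylinderU K) (@cylinderC K).

Section CylinderExtension.
Context (K : Type) (R : realType) (mu0 : set (K -> bool) -> R).
Context (mu0_ge0 : forall A, cylinder A -> 0 <= mu0 A).
Context (mu0U : forall A B, cylinder A -> cylinder B -> A `&` B = set0 ->
  mu0 (A `|` B) = mu0 A + mu0 B).

(* The norm makes the set function nonnegative off the cylinders too. *)
Definition cylinder_content (A : set (bit_space K)) : \bar R := `|mu0 A|%:E.

Local Lemma mu0_set0 : mu0 set0 = 0.
Proof.
have := mu0U (cylinder0 K) (cylinder0 K) (setI0 _).
by rewrite setU0 => /eqP; rewrite -subr_eq0 opprD addNKr oppr_eq0 => /eqP.
Qed.

Local Lemma cylinder_content0 : cylinder_content set0 = 0%E.
Proof. by rewrite /cylinder_content mu0_set0 normr0. Qed.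

Local Lemma cylinder_content_ge0 A : (0 <= cylinder_content A)%E.
Proof. by rewrite lee_fin normr_ge0. Qed.

Local Lemma cylinder_content_sum (F : nat -> set (bit_space K)) n :
  (forall k, cylinder (F k)) -> trivIset setT F ->
  cylinder_content (\big[setU/set0]_(k < n) F k) =
  (\sum_(k < n) cylinder_content (F k))%E.
Proof.
move=> cF tF; elim: n => [|n IH]; first by rewrite !big_ord0 cylinder_content0.
rewrite !big_ord_recr /= -IH.
have cU := cylinder_bigsetU n cF.
rewrite /cylinder_content mu0U //; first by
  rewrite ger0_norm ?addr_ge0 ?mu0_ge0 // EFinD !ger0_norm ?mu0_ge0.
apply/seteqP; split => // w []; rewrite -bigcup_mkord => -[k /= kn Fk] Fn.
have /= e : k = n by apply: (tF k n) => //; exists w.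
by rewrite e ltnn in kn.
Qed.

(** The cylinders [G n] not covered by the first [n] sets decrease to the empty set, so by
    compactness one of them is empty. Only finitely many sets matter and the partial sums are
    eventually constant. *)
Local Lemma cylinder_content_sigma_additive : semi_sigma_additive cylinder_content.
Proof.
move=> F cF tF cUF.
pose G n := (\bigcup_k F k) `\` \big[setU/set0]_(k < n) F k.
have cG n : cylinder (G n).
  by rewrite /G setDE; apply: cylinderI => //; apply: cylinderC;
    exact: cylinder_bigsetU.
have [N GN] : exists N, G N = set0.
  apply: contrapT => /forallNP GN.
  have G0 n : G n !=set0 by apply/set0P/eqP.
  have [|w wG] := cylinder_compact cG G0.
    move=> m n mn w [Fw nFw]; split=> //; apply: contra_not nFw.
    rewrite -!bigcup_mkord => -[k /= km Fkw]; exists k => //=.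
    exact: leq_trans km mn.
  have [[k _ Fkw] _] := wG 0%N I.
  have [_] := wG k.+1 I; apply; rewrite -bigcup_mkord; exists k => //=.
have UN n : (N <= n)%N -> \big[setU/set0]_(k < n) F k = \bigcup_k F k.
  move=> Nn; apply/seteqP; split.
    by rewrite -bigcup_mkord => w [k _ Fk]; exists k.
  move=> w Fw; apply: contrapT => nF.
  suff : G N w by rewrite GN.
  split=> //; apply: contra_not nF.
  rewrite -!bigcup_mkord => -[k /= km Fkw]; exists k => //=.
  exact: leq_trans km Nn.
apply: cvg_near_cst; exists N => // n /= Nn.
by rewrite -(UN n Nn) cylinder_content_sum // big_mkord.
Qed.

HB.instance Definition _ := isMeasure.Build _ (bit_space K) R cylinder_content
  cylinder_content0 cylinder_content_ge0 cylinder_content_sigma_additive.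

(** Compactness has turned finite additivity into a measure on the algebra of cylinders;
    Caratheodory extension does the rest. *)
Lemma cylinder_extension : mu0 setT = 1 ->
  exists P : probability (g_sigma_algebraType (@measurable _ (bit_space K))) R,
    forall A, cylinder A -> P A = (mu0 A)%:E.
Proof.
move=> mu01; pose m := measure_extension cylinder_content.
have mE A : cylinder A -> m A = (mu0 A)%:E.
  move=> cA; rewrite /m/= /measure_extension measurable_mu_extE //=.
  by rewrite /cylinder_content ger0_norm // mu0_ge0.
have mT : m setT = 1%E.
  by rewrite mE ?mu01 //; rewrite -setC0; apply: cylinderC; exact: cylinder0.
pose isP := Measure_isProbability.Build _ _ R m mT.
pose P : probability _ R := HB.pack m isP.
by exists P.
Qed.

End CylinderExtension.

(** * Bounded measurable and integrable real functions under a probability *)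

(* bmf: bounded measurable function. *)
Definition bmf (d : measure_display) (T : measurableType d) (R : realType)
    (f : T -> R) : Prop :=
  measurable_fun setT f /\ exists M : R, forall t, `|f t| <= M.

Section BoundedMeasurable.
Context (d : measure_display) (T : measurableType d) (R : realType).
Implicit Types f g : T -> R.

Lemma bmf_cst (c : R) : bmf (fun _ : T => c).
Proof. by split; [exact: measurable_cst|exists `|c|]. Qed.

Lemma bmfD f g : bmf f -> bmf g -> bmf (fun t => f t + g t).
Proof.
move=> [mf [M fM]] [mg [N gN]]; split; first exact: measurable_funD.
by exists (M + N) => t; rewrite (le_trans (ler_normD _ _))// lerD.
Qed.

Lemma bmfM f g : bmf f -> bmf g -> bmf (fun t => f t * g t).
Proof.
move=> [mf [M fM]] [mg [N gN]]; split; first exact: measurable_funM.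
by exists (M * N) => t; rewrite normrM ler_pM.
Qed.

Lemma bmfZ (c : R) f : bmf f -> bmf (fun t => c * f t).
Proof. by move=> bf; apply: bmfM => //; exact: bmf_cst. Qed.

Lemma bmfN f : bmf f -> bmf (fun t => - f t).
Proof.
move=> [mf [M fM]]; split; first exact: measurable_funN.
by exists M => t; rewrite normrN.
Qed.

Lemma bmfB f g : bmf f -> bmf g -> bmf (fun t => f t - g t).
Proof. by move=> bf bg; apply: bmfD => //; exact: bmfN. Qed.

Lemma bmf_sum (I : Type) (s : seq I) (F : I -> T -> R) :
  (forall i, bmf (F i)) -> bmf (fun t => \sum_(i <- s) F i t).
Proof.
move=> bF; elim: s => [|i s IH].
  by under eq_fun do rewrite big_nil; exact: bmf_cst.
by under eq_fun do rewrite big_cons; exact: bmfD.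
Qed.

Lemma bmf_prod (I : Type) (s : seq I) (F : I -> T -> R) :
  (forall i, bmf (F i)) -> bmf (fun t => \prod_(i <- s) F i t).
Proof.
move=> bF; elim: s => [|i s IH].
  by under eq_fun do rewrite big_nil; exact: bmf_cst.
by under eq_fun do rewrite big_cons; exact: bmfM.
Qed.

Lemma bmf_indic (A : set T) : measurable A -> bmf (\1_A : T -> R).
Proof.
move=> mA; split; first exact: measurable_indic.
by exists 1 => t; rewrite indicE; case: (t \in A); rewrite ?normr1 ?normr0 // ler01.
Qed.

Lemma bmf_bool (b : T -> bool) :
  measurable_fun setT b -> bmf (fun t => (b t)%:R : R).
Proof.
move=> mb; split; last by exists 1 => t; case: (b t); rewrite ?normr1 ?normr0.
rewrite (_ : (fun t => _) = fun t => if b t then 1 else 0).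
  by apply: measurable_fun_ifT => //; exact: measurable_cst.
by apply/funext => t; case: (b t).
Qed.

Lemma bmf_comp (d' : measure_display) (T' : measurableType d') (W : T' -> T) f :
  measurable_fun setT W -> bmf f -> bmf (fun t => f (W t)).
Proof.
move=> mW [mf [M fM]]; split; last by exists M.
exact: (measurableT_comp mf).
Qed.

End BoundedMeasurable.

Definition L1 (d : measure_display) (T : measurableType d) (R : realType)
    (P : probability T R) (f : T -> R) : Prop :=
  P.-integrable setT (EFin \o f).

Section RealIntegrable.
Context (d : measure_display) (T : measurableType d) (R : realType).
Context (P : probability T R).
Implicit Types f g : T -> R.

Lemma L1_bmf f : bmf f -> L1 P f.
Proof.
move=> [mf [M fM]].
apply: (le_integrable measurableT (g := EFin \o cst M)).
- exact/measurable_EFinP.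
- move=> t _; rewrite !abse_EFin lee_fin /=.
  by rewrite (le_trans (fM t)) // ler_norm.
- by apply/finite_measure_integrable_cst.
Qed.

Lemma L1_measurable f : L1 P f -> measurable_fun setT f.
Proof. by move=> /(measurable_int P) /measurable_EFinP. Qed.

Lemma L1_le f g : measurable_fun setT f -> (forall t, `|f t| <= g t) ->
  L1 P g -> L1 P f.
Proof.
move=> mf fg; apply: le_integrable => //; first exact/measurable_EFinP.
by move=> t _; rewrite !abse_EFin lee_fin (le_trans (fg t)) // ler_norm.
Qed.

Lemma L1D f g : L1 P f -> L1 P g -> L1 P (fun t => f t + g t).
Proof. by move=> Lf Lg; exact: (integrableD measurableT Lf Lg). Qed.

Lemma L1Z c f : L1 P f -> L1 P (fun t => c * f t).
Proof. by move=> Lf; exact: (integrableZl measurableT c Lf). Qed.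

Lemma L1B f g : L1 P f -> L1 P g -> L1 P (fun t => f t - g t).
Proof. by move=> Lf Lg; exact: (integrableB measurableT Lf Lg). Qed.

Lemma L1_sum (I : Type) (s : seq I) (F : I -> T -> R) :
  (forall i, L1 P (F i)) -> L1 P (fun t => \sum_(i <- s) F i t).
Proof.
move=> LF; elim: s => [|i s IH].
  by under eq_fun do rewrite big_nil; apply: L1_bmf; exact: bmf_cst.
by under eq_fun do rewrite big_cons; exact: L1D.
Qed.

Lemma L1M f g : L1 P f -> bmf g -> L1 P (fun t => f t * g t).
Proof.
move=> Lf [mg [M gM]]; have M0 : 0 <= M by apply: le_trans (gM point).
apply: (@L1_le _ (fun t => M * `|f t|)).
- by apply: measurable_funM => //; exact: L1_measurable.
- by move=> t; rewrite normrM mulrC ler_wpM2r.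
- by apply: L1Z; exact: (integrable_abse Lf).
Qed.

Lemma RintD f g : L1 P f -> L1 P g ->
  \int[P]_t (f t + g t) = \int[P]_t f t + \int[P]_t g t.
Proof. by move=> Lf Lg; rewrite RintegralD. Qed.

Lemma RintB f g : L1 P f -> L1 P g ->
  \int[P]_t (f t - g t) = \int[P]_t f t - \int[P]_t g t.
Proof. by move=> Lf Lg; rewrite RintegralB. Qed.

Lemma RintZ c f : L1 P f -> \int[P]_t (c * f t) = c * \int[P]_t f t.
Proof. by move=> Lf; rewrite RintegralZl. Qed.

Lemma Rexp_cst (c : R) : \int[P]_t c = c.
Proof. by rewrite /Rintegral integral_cst//= (probability_setT P) mule1. Qed.

Lemma Rint_sum (I : Type) (s : seq I) (F : I -> T -> R) :
  (forall i, L1 P (F i)) ->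
  \int[P]_t (\sum_(i <- s) F i t) = \sum_(i <- s) \int[P]_t F i t.
Proof.
move=> LF; elim: s => [|i s IH].
  by under eq_Rintegral do rewrite big_nil; rewrite big_nil Rexp_cst.
under eq_Rintegral do rewrite big_cons.
by rewrite RintD ?IH ?big_cons //; exact: L1_sum.
Qed.

Lemma le_Rint f g : L1 P f -> L1 P g -> (forall t, f t <= g t) ->
  \int[P]_t f t <= \int[P]_t g t.
Proof. by move=> Lf Lg fg; apply: le_Rintegral. Qed.

Lemma Rint_norm_le f g : L1 P f -> L1 P g -> (forall t, `|f t| <= g t) ->
  `|\int[P]_t f t| <= \int[P]_t g t.
Proof.
move=> Lf Lg fg; apply: (le_trans (le_normr_Rintegral _ Lf)) => //.
by apply: le_Rint => //; exact: (integrable_abse Lf).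
Qed.

Lemma Rint_ge0 f : (forall t, 0 <= f t) -> 0 <= \int[P]_t f t.
Proof. by move=> f0; exact: Rintegral_ge0. Qed.

Lemma RexpD f g : bmf f -> bmf g ->
  \int[P]_t (f t + g t) = \int[P]_t f t + \int[P]_t g t.
Proof. by move=> bf bg; apply: RintD; exact: L1_bmf. Qed.

Lemma RexpB f g : bmf f -> bmf g ->
  \int[P]_t (f t - g t) = \int[P]_t f t - \int[P]_t g t.
Proof. by move=> bf bg; apply: RintB; exact: L1_bmf. Qed.

Lemma RexpZ (c : R) f : bmf f -> \int[P]_t (c * f t) = c * \int[P]_t f t.
Proof. by move=> bf; apply: RintZ; exact: L1_bmf. Qed.

Lemma Rexp_sum (I : Type) (s : seq I) (F : I -> T -> R) : (forall i, bmf (F i)) ->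
  \int[P]_t (\sum_(i <- s) F i t) = \sum_(i <- s) \int[P]_t F i t.
Proof. by move=> bF; apply: Rint_sum => i; exact: L1_bmf. Qed.

Lemma le_Rexp f g : bmf f -> bmf g -> (forall t, f t <= g t) ->
  \int[P]_t f t <= \int[P]_t g t.
Proof. by move=> bf bg; apply: le_Rint; exact: L1_bmf. Qed.

Lemma Rexp_norm_le f (M : R) : bmf f -> (forall t, `|f t| <= M) ->
  `|\int[P]_t f t| <= M.
Proof.
move=> bf fM; rewrite -[leRHS]Rexp_cst.
by apply: Rint_norm_le => //; apply: L1_bmf => //; exact: bmf_cst.
Qed.

Lemma Rexp_indic (A : set T) : measurable A -> \int[P]_t \1_A t = fine (P A).
Proof. by move=> mA; rewrite /Rintegral integral_indic// setIT. Qed.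

Lemma Rexp_dominated_cvg (f_ : nat -> T -> R) f g :
  (forall k, measurable_fun setT (f_ k)) -> measurable_fun setT f ->
  L1 P g -> (forall k t, `|f_ k t| <= g t) ->
  (\forall t \ae P, (fun k => f_ k t) @ \oo --> f t) ->
  (fun k => \int[P]_t f_ k t) @ \oo --> \int[P]_t f t.
Proof.
move=> mf_ mf ig fg fcvg.
have m_ k : measurable_fun setT (EFin \o f_ k) by exact/measurable_EFinP.
have m : measurable_fun setT (EFin \o f) by exact/measurable_EFinP.
have ae1 : \forall t \ae P, setT t -> (fun k => (f_ k t)%:E) @ \oo --> (f t)%:E.
  apply: (@filterS _ _ (ae_filter_ringOfSetsType P)) fcvg => t ft _.
  by apply: cvg_EFin => //; exact: nearW.
have ae2 : \forall t \ae P, forall k, setT t -> (`|(f_ k t)%:E| <= (EFin \o g) t)%E.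
  by apply: aeW => t k _; rewrite abse_EFin lee_fin; exact: fg.
have [if_ _ H] := dominated_convergence measurableT m_ m ae1 ig ae2.
by apply: fine_cvg; rewrite /Rintegral fineK //; exact: integrable_fin_num.
Qed.

End RealIntegrable.


(** * Product sigma-algebras on paths and tuples *)

Section PathSpace.
Context (I : Type) (R : realType).

Definition coordinate_sets : set (set (I -> R)) :=
  [set C | exists i : I, exists2 B : set R, measurable B &
    C = (fun z => z i) @^-1` B].

Definition path_space := g_sigma_algebraType coordinate_sets.

Lemma measurable_coordinate (i : I) :
  measurable_fun setT (fun z : path_space => z i).
Proof.
move=> _ B mB; rewrite setTI; apply: sub_sigma_algebra.
by exists i, B.
Qed.

Lemma measurable_path (d : measure_display) (T : measurableType d)
    (Z : T -> I -> R) : (forall i, measurable_fun setT (fun t => Z t i)) ->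
  measurable_fun setT (Z : T -> path_space).
Proof.
move=> mZ; apply: (@measurability _ _ T path_space setT Z coordinate_sets) => //.
move=> _ [_ [i [B mB ->]] <-]; rewrite -[X in measurable X]/([set: T] `&` (fun t => Z t i) @^-1` B).
exact: mZ.
Qed.

End PathSpace.

Section MeasurableTuple.
Context (d : measure_display) (T : measurableType d) (R : realType) (E : Type).

Lemma measurable_marginal (X : E -> T -> R) n (x : n.-tuple E) :
  (forall e, measurable_fun setT (X e)) -> measurable_fun setT (marginal X x).
Proof.
move=> mX; apply/measurable_fun_tnthP => i.
by rewrite (_ : _ \o _ = X (tnth x i)) //; apply/funext => t /=; rewrite tnth_mktuple.
Qed.

End MeasurableTuple.

(* blip: bounded Lipschitz. *)
Definition blip (R : realType) n (h : n.-tuple R -> R) : Prop :=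
  measurable_fun setT h /\
  exists M : R, [/\ 0 <= M, forall y, `|h y| <= M &
    forall y z, `|h y - h z| <= M * \sum_(i < n) `|tnth y i - tnth z i|].

Lemma blip_bmf (R : realType) n (h : n.-tuple R -> R) : blip h -> bmf h.
Proof. by move=> [mh [M [_ hM _]]]; split=> //; exists M. Qed.

(** Induction on the list: a function of the bits is the mixture, with weights [W t b] and
    [1 - W t b], of its two versions with bit [b] frozen. *)
Lemma cylinder_bmf (K : Type) (d : measure_display) (T : measurableType d)
    (R : realType) (W : T -> K -> bool) (s : seq K) (g : (K -> bool) -> R) :
  (forall b, measurable_fun setT (W^~ b)) -> depends_on s g -> bmf (g \o W).
Proof.
move=> mW; elim: s g => [|b s IH] g gs.
  rewrite (_ : g \o W = fun=> g point); first exact: bmf_cst.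
  by apply/funext => t /=; apply: gs.
have -> : g \o W = fun t =>
    (W t b)%:R * (g \o set_bit b true \o W) t +
    (1 - (W t b)%:R) * (g \o set_bit b false \o W) t.
  apply/funext => t /=; rewrite -{1}(set_bit_id b (W t)).
  by case: (W t b); rewrite /= ?mul1r ?mul0r ?subrr ?subr0 ?mul1r ?mul0r ?addr0 ?add0r.
have bb := @bmf_bool _ _ R _ (mW b).
apply: bmfD; apply: bmfM => //; try exact/IH/depends_on_set_bit.
by apply: bmfB => //; exact: bmf_cst.
Qed.

(** The sum counts the integers from 1 to [N] that are below [t]. Applied to a large multiple of a
    function, this unit error quantizes the function by indicators of its level sets. *)
Lemma count_below_le (R : realType) (t : R) N : 0 <= t ->
  `|\sum_(j < N) ((j.+1%:R < t)%R)%:R - Num.min t N%:R| <= 1.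
Proof.
move=> t0.
have full M : M%:R < t -> \sum_(j < M) ((j.+1%:R < t)%R)%:R = M%:R :> R.
  move=> Mt; rewrite (eq_bigr (fun=> 1)); first by rewrite sumr_const card_ord.
  move=> j _; suff -> : j.+1%:R < t by [].
  by apply: le_lt_trans Mt; rewrite ler_nat ltn_ord.
elim: N => [|N IH]; first by rewrite big_ord0 (min_r t0) subrr normr0.
have [Nt|tN] := ltP N.+1%:R t.
  by rewrite full // subrr normr0.
rewrite big_ord_recr /= ltNge tN /= addr0.
have [Nt|tN'] := ltP N%:R t; last by move: IH; rewrite (min_l tN').
by rewrite full // distrC ler_norml -natr1 in tN *; lra.
Qed.

(** * Processes from positive functionals *)

Lemma agree_map (J : eqType) (K : Type) (f : J -> K) (s : seq J)
    (w w' : K -> bool) j :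
  agree (map f s) w w' -> j \in s -> w (f j) = w' (f j).
Proof.
elim: s => //= j' s IH [e /IH h]; rewrite inE.
by case/orP => [/eqP ->|/h].
Qed.

Lemma agree_flatten (J : eqType) (K : Type) (f : J -> seq K) (s : seq J)
    (w w' : K -> bool) j :
  agree (flatten (map f s)) w w' -> j \in s -> agree (f j) w w'.
Proof.
elim: s => //= j' s IH /agree_cat[e /IH h]; rewrite inE.
by case/orP => [/eqP ->|/h].
Qed.

(* Bit (i, k, j) of the code of z tells whether z i exceeds (j + 1) / 2 ^ k. *)
Definition path_code (I : Type) (R : realType) (z : I -> R)
    (b : I * nat * nat) : bool :=
  b.2.+1%:R < z b.1.1 * 2 ^+ b.1.2.

(** The [4 ^ k] thresholds, spaced by [2 ^- k], reach exactly [2 ^ k]: on the code of a nonnegative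
    [z] this is [z i] truncated at [2 ^ k], up to an error of [2 ^- k]. *)
Definition dyadic (I : Type) (R : realType) (k : nat) (w : I * nat * nat -> bool)
    (i : I) : R :=
  (\sum_(j < 4 ^ k) (w (i, k, val j))%:R) / 2 ^+ k.

Section Decode.
Context (I : Type) (R : realType).
Implicit Types (z : I -> R) (w : I * nat * nat -> bool).

Lemma depends_on_dyadic k (i : I) :
  depends_on [seq (i, k, val j) | j <- enum 'I_(4 ^ k)] (fun w => dyadic R k w i).
Proof.
move=> w w' ww'; rewrite /dyadic; congr (_ / _); apply: eq_bigr => j _.
by rewrite (agree_map ww') // mem_enum.
Qed.

Lemma depends_on_dyadics k n (x : n.-tuple I) (h : n.-tuple R -> R) :
  exists s, depends_on s (fun w => h [tuple dyadic R k w (tnth x i) | i < n]).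
Proof.
exists (flatten [seq [seq (tnth x i, k, val j) | j <- enum 'I_(4 ^ k)] | i <- enum 'I_n]).
move=> w w' ww'; congr h; apply: eq_from_tnth => i; rewrite !tnth_mktuple.
by apply: depends_on_dyadic; apply: (agree_flatten ww'); rewrite mem_enum.
Qed.


Lemma dyadic_code k z i : 0 <= z i ->
  `|dyadic R k (path_code z) i - Num.min (z i) (2 ^+ k)| <= (2 ^+ k)^-1.
Proof.
move=> z0; have p0 : 0 < 2 ^+ k :> R by rewrite exprn_gt0.
have zk0 : 0 <= z i * 2 ^+ k by rewrite mulr_ge0 // ltW.
have := count_below_le (4 ^ k) zk0.
have -> : Num.min (z i * 2 ^+ k) (4 ^ k)%:R = Num.min (z i) (2 ^+ k) * 2 ^+ k.
  by rewrite minr_pMl ?(ltW p0) // natrX -exprD addnn -mul2n exprM (_ : 2 ^+ 2 = 4%:R) // expr2 -natrM.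
move=> h.
have -> : dyadic R k (path_code z) i - Num.min (z i) (2 ^+ k) =
    (\sum_(j < 4 ^ k) ((j.+1%:R < z i * 2 ^+ k)%R)%:R -
     Num.min (z i) (2 ^+ k) * 2 ^+ k) / 2 ^+ k.
  by rewrite mulrBl mulfK ?gt_eqF.
rewrite normrM normfV (gtr0_norm p0) -[leRHS]mul1r ler_wpM2r //.
Qed.

(** Both levels round the same [z i]. The inequality involves bits only, so it makes sense for
    families that are not codes and can be passed to a probability on bit families. *)
Lemma dyadic_code_compat k l z i : (k <= l)%N -> 0 <= z i ->
  `|dyadic R k (path_code z) i - Num.min (dyadic R l (path_code z) i) (2 ^+ k)|
   <= 2 * (2 ^+ k)^-1.
Proof.
move=> kl z0; have hk := dyadic_code k z0; have hl := dyadic_code l z0.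
have le1 : (2 ^+ l)^-1 <= (2 ^+ k)^-1 :> R.
  by rewrite lef_pV2 ?posrE ?exprn_gt0 // ler_weXn2l // ler1n.
have le2 : 2 ^+ k <= 2 ^+ l :> R by rewrite ler_weXn2l // ler1n.
move: hk hl le1 le2; set a := dyadic _ _ _ _; set b := dyadic _ _ _ _.
set u := 2 ^+ k; set v := 2 ^+ l; set e := u^-1; set e' := v^-1.
move=> hk hl le1 le2; have uv : Num.min (z i) u = Num.min (Num.min (z i) v) u.
  by rewrite -minA (min_r le2).
have : `|Num.min (Num.min (z i) v) u - Num.min b u| <= e'.
  rewrite distrC; move: hl; set m := Num.min (z i) v.
  rewrite !ler_norml => /andP[h1 h2].
  by case: (leP b u) => ?; case: (leP m u) => ?; apply/andP; split; lra.
rewrite -uv; move: hk; rewrite !ler_norml => /andP[h1 h2] /andP[h3 h4].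
by apply/andP; split; lra.
Qed.

(** A limit superior is defined and measurable for every bit family, also where the approximations
    diverge. *)
Definition dyadic_lim (i : I) (w : I * nat * nat -> bool) : R :=
  fine (limn_esup (fun k => (dyadic R k w i)%:E)).

(** If a later level reached [2 ^ k0], compatibility would push level [k0] up to [2 ^ k0 - 2]. So
    the second hypothesis bounds the sequence, the truncations become inactive, and compatibility is
    the Cauchy property. *)
Lemma dyadic_cvg i w :
  (forall k l, (k <= l)%N ->
    `|dyadic R k w i - Num.min (dyadic R l w i) (2 ^+ k)| <= 2 * (2 ^+ k)^-1) ->
  (exists k, dyadic R k w i < 2 ^+ k - 2) ->
  (fun k => dyadic R k w i) @ \oo --> dyadic_lim i w.
Proof.
move=> compat [k0 hk0].
have bnd l : (k0 <= l)%N -> dyadic R l w i < 2 ^+ k0.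
  move=> kl; have := compat _ _ kl; rewrite ler_norml => /andP[h _].
  have e1 : (2 ^+ k0)^-1 <= 1 :> R.
    by rewrite invf_le1 ?exprn_gt0 // exprn_ege1 // ler1n.
  by move: h; case: (leP (dyadic R l w i) (2 ^+ k0)) => ?; lra.
have cau k l : (k0 <= k)%N -> (k <= l)%N ->
    `|dyadic R k w i - dyadic R l w i| <= 2 * (2 ^+ k)^-1.
  move=> k0k kl; have := compat _ _ kl; rewrite min_l //.
  apply: (le_trans (ltW (bnd l (leq_trans k0k kl)))).
  by rewrite ler_weXn2l // ler1n.
have cv : cvgn (fun k => dyadic R k w i).
  apply/cauchy_cvgP; apply: cauchy_exP => e e0.
  have : (fun k => 2 * (2 ^+ k)^-1 : R) @ \oo --> (0 : R).
    rewrite -[X in _ --> X](mulr0 2); apply: cvgMr.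
    rewrite (_ : (fun k => _) = geometric 1 (2^-1)); last first.
      by apply/funext => k /=; rewrite mul1r exprVn.
    by apply: cvg_geometric; rewrite ger0_norm ?invr_ge0 //; lra.
  move=> /cvgrPdist_lt/(_ e e0)[N _ hN].
  exists (dyadic R (maxn N k0) w i); exists (maxn N k0) => // l /= hl.
  rewrite /ball /=; apply: (le_lt_trans (cau _ _ (leq_maxr _ _) hl)).
  have := hN _ (leq_maxl N k0); rewrite sub0r normrN.
  by apply: le_lt_trans; exact: ler_norm.
rewrite /dyadic_lim is_cvg_limn_esupE; last first.
  by apply/cvg_ex; have /cvg_ex[l hl] := cv; exists l%:E; apply: cvg_EFin => //; exact: nearW.
by rewrite (@EFin_lim _ (fun k => dyadic R k w i)).
Qed.

End Decode.

(** Positivity is tested on nonnegative paths only, so [L] sees these paths only. Additivity is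
    finite, as it is what survives limits along an ultrafilter. *)
Definition positive_functional (I : Type) (R : realType)
    (L : (path_space I R -> R) -> R) : Prop :=
  [/\ forall f g, bmf f -> bmf g -> L (fun z => f z + g z) = L f + L g,
      forall c f, bmf f -> L (fun z => c * f z) = c * L f
    & forall f : path_space I R -> R, bmf f ->
        (forall z : I -> R, (forall i, 0 <= z i) -> 0 <= f z) -> 0 <= L f].

Section PositiveFunctional.
Context (I : Type) (R : realType) (L : (path_space I R -> R) -> R).
Context (pL : positive_functional L).
Implicit Types f g : path_space I R -> R.

Lemma pfunB f g : bmf f -> bmf g -> L (fun z => f z - g z) = L f - L g.
Proof.
have [LD LZ _] := pL; move=> bf bg.
rewrite (_ : (fun z => _) = fun z => f z + (-1) * g z); last first.
  by apply/funext => z; rewrite mulN1r.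
by rewrite LD ?LZ ?mulN1r //; exact: bmfZ.
Qed.

Lemma pfun_le f g : bmf f -> bmf g ->
  (forall z : I -> R, (forall i, 0 <= z i) -> f z <= g z) -> L f <= L g.
Proof.
have [_ _ L0] := pL; move=> bf bg fg.
rewrite -subr_ge0 -pfunB //; apply: L0; first exact: bmfB.
by move=> z z0; rewrite subr_ge0 fg.
Qed.

Lemma pfun_cst c : L (fun=> c) = c * L (fun=> 1).
Proof.
have [_ LZ _] := pL; rewrite -LZ; last exact: bmf_cst.
by congr L; apply/funext => z; rewrite mulr1.
Qed.

Lemma pfun_norm_le f g : bmf f -> bmf g ->
  (forall z : I -> R, (forall i, 0 <= z i) -> `|f z| <= g z) -> `|L f| <= L g.
Proof.
move=> bf bg fg; rewrite ler_norml; apply/andP; split; last first.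
  by apply: pfun_le => // z z0; rewrite (le_trans (ler_norm _)) ?fg.
have [_ LZ _] := pL; rewrite -mulN1r -LZ //; apply: pfun_le => //.
  exact: bmfZ.
by move=> z z0; have := fg z z0; rewrite mulN1r ler_norml => /andP[].
Qed.

Lemma pfun_sum (J : Type) (s : seq J) (F : J -> path_space I R -> R) :
  (forall j, bmf (F j)) ->
  L (fun z => \sum_(j <- s) F j z) = \sum_(j <- s) L (F j).
Proof.
move=> bF; elim: s => [|j s IH].
  under eq_fun do rewrite big_nil; rewrite big_nil.
  by rewrite pfun_cst mul0r.
under eq_fun do rewrite big_cons; rewrite big_cons -IH.
by have [-> //] := pL; exact: bmf_sum.
Qed.

Lemma bmf_blip n (x : n.-tuple I) h : blip h ->
  bmf (fun z : path_space I R => h [tuple z (tnth x i) | i < n]).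
Proof.
move=> /blip_bmf; apply: bmf_comp; apply/measurable_fun_tnthP => i.
rewrite (_ : _ \o _ = fun z => z (tnth x i)); first exact: measurable_coordinate.
by apply/funext => z /=; rewrite tnth_mktuple.
Qed.

Lemma bmf_gt (K : R) (i : I) :
  bmf (fun z : path_space I R => ((K < z i)%R)%:R : R).
Proof.
apply: bmf_bool; apply: measurable_fun_ltr; first exact: measurable_cst.
exact: measurable_coordinate.
Qed.

Lemma measurable_path_code b :
  measurable_fun setT (fun z : path_space I R => path_code z b).
Proof.
apply: measurable_fun_ltr; first exact: measurable_cst.
by apply: measurable_funM; [exact: measurable_coordinate|exact: measurable_cst].
Qed.

Lemma bmf_code s (g : (I * nat * nat -> bool) -> R) : depends_on s g ->
  bmf (fun z : path_space I R => g (path_code z)).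
Proof. by apply: cylinder_bmf; exact: measurable_path_code. Qed.

Lemma depends_on_indic (K : Type) s (A : set (K -> bool)) :
  depends_on s A -> depends_on s (\1_A : _ -> R).
Proof. move=> As w w' /As e; rewrite !indicE; congr (nat_of_bool _)%:R.
by apply/idP/idP; rewrite !inE e. Qed.

Let Om := g_sigma_algebraType (@measurable _ (bit_space (I * nat * nat))).

Lemma measurable_bit b : measurable_fun setT (fun w : Om => w b).
Proof.
move=> _ B _; rewrite setTI; apply: sub_sigma_algebra.
by apply: (depends_on_preimage (s := [:: b])) => w w' [].
Qed.

Lemma bmf_bits s (g : (I * nat * nat -> bool) -> R) : depends_on s g ->
  bmf (g : Om -> R).
Proof. by apply: (@cylinder_bmf (I * nat * nat) _ Om R id s g); exact: measurable_bit. Qed.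

Section CodeLaw.
Context (P : probability Om R).
Context (PE : forall A, cylinder A -> P A = (L (fun z => \1_A (path_code z)))%:E).

(** Induction on the bits read by [g]. The indicator of [A] collects the bits already split off,
    until [g] is constant and the assumption on [P] applies. *)
Lemma code_law_indic s (g : (I * nat * nat -> bool) -> R) A : depends_on s g ->
  cylinder A ->
  \int[P]_w (\1_A w * g w) = L (fun z => \1_A (path_code z) * g (path_code z)).
Proof.
have [LD LZ _] := pL.
elim: s g A => [|b s IH] g A gs cA.
  have gE w : g w = g point by apply: gs.
  have [s As] := cA.
  rewrite (_ : (fun z => _) = fun z => g point * \1_A (path_code z)); last first.
    by apply/funext => z; rewrite gE mulrC.
  under eq_Rintegral do rewrite gE mulrC.
  rewrite LZ ?RexpZ; last 2 first.
  - exact: (bmf_bits (depends_on_indic As)).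
  - exact: (bmf_code (depends_on_indic As)).
  rewrite (@Rexp_indic _ _ _ P) ?PE //; exact: sub_sigma_algebra.
pose B := [set w : I * nat * nat -> bool | w b].
have cB : cylinder B by exists [:: b] => w w' [+ _]; rewrite /B /= => ->.
pose g1 := g \o set_bit b true; pose g0 := g \o set_bit b false.
have gs1 : depends_on s g1 by exact: depends_on_set_bit.
have gs0 : depends_on s g0 by exact: depends_on_set_bit.
have gE w : \1_A w * g w = \1_(A `&` B) w * g1 w + \1_(A `&` ~` B) w * g0 w.
  have wB : (w \in B) = w b by apply/idP/idP; rewrite inE.
  have gw : g w = g (set_bit b (w b) w) by rewrite set_bit_id.
  rewrite /g1 /g0 /= !indicE !in_setI in_setC wB gw.
  by case: (w b); case: (w \in A); rewrite /= ?(mul1r, mul0r, addr0, add0r).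
under eq_Rintegral do rewrite gE.
have -> : (fun z : path_space I R => \1_A (path_code z) * g (path_code z)) =
    fun z => \1_(A `&` B) (path_code z) * g1 (path_code z) +
             \1_(A `&` ~` B) (path_code z) * g0 (path_code z).
  by apply/funext => z; exact: gE.
have c1 : cylinder (A `&` B) by exact: cylinderI.
have c0 : cylinder (A `&` ~` B) by apply: cylinderI => //; exact: cylinderC.
have [s1 h1] := c1; have [s0 h0] := c0.
rewrite RexpD; last 2 first.
- by apply: bmfM; [exact: (bmf_bits (depends_on_indic h1))|exact: (bmf_bits gs1)].
- by apply: bmfM; [exact: (bmf_bits (depends_on_indic h0))|exact: (bmf_bits gs0)].
rewrite !IH // LD //.
- by apply: bmfM; [exact: (bmf_code (depends_on_indic h1))|exact: (bmf_code gs1)].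
- by apply: bmfM; [exact: (bmf_code (depends_on_indic h0))|exact: (bmf_code gs0)].
Qed.

Lemma code_law s (g : (I * nat * nat -> bool) -> R) : depends_on s g ->
  \int[P]_w g w = L (fun z => g (path_code z)).
Proof.
move=> gs; have := code_law_indic gs (cylinderC (cylinder0 _)).
rewrite setC0; under eq_Rintegral do rewrite indicT mul1r.
by move=> ->; congr L; apply/funext => z; rewrite indicE in_setT mul1r.
Qed.

(** The channel through which properties of codes that involve finitely many bits become almost sure
    under [P]. *)
Lemma code_law_null A : cylinder A ->
  (forall z : I -> R, (forall i, 0 <= z i) -> ~ A (path_code z)) -> P A = 0%E.
Proof.
move=> cA Az; rewrite PE //; congr EFin; apply/le_anti.
have [s As] := cA; have [_ _ L0] := pL.
have bA := bmf_code (depends_on_indic As).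
rewrite L0 // andbT -[leRHS](mul0r (L (fun=> 1))) -pfun_cst.
apply: pfun_le => //; first exact: bmf_cst.
by move=> z z0; rewrite indicE memNset //; exact: Az.
Qed.

End CodeLaw.
End PositiveFunctional.

Lemma exp2_inv_cvg (R : realType) (c : R) :
  (fun k => c * (2 ^+ k)^-1 : R) @ \oo --> (0 : R).
Proof.
rewrite (_ : (fun k => _) = geometric c (2^-1)); last first.
  by apply/funext => k /=; rewrite exprVn.
by apply: cvg_geometric; rewrite ger0_norm ?invr_ge0 //; lra.
Qed.

Lemma cvg_sum_seq (R : realType) (J K : Type) (F : set_system J) (s : seq K)
    (f : K -> J -> R) (l : K -> R) : Filter F ->
  (forall i, f i @ F --> l i) ->
  (fun j => \sum_(i <- s) f i j) @ F --> \sum_(i <- s) l i.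
Proof.
move=> FF fl; elim: s => [|k s IH].
  by rewrite big_nil; under eq_fun do rewrite big_nil; exact: cvg_cst.
by rewrite big_cons; under eq_fun do rewrite big_cons; exact: cvgD.
Qed.

Lemma cvg_sum0 (R : realType) (J : Type) (F : set_system J) (n : nat)
    (f : 'I_n -> J -> R) : Filter F ->
  (forall i, f i @ F --> (0 : R)) ->
  (fun j => \sum_(i < n) f i j) @ F --> (0 : R).
Proof.
move=> FF f0; have := @cvg_sum_seq R J _ F (index_enum 'I_n) f (fun=> 0) FF f0.
by rewrite [X in _ --> X -> _]big1.
Qed.

Section Representation.
Context (I : Type) (R : realType) (L : (path_space I R -> R) -> R).
Context (pL : positive_functional L) (L1 : L (fun=> 1) = 1).
Context (Ltight : forall i e, 0 < e ->
  exists K : R, L (fun z : path_space I R => ((K < z i)%R)%:R) <= e).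
Let Om := g_sigma_algebraType (@measurable _ (bit_space (I * nat * nat))).

Lemma bmf_code_indic A : cylinder A ->
  bmf (fun z : path_space I R => \1_A (path_code z) : R).
Proof.
by move=> [s As]; apply: (@bmf_code I R s (\1_A)); exact: depends_on_indic.
Qed.

(** The margin 4 leaves room for rounding: a code whose value at level [k] is at least [2 ^ k - 2]
    comes from a path with [z i] at least [2 ^ k - 3]. *)
Lemma tight_exp2 i e : 0 < e -> exists k0, forall k, (k0 <= k)%N ->
  L (fun z : path_space I R => ((2 ^+ k - 4 < z i)%R)%:R) <= e.
Proof.
move=> e0; have [K LK] := Ltight i e0.
exists (Num.bound (K + 4)) => k /upper_nthrootP Kk.
apply: le_trans LK; apply: (pfun_le pL); [exact: bmf_gt|exact: bmf_gt|].
move=> z _; have [h|//] := boolP (2 ^+ k - 4 < z i).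
by rewrite (_ : K < z i) //; lra.
Qed.

Lemma tight_exp2_cvg i :
  (fun k => L (fun z : path_space I R => ((2 ^+ k < z i)%R)%:R)) @ \oo --> (0 : R).
Proof.
apply/cvgrPdist_le => e e0; have [k0 hk] := tight_exp2 i e0.
exists k0 => // k /= /hk h; rewrite sub0r normrN ger0_norm; last first.
  have [_ _ L0] := pL; apply: L0; first exact: bmf_gt.
  by move=> z _; case: (_ < _).
apply: le_trans h; apply: (pfun_le pL); [exact: bmf_gt|exact: bmf_gt|].
move=> z _; have [h|//] := boolP (2 ^+ k < z i).
by rewrite (_ : 2 ^+ k - 4 < z i) //; lra.
Qed.

Lemma measurable_dyadic k i : measurable_fun setT (fun w : Om => dyadic R k w i).
Proof. by have [] := bmf_bits (@depends_on_dyadic I R k i). Qed.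

Lemma measurable_dyadic_lim i : measurable_fun setT (dyadic_lim R i : Om -> R).
Proof.
apply: (measurableT_comp (f := fine)).
  exact: fine_measurable.
apply: measurable_fun_limn_esup => k; apply/measurable_EFinP.
exact: measurable_dyadic.
Qed.

Section Law.
Context (P : probability Om R).
Context (PE : forall A, cylinder A ->
  P A = (L (fun z : path_space I R => \1_A (path_code z)))%:E).

(** Incompatibility of two levels is a cylinder that codes of nonnegative paths avoid, hence null.
    The other obstruction, [2 ^ k - 2 <= dyadic R k w i] for all [k], is null by tightness. *)
Lemma dyadic_ae_cvg i :
  \forall w \ae P, (fun k => dyadic R k w i) @ \oo --> dyadic_lim R i w.
Proof.
pose N1 k l := [set w : Om | (k <= l)%N /\
  ~ `|dyadic R k w i - Num.min (dyadic R l w i) (2 ^+ k)| <= 2 * (2 ^+ k)^-1].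
pose B k := [set w : Om | 2 ^+ k - 2 <= dyadic R k w i].
have cB k : cylinder (B k).
  exact: (depends_on_preimage [set r | 2 ^+ k - 2 <= r] (@depends_on_dyadic I R k i)).
have nN1 k l : P.-negligible (N1 k l).
  have cN : cylinder (N1 k l).
    exact: (depends_on_preimage [set p | (k <= l)%N /\
       ~ `|p.1 - Num.min p.2 (2 ^+ k)| <= 2 * (2 ^+ k)^-1 ]
      (depends_on_pair (@depends_on_dyadic I R k i) (@depends_on_dyadic I R l i))).
  apply/negligibleP; first exact: sub_sigma_algebra.
  apply: (code_law_null pL PE cN) => z z0 [kl]; apply.
  exact: dyadic_code_compat.
have nB : P.-negligible (\bigcap_k B k).
  apply/negligibleP.
    by apply: bigcapT_measurable => k; apply: sub_sigma_algebra; exact: cB.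
  apply/le_anti; rewrite measure_ge0 andbT; apply/lee_addgt0Pr => e e0.
  rewrite add0e; have [k0 hk] := tight_exp2 i e0.
  apply: (le_trans (y := P (B k0))).
    apply: le_measure; rewrite ?inE; last by apply: bigcap_inf.
    - by apply: bigcapT_measurable => k; apply: sub_sigma_algebra; exact: cB.
    - by apply: sub_sigma_algebra; exact: cB.
  rewrite PE // lee_fin; apply: le_trans (hk _ (leqnn _)).
  apply: (pfun_le pL); [exact: bmf_code_indic|exact: bmf_gt|].
  move=> z z0; rewrite indicE; have [|//] := boolP (_ \in B k0).
  rewrite inE /B /= => h; rewrite (_ : 2 ^+ k0 - 4 < z i) //.
  have := dyadic_code k0 (z0 i); have e1 : (2 ^+ k0)^-1 <= 1 :> R.
    by rewrite invf_le1 ?exprn_gt0 // exprn_ege1 // ler1n.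
  by rewrite ler_norml => /andP[_]; case: (leP (z i) (2 ^+ k0)) => ? ?; lra.
have nU : P.-negligible ((\bigcup_k \bigcup_l N1 k l) `|` (\bigcap_k B k)).
  apply: negligibleU => //.
  by apply: negligible_bigcup => k; exact: negligible_bigcup.
apply: negligibleS nU => w /= ncv; apply: contrapT => /not_orP[h1 h2]; apply: ncv.
apply: dyadic_cvg => [k l kl|].
  by apply: contrapT => h; apply: h1; exists k => //; exists l.
by apply: contrapT => /forallNP h; apply: h2 => k _; rewrite /B /= leNgt; apply/negP.
Qed.

(** At level [k] the function reads finitely many bits, so the two sides agree; then [k] grows. On
    the left this is dominated convergence. *)
Lemma representation_blip n (x : n.-tuple I) h : blip h ->
  \int[P]_w h [tuple dyadic_lim R (tnth x i) w | i < n] =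
  L (fun z : path_space I R => h [tuple z (tnth x i) | i < n]).
Proof.
move=> bh; have [mh [M [M0 hM hl]]] := bh.
pose hk k (w : Om) := h [tuple dyadic R k w (tnth x i) | i < n].
pose hZ (w : Om) := h [tuple dyadic_lim R (tnth x i) w | i < n].
have bhk k : bmf (hk k).
  by have [s hs] := depends_on_dyadics k x h; exact: (bmf_bits hs).
have bhZ : bmf hZ.
  apply: bmf_comp (blip_bmf bh); apply/measurable_fun_tnthP => i.
  rewrite (_ : _ \o _ = dyadic_lim R (tnth x i)); first exact: measurable_dyadic_lim.
  by apply/funext => w /=; rewrite tnth_mktuple.
have c1 : (fun k => \int[P]_w hk k w) @ \oo --> \int[P]_w hZ w.
  apply: (Rexp_dominated_cvg _ _ (L1_bmf P (bmf_cst _ M))).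
  - by move=> k; have [] := bhk k.
  - by have [] := bhZ.
  - by move=> k w; exact: hM.
  have : \forall w \ae P, forall i : 'I_n,
      (fun k => dyadic R k w (tnth x i)) @ \oo --> dyadic_lim R (tnth x i) w.
    by apply: filter_forall => i; exact: dyadic_ae_cvg.
  apply: (@filterS _ _ (ae_filter_ringOfSetsType P)) => w cw.
  apply/cvgrPdist_le => e e0 /=.
  have cs : (fun k => M * \sum_(i < n)
      `|dyadic_lim R (tnth x i) w - dyadic R k w (tnth x i)|) @ \oo --> (0 : R).
    rewrite -[X in _ --> X](mulr0 M); apply: cvgMr.
    apply: cvg_sum0 => i; rewrite -(@normr0 _ R) -(subrr (dyadic_lim R (tnth x i) w)).
    by apply: cvg_norm; apply: cvgB; [exact: cvg_cst|exact: cw].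
  move/cvgrPdist_le : cs => /(_ e e0); apply: filterS => k.
  rewrite sub0r normrN => h'; apply: le_trans h'; apply: (le_trans (hl _ _)).
  apply: le_trans (ler_norm _); under eq_bigr do rewrite !tnth_mktuple.
  exact: lexx.
have bz := @bmf_blip I R n x h bh.
pose hc k (z : path_space I R) := h [tuple dyadic R k (path_code z) (tnth x i) | i < n].
have bhc k : bmf (hc k).
  by have [s hs] := depends_on_dyadics k x h; exact: (bmf_code hs).
have c2 : (fun k => L (hc k)) @ \oo -->
    L (fun z : path_space I R => h [tuple z (tnth x i) | i < n]).
  apply/cvgrPdist_le => e e0.
  have cs : (fun k => \sum_(i < n) (M * (2 ^+ k)^-1 +
      2 * M * L (fun z : path_space I R => ((2 ^+ k < z (tnth x i))%R)%:R)))
      @ \oo --> (0 : R).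
    apply: cvg_sum0 => i; rewrite -[X in _ --> X]addr0.
    apply: cvgD; first exact: exp2_inv_cvg.
    by rewrite -[X in _ --> X](mulr0 (2 * M)); apply: cvgMr; exact: tight_exp2_cvg.
  move/cvgrPdist_le : cs => /(_ e e0); apply: filterS => k.
  rewrite sub0r normrN => h'; apply: le_trans h'; apply: le_trans (ler_norm _).
  have bi i : bmf (fun z : path_space I R =>
      M * (2 ^+ k)^-1 + 2 * M * ((2 ^+ k < z (tnth x i))%R)%:R).
    by apply: bmfD; [exact: bmf_cst|apply: bmfZ; exact: bmf_gt].
  rewrite -(pfunB pL) //.
  apply: (le_trans (pfun_norm_le pL (bmfB bz (bhc k)) (bmf_sum (index_enum 'I_n) bi) _)).
    move=> z z0; set S := \sum_(i < n) _.
    have S0 (i : 'I_n) : 0 <= M * (2 ^+ k)^-1 +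
        2 * M * ((2 ^+ k < z (tnth x i))%R)%:R :> R.
      by rewrite addr_ge0 // mulr_ge0 // ?mulr_ge0 // invr_ge0 exprn_ge0.
    have [/existsP[i zi]|/existsPn zk] := boolP [exists i, 2 ^+ k < z (tnth x i)].
      apply: (le_trans (y := 2 * M)).
        apply: (le_trans (ler_normB _ _)).
        by rewrite mulr_natl mulr2n; apply: lerD; exact: hM.
      rewrite /S (bigD1 i) //= zi mulr1 -addrA.
      rewrite -[leLHS]add0r -[leLHS]addr0 -addrA.
      by apply: lerD; [rewrite mulr_ge0 // invr_ge0 exprn_ge0|
        apply: lerD => //; exact: sumr_ge0].
    apply: (le_trans (hl _ _)); rewrite mulr_sumr; apply: ler_sum => i _.
    rewrite !tnth_mktuple (negbTE (zk i)) mulr0 addr0 ler_wpM2l // distrC.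
    have := dyadic_code k (z0 (tnth x i)).
    by rewrite min_l // leNgt zk.
  rewrite (pfun_sum pL) //; apply: ler_sum => i _.
  have [LD LZ _] := pL.
  rewrite LD; [|exact: bmf_cst|by apply: bmfZ; exact: bmf_gt].
  have -> : L (fun=> M / 2 ^+ k) = M / 2 ^+ k by rewrite (pfun_cst pL) L1 mulr1.
  by rewrite lerD2l (LZ (2 * M)) //; exact: bmf_gt.
have c1' : (fun k => L (hc k)) @ \oo --> \int[P]_w hZ w.
  rewrite (_ : (fun k => _) = fun k => \int[P]_w hk k w) //.
  apply/funext => k; have [s hs] := depends_on_dyadics k x h.
  by rewrite /hk (code_law pL PE hs).
exact: cvg_unique c1' c2.
Qed.
End Law.

(** Bounded Lipschitz functions are the right class: [L] is only finitely additive and may differ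
    from an expectation on other bounded functions. *)
Lemma functional_representation : exists (d : measure_display) (T : measurableType d)
    (P : probability T R) (Z : I -> {RV P >-> R}),
  forall n (x : n.-tuple I) h, blip h ->
    \int[P]_w h [tuple Z (tnth x i) w | i < n] =
    L (fun z : path_space I R => h [tuple z (tnth x i) | i < n]).
Proof.
have [_ _ L0] := pL; have [LD LZ _] := pL.
pose mu0 (A : set (I * nat * nat -> bool)) :=
  L (fun z : path_space I R => \1_A (path_code z)).
have [|||P PE] := @cylinder_extension (I * nat * nat) R mu0.
- move=> A cA; apply: L0; first exact: bmf_code_indic.
  by move=> z _; rewrite indicE.
- move=> A B cA cB AB; rewrite /mu0.
  rewrite -LD; [|exact: bmf_code_indic|exact: bmf_code_indic].
  congr L; apply/funext => z; rewrite !indicE in_setU.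
  have := AB => /seteqP[/(_ (path_code z)) h _].
  have [Az|] := boolP (path_code z \in A); have [Bz|] := boolP (path_code z \in B);
    rewrite /= ?addr0 ?add0r //.
  by move: Az Bz; rewrite !inE => Az Bz; case: h.
- by rewrite /mu0 -[RHS]L1; congr L; apply/funext => z; rewrite indicE in_setT.
exists _, _, P, (fun i => mfun_Sub (mem_set (measurable_dyadic_lim i)) : {RV P >-> R}).
move=> n x h bh; rewrite -(representation_blip PE) //.
Qed.

End Representation.

(** The image is an ultrafilter on a compact segment, and a cluster point of an ultrafilter is a
    limit. *)
Lemma ultra_bounded_cvg (J : Type) (U : set_system J) (R : realType) (u : J -> R)
    (M : R) :
  UltraFilter U -> (\forall j \near U, `|u j| <= M) -> cvg (u @ U).
Proof.
move=> UU uM.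
have cpt : (u @ U) [set` `[- M, M]].
  by apply: filterS uM => j; rewrite /= in_itv /= ler_norml.
have [a [_ ca]] := @segment_compact R (- M) M _ _ cpt.
apply/cvg_ex; exists a => V Va.
have [//|h] := in_ultra_setVsetC (u @^-1` V) UU.
have [y [/=]] := ca (~` V) V h Va.
by [].
Qed.

(** Along an ultrafilter all bounded families converge at once, whatever the number of test
    functions. The mass has only to tend to one because the lattice approximants of the converse are
    defective. *)
Lemma functional_limit (K J : Type) (R : realType) (U : set_system J)
    (Lam : J -> (path_space K R -> R) -> R) :
  UltraFilter U -> (forall j, positive_functional (Lam j)) ->
  (fun j => Lam j (fun=> 1)) @ U --> (1 : R) ->
  exists L : (path_space K R -> R) -> R,
    [/\ positive_functional L, L (fun=> 1) = 1 &
      forall f, bmf f -> (fun j => Lam j f) @ U --> L f].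
Proof.
move=> UU pL c1; pose L f := lim ((fun j => Lam j f) @ U).
have cL f : bmf f -> (fun j => Lam j f) @ U --> L f.
  move=> bf; have [_ [M fM]] := bf.
  (* Near [U] the mass of [Lam j] is at most 2. *)
  apply: (@ultra_bounded_cvg _ _ _ _ (M * 2)) => //.
  have M0 : 0 <= M by apply: le_trans (fM point).
  have := c1; move=> /cvgrPdist_lt /(_ _ ltr01).
  apply: filterS => j h; apply: (le_trans (y := Lam j (fun=> M))).
    by apply: (pfun_norm_le (pL j)) => //; exact: bmf_cst.
  rewrite (pfun_cst (pL j)) ler_wpM2l //.
  by move: h; rewrite ltr_norml => /andP[]; lra.
exists L; split; last exact: cL.
- split.
  + move=> f g bf bg; apply: cvg_lim => //.
    rewrite (_ : (fun j => _) = fun j => Lam j f + Lam j g); last first.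
      by apply/funext => j; have [-> //] := pL j.
    by apply: cvgD; exact: cL.
  + move=> c f bf; apply: cvg_lim => //.
    rewrite (_ : (fun j => _) = fun j => c * Lam j f); last first.
      by apply/funext => j; have [_ -> //] := pL j.
    by apply: cvgMr; exact: cL.
  + move=> f bf f0; apply: (limr_ge (cvgP _ (cL _ bf))).
    by apply: nearW => j; have [_ _ h] := pL j; exact: h.
- exact: cvg_lim c1.
Qed.

(** * Laws are determined by bounded Lipschitz functions *)

(** Boxes are stable under intersection, generate the Borel sets, and have indicators that are
    limits of Lipschitz ramps. *)
Definition lower_boxes (R : realType) n : set (set (n.-tuple R)) :=
  [set A | exists b : n.-tuple R, A = [set y | forall i, tnth y i <= tnth b i]].

Lemma lower_boxesI (R : realType) n : setI_closed (@lower_boxes R n).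
Proof.
move=> _ _ [b ->] [c ->]; exists [tuple Num.min (tnth b i) (tnth c i) | i < n].
apply/seteqP; split=> y /=.
  by move=> [yb yc] i; rewrite tnth_mktuple le_min yb yc.
by move=> h; split=> i; have := h i; rewrite tnth_mktuple le_min => /andP[].
Qed.

Lemma lower_boxes_coordinate (R : realType) n (i : 'I_n) (r : R) :
  <<s @lower_boxes R n >> [set y | tnth y i <= r].
Proof.
(* The other coordinates are bounded by [k], which exhausts the half-space as [k] grows. *)
have -> : [set y : n.-tuple R | tnth y i <= r] = \bigcup_k
    [set y | forall j, tnth y j <= tnth [tuple if j == i then r else k%:R | j < n] j].
  apply/seteqP; split=> y /=; last first.
    by move=> [k _ /(_ i)]; rewrite tnth_mktuple eqxx.
  move=> yi; pose k := Num.bound (\sum_j `|tnth y j|).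
  exists k => // j; rewrite tnth_mktuple; have [->//|_] := eqVneq j i.
  have s0 : 0 <= \sum_j `|tnth y j| by exact: sumr_ge0.
  apply: le_trans (ltW (archi_boundP s0)).
  apply: (le_trans (ler_norm _)).
  by rewrite (bigD1 j) //= lerDl sumr_ge0.
apply: sigma_algebra_bigcup => k; apply: sub_sigma_algebra.
by exists [tuple if j == i then r else k%:R | j < n].
Qed.

Lemma measurable_lower_boxes (R : realType) n :
  @measurable _ (n.-tuple R) = <<s @lower_boxes R n >>.
Proof.
apply/seteqP; split; last first.
  apply: smallest_sub; first exact: sigma_algebra_measurable.
  move=> _ [b ->].
  rewrite (_ : [set y | _] = \bigcap_(i in [set: 'I_n]) [set y | tnth y i <= tnth b i]).
    apply: fin_bigcap_measurable => // i _.
    rewrite -[X in measurable X]setTI.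
    exact: (measurable_fun_le measurableT (measurable_tnth i) (measurable_cst _)).
  by apply/seteqP; split => y /= h i; [move=> _; exact: h|exact: h].
pose T' := g_sigma_algebraType (@lower_boxes R n).
have mt i : measurable_fun setT (fun y : T' => tnth y i).
  apply: (measurability _ (RGenOInfty.measurableE R)) => //.
  move=> _ [_ [r ->] <-]; rewrite setTI.
  rewrite (_ : _ @^-1` _ = ~` [set y | tnth y i <= r]).
    by apply: sigma_algebraC; exact: lower_boxes_coordinate.
  by apply/seteqP; split => y /=; rewrite in_itv /= andbT ltNge => /negP.
apply: smallest_sub; first exact: smallest_sigma_algebra.
move=> A; rewrite -bigcup_seq => -[i _ [B mB <-]].
exact: mt.
Qed.

(** [c] is the slope in the l1 overshoot beyond the box; letting it grow sharpens the ramp into the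
    indicator of the box. *)
Lemma blip_box_ramp (R : realType) n (b : n.-tuple R) (c : R) : 0 <= c ->
  blip (fun y : n.-tuple R =>
    Num.max 0 (1 - c * \sum_(i < n) Num.max 0 (tnth y i - tnth b i))).
Proof.
move=> c0; pose u (y : n.-tuple R) := c * \sum_(i < n) Num.max 0 (tnth y i - tnth b i).
have u0 y : 0 <= u y.
  by rewrite mulr_ge0 // sumr_ge0 // => i _; rewrite le_max lexx.
split.
  apply: measurable_maxr; first exact: measurable_cst.
  apply: measurable_funB; first exact: measurable_cst.
  apply: measurable_funM; first exact: measurable_cst.
  apply: measurable_sum => i; apply: measurable_maxr; first exact: measurable_cst.
  by apply: measurable_funB; [exact: measurable_tnth|exact: measurable_cst].
(* A single constant serves as Lipschitz constant, at least [c], and as bound, at least 1. *)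
exists (c + 1); split; first lra.
  move=> y; have := u0 y; rewrite -/(u y) => h.
  rewrite ger0_norm; last by rewrite le_max lexx.
  by rewrite ge_max; apply/andP; split; lra.
move=> y z; rewrite -/(u y) -/(u z).
apply: (le_trans (y := `|u y - u z|)).
  move: (u0 y) (u0 z); set p := u y; set q := u z => p0 q0.
  rewrite ler_norml; have := ler_norm (p - q); have := ler_norm (q - p).
  rewrite distrC => h1 h2.
  case: (leP 0 (1 - p)) => h3; case: (leP 0 (1 - q)) => h4;
    rewrite ?(max_r h3) ?(max_r h4) ?(max_l (ltW h3)) ?(max_l (ltW h4));
    apply/andP; split; lra.
rewrite /u -mulrBr normrM (ger0_norm c0) -sumrB.
apply: ler_pM => //; first by rewrite lerDl.
apply: (le_trans (ler_norm_sum _ _ _)); apply: ler_sum => i _.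
set p := tnth y i; set q := tnth z i; set r := tnth b i.
rewrite ler_norml; have := ler_norm (p - q); have := ler_norm (q - p).
rewrite distrC => h1 h2.
by case: (leP 0 (p - r)) => h3; case: (leP 0 (q - r)) => h4;
    rewrite ?(max_r h3) ?(max_r h4) ?(max_l (ltW h3)) ?(max_l (ltW h4));
    apply/andP; split; lra.
Qed.

Lemma box_ramp_cvg (R : realType) n (b y : n.-tuple R) :
  (fun k : nat => Num.max 0 (1 - k%:R * \sum_(i < n) Num.max 0 (tnth y i - tnth b i)))
  @ \oo --> (\1_[set y | forall i, tnth y i <= tnth b i] y : R).
Proof.
rewrite indicE; have [|] := boolP (y \in _); rewrite ?inE ?notin_setE /= => h.
  rewrite big1; first by under eq_fun do rewrite mulr0 subr0 (max_r ler01); exact: cvg_cst.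
  by move=> i _; rewrite max_l // subr_le0.
set s := \sum_(i < n) _; have s0 : 0 < s.
  move/existsNP : h => [i /negP]; rewrite -ltNge => h.
  rewrite /s (bigD1 i) //=; apply: ltr_wpDr.
    by apply: sumr_ge0 => j _; rewrite le_max lexx.
  by rewrite lt_max subr_gt0 h orbT.
apply: cvg_near_cst; exists (Num.bound s^-1) => // k /= hk.
have : s^-1 < k%:R.
  apply: (@lt_le_trans _ _ (Num.bound s^-1)%:R); last by rewrite ler_nat.
  by apply: archi_boundP; rewrite invr_ge0 ltW.
rewrite -(ltr_pM2r s0) mulVf ?gt_eqF // => h1.
by rewrite max_l // subr_le0 ltW.
Qed.

Lemma weighted_box_cvg (R : realType) n (d : measure_display) (T : measurableType d)
    (P : probability T R) (G : T -> R) (W : T -> n.-tuple R) (b : n.-tuple R) :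
  (forall w, 0 <= G w) -> P.-integrable setT (EFin \o G) -> measurable_fun setT W ->
  (fun k : nat => \int[P]_w (G w * Num.max 0 (1 - k%:R *
     \sum_(i < n) Num.max 0 (tnth (W w) i - tnth b i)))) @ \oo -->
  \int[P]_w (G w * \1_[set y | forall i, tnth y i <= tnth b i] (W w)).
Proof.
move=> G0 iG mW; pose B := [set y : n.-tuple R | forall i, tnth y i <= tnth b i].
have mG : measurable_fun setT G by apply/measurable_EFinP; exact: (measurable_int P).
have mB : measurable B.
  by rewrite measurable_lower_boxes; apply: sub_sigma_algebra; exists b.
pose r (k : nat) (y : n.-tuple R) :=
  Num.max 0 (1 - k%:R * \sum_(i < n) Num.max 0 (tnth y i - tnth b i)).
have br k : blip (r k) by apply: blip_box_ramp.
have mr k : measurable_fun setT (fun w => r k (W w)).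
  by have [+ _] := br k => h; exact: (measurableT_comp h).
have r01 k y : 0 <= r k y <= 1.
  rewrite /r le_max lexx ge_max ler01 /= gerBl mulr_ge0 // sumr_ge0 // => i _.
  by rewrite le_max lexx.
apply: (Rexp_dominated_cvg _ _ iG).
- by move=> k; apply: measurable_funM => //; exact: mr.
- apply: measurable_funM => //.
  have mi : measurable_fun setT (\1_B : n.-tuple R -> R) by exact: measurable_indic.
  exact: (measurableT_comp mi).
- move=> k w; have /andP[h1 h2] := r01 k (W w).
  by rewrite ger0_norm ?mulr_ge0 // ler_piMr.
- by apply: aeW => w; apply: cvgMr; exact: box_ramp_cvg.
Qed.

Lemma weighted_indicE (R : realType) n (d : measure_display) (T : measurableType d)
    (P : probability T R) (G : T -> R) (W : T -> n.-tuple R) (A : set (n.-tuple R)) :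
  (forall w, 0 <= G w) -> P.-integrable setT (EFin \o G) -> measurable_fun setT W ->
  measurable A ->
  (\int[P]_(w in W @^-1` A) (G w)%:E)%E =
  (\int[P]_w (G w * \1_A (W w)))%:E.
Proof.
move=> G0 iG mW mA.
have mWA : measurable (W @^-1` A) by rewrite -[X in measurable X]setTI; exact: mW.
have E : (\int[P]_(w in W @^-1` A) (G w)%:E)%E = (\int[P]_w (G w * \1_A (W w))%:E)%E.
  rewrite integral_mkcond; apply: eq_integral => w _.
  rewrite patchE indicE (_ : (w \in W @^-1` A) = (W w \in A)); last first.
    by apply/idP/idP; rewrite !inE.
  by case: ifP => _; rewrite ?mulr1 ?mulr0.
rewrite /Rintegral -E fineK //.
apply: integrable_fin_num => //.
by apply: integrableS iG.
Qed.

Section Determination.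
Context (R : realType) (n : nat).
Context (d1 : measure_display) (T1 : measurableType d1) (P1 : probability T1 R).
Context (d2 : measure_display) (T2 : measurableType d2) (P2 : probability T2 R).
Context (G1 : T1 -> R) (W1 : T1 -> n.-tuple R) (G2 : T2 -> R) (W2 : T2 -> n.-tuple R).

Context (G1_ge0 : forall w, 0 <= G1 w) (G2_ge0 : forall w, 0 <= G2 w).
Context (iG1 : P1.-integrable setT (EFin \o G1)) (iG2 : P2.-integrable setT (EFin \o G2)).
Context (mW1 : measurable_fun setT W1) (mW2 : measurable_fun setT W2).

(** Weights are allowed so that one statement compares plain laws, a size-biased law with a plain
    one and, in the proof of independence, the law of one vector weighted by functions of the
    others. Boxes form the pi-system and ramps reach their indicators. *)
Lemma blip_determines :
  (forall h : n.-tuple R -> R, blip h ->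
    \int[P1]_w (G1 w * h (W1 w)) = \int[P2]_w (G2 w * h (W2 w))) ->
  forall A, measurable A ->
  (\int[P1]_(w in W1 @^-1` A) (G1 w)%:E)%E = (\int[P2]_(w in W2 @^-1` A) (G2 w)%:E)%E.
Proof.
move=> eqh A mA.
pose v1 A := (\int[P1]_(w in W1 @^-1` A) (G1 w)%:E)%E.
pose v2 A := (\int[P2]_(w in W2 @^-1` A) (G2 w)%:E)%E.
have mW1A B : measurable B -> measurable (W1 @^-1` B).
  by move=> mB; rewrite -[X in measurable X]setTI; exact: mW1.
have mW2A B : measurable B -> measurable (W2 @^-1` B).
  by move=> mB; rewrite -[X in measurable X]setTI; exact: mW2.
have fG1 B : measurable B -> P1.-integrable (W1 @^-1` B) (EFin \o G1).
  by move=> mB; apply: integrableS iG1 => //; exact: mW1A.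
have fG2 B : measurable B -> P2.-integrable (W2 @^-1` B) (EFin \o G2).
  by move=> mB; apply: integrableS iG2 => //; exact: mW2A.
have mG1 D : measurable_fun D (EFin \o G1).
  by apply: (measurable_funS measurableT (@subsetT _ D)); exact: (measurable_int P1).
have mG2 D : measurable_fun D (EFin \o G2).
  by apply: (measurable_funS measurableT (@subsetT _ D)); exact: (measurable_int P2).
have vT : v1 setT = v2 setT.
  rewrite /v1 /v2 !weighted_indicE // ; congr EFin.
  under eq_Rintegral do rewrite indicT; under [RHS]eq_Rintegral do rewrite indicT.
  apply: (eqh (fun=> 1)); split; first exact: measurable_cst.
  by exists 1; split=> // [y|y z]; rewrite ?normr1 // subrr normr0 mul1r sumr_ge0.
apply: (@dynkin_induction _ _ (@lower_boxes R n) (fun A => v1 A = v2 A)) => //.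
- exact: measurable_lower_boxes.
- exact: lower_boxesI.
- move=> B LB; have mB : measurable B.
    by rewrite measurable_lower_boxes; exact: sub_sigma_algebra.
  rewrite /v1 /v2 !weighted_indicE // ; congr EFin; move: LB => [b Eb]; rewrite Eb.
  have c1 := weighted_box_cvg (b := b) G1_ge0 iG1 mW1.
  have c2 := weighted_box_cvg (b := b) G2_ge0 iG2 mW2.
  suff e : (fun k : nat => \int[P1]_w (G1 w * Num.max 0 (1 - k%:R *
       \sum_(i < n) Num.max 0 (tnth (W1 w) i - tnth b i)))) =
      fun k : nat => \int[P2]_w (G2 w * Num.max 0 (1 - k%:R *
       \sum_(i < n) Num.max 0 (tnth (W2 w) i - tnth b i))).
    by rewrite e in c1; exact: cvg_unique c1 c2.
  apply/funext => k.
  by rewrite (eqh (fun y => Num.max 0 (1 - k%:R *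
     \sum_(i < n) Num.max 0 (tnth y i - tnth b i)))) //; exact: blip_box_ramp.
- move=> B mB eB.
  have e1 : v1 setT = (v1 B + v1 (~` B))%E.
    rewrite /v1 -integral_setU //; first by rewrite -preimage_setU setUv.
    + exact: mW1A.
    + by apply: mW1A; exact: measurableC.
    + by apply/disj_set2P; rewrite -preimage_setI setICr preimage_set0.
  have e2 : v2 setT = (v2 B + v2 (~` B))%E.
    rewrite /v2 -integral_setU //; first by rewrite -preimage_setU setUv.
    + exact: mW2A.
    + by apply: mW2A; exact: measurableC.
    + by apply/disj_set2P; rewrite -preimage_setI setICr preimage_set0.
  have f1 : v1 B \is a fin_num by apply: integrable_fin_num; [exact: mW1A|exact: fG1].
  have := vT; rewrite e1 e2 -eB => /(congr1 (fun x => x - v1 B)%E).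
  by rewrite ![(v1 B + _)%E]addeC !addeK.
- move=> F mF tF eF; rewrite /v1 /v2 !preimage_bigcup !ge0_integral_bigcup //.
  + by apply: eq_eseriesr => k _; exact: eF.
  + by move=> k; exact: mW2A.
  + by move=> w _; rewrite lee_fin.
  + by move=> i j _ _ [w [Fi Fj]]; apply: tF => //; exists (W2 w).
  + by move=> k; exact: mW1A.
  + by move=> w _; rewrite lee_fin.
  + by move=> i j _ _ [w [Fi Fj]]; apply: tF => //; exists (W1 w).
- by rewrite -measurable_lower_boxes.
Qed.

End Determination.

(** * Transfer of integrals between maps of equal law *)

Definition same_law (R : realType) (d1 d2 d : measure_display)
    (T1 : measurableType d1) (T2 : measurableType d2) (S : measurableType d)
    (P1 : probability T1 R) (X1 : T1 -> S) (P2 : probability T2 R) (X2 : T2 -> S) :=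
  forall A, measurable A -> P1 (X1 @^-1` A) = P2 (X2 @^-1` A).

Section SameLaw.
Context (R : realType) (d1 d2 d : measure_display).
Context (T1 : measurableType d1) (T2 : measurableType d2) (S : measurableType d).
Context (P1 : probability T1 R) (P2 : probability T2 R).
Context (X1 : T1 -> S) (X2 : T2 -> S).
Context (mX1 : measurable_fun setT X1) (mX2 : measurable_fun setT X2).
Context (eqX : same_law P1 X1 P2 X2).

Lemma same_law_L1 (F : S -> R) : measurable_fun setT F ->
  L1 P1 (F \o X1) -> L1 P2 (F \o X2).
Proof.
move=> mF /integrableP[_ L]; apply/integrableP; split.
  by apply/measurable_EFinP; exact: (measurableT_comp mF).
have mF' : measurable_fun setT (fun s => `|(F s)%:E|)%E.
  by apply: measurableT_comp => //; exact/measurable_EFinP.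
have := @ge0_integral_pushforward _ _ _ _ _ _ mX2 P2 setT (fun s => `|(F s)%:E|)%E measurableT mF' (fun _ _ => abse_ge0 _).
rewrite preimage_setT /comp /= => <-.
have := @ge0_integral_pushforward _ _ _ _ _ _ mX1 P1 setT (fun s => `|(F s)%:E|)%E measurableT mF' (fun _ _ => abse_ge0 _).
rewrite preimage_setT /comp /= => e; move: L; rewrite -e.
by rewrite (eq_measure_integral (pushforward P2 X2)) // => A mA _; exact: eqX.
Qed.

Lemma same_law_integral (F : S -> R) : measurable_fun setT F ->
  L1 P1 (F \o X1) -> \int[P1]_w F (X1 w) = \int[P2]_w F (X2 w).
Proof.
move=> mF LF; have mF' : measurable_fun setT (EFin \o F) by exact/measurable_EFinP.
have := @integral_pushforward _ _ _ _ _ _ mX1 P1 setT (EFin \o F) mF'.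
rewrite preimage_setT => /(_ LF measurableT) e1.
have := @integral_pushforward _ _ _ _ _ _ mX2 P2 setT (EFin \o F) mF'.
rewrite preimage_setT => /(_ (same_law_L1 mF LF) measurableT) e2.
rewrite /Rintegral; congr fine; move: e1 e2; rewrite /comp /= => <- <-.
by apply: eq_measure_integral => A mA _; exact: eqX.
Qed.

End SameLaw.

Definition rectangles (d : measure_display) (S : measurableType d) m :
    set (set (m.-tuple S)) :=
  [set C | exists2 A : 'I_m -> set S, (forall k, measurable (A k)) &
    C = [set v | forall k, A k (tnth v k)]].

Lemma measurable_rectangles (d : measure_display) (S : measurableType d) m :
  @measurable _ (m.-tuple S) = <<s @rectangles d S m >>.
Proof.
apply/seteqP; split; last first.
  apply: smallest_sub; first exact: sigma_algebra_measurable.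
  move=> _ [A mA ->].
  rewrite (_ : [set v | _] = \bigcap_(k in [set: 'I_m]) ((fun v : m.-tuple S => tnth v k) @^-1` A k)).
    apply: fin_bigcap_measurable => // k _.
    by rewrite -[X in measurable X]setTI; exact: measurable_tnth.
  by apply/seteqP; split => y /= h i; [move=> _; exact: h|exact: h].
apply: smallest_sub; first exact: smallest_sigma_algebra.
move=> A; rewrite -bigcup_seq => -[i _ [B mB <-]]; apply: sub_sigma_algebra.
exists (fun k => if k == i then B else setT) => [k|]; first by case: ifP.
rewrite setTI; apply/seteqP; split=> v /=.
  by move=> vi k; case: eqP => // ->.
by move=> /(_ i); rewrite eqxx.
Qed.

Lemma rectangles_same_law (R : realType) (d1 d2 d : measure_display)
    (T1 : measurableType d1) (T2 : measurableType d2) (S : measurableType d) m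
    (P1 : probability T1 R) (X1 : T1 -> m.-tuple S)
    (P2 : probability T2 R) (X2 : T2 -> m.-tuple S) :
  measurable_fun setT X1 -> measurable_fun setT X2 ->
  (forall A : 'I_m -> set S, (forall k, measurable (A k)) ->
    P1 [set w | forall k, A k (tnth (X1 w) k)] =
    P2 [set w | forall k, A k (tnth (X2 w) k)]) ->
  same_law P1 X1 P2 X2.
Proof.
move=> mX1 mX2 eqX A mA.
pose D1 : probability _ R := distribution P1 (mfun_Sub (mem_set mX1) : {RV P1 >-> m.-tuple S}).
pose D2 : probability _ R := distribution P2 (mfun_Sub (mem_set mX2) : {RV P2 >-> m.-tuple S}).
apply: (@measure_unique _ R _ (@rectangles d S m) (fun=> setT) _ _ _ _ D1 D2) => //.
- exact: measurable_rectangles.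
- move=> _ _ [B mB ->] [C mC ->]; exists (fun k => B k `&` C k).
    by move=> k; exact: measurableI.
  apply/seteqP; split=> v /=; first by move=> [Bv Cv] k; split.
  by move=> h; split=> k; have [] := h k.
- by move=> _; exists (fun=> setT) => //; apply/seteqP; split.
- by rewrite bigcup_const.
- by move=> _ [B mB ->]; exact: eqX.
- by move=> _; rewrite ltey_eq fin_num_measure.
Qed.

(** * Size biasing an infinitely divisible process *)

Section Fubini.
Context (R : realType) (d1 d2 : measure_display).
Context (T1 : measurableType d1) (T2 : measurableType d2).
Context (P1 : probability T1 R) (P2 : probability T2 R).

Lemma L1_fst (u : T1 -> R) : L1 P1 u -> L1 (P1 \x P2)%E (u \o fst).
Proof.
move=> Lu; have mu := L1_measurable Lu.
apply: (@same_law_L1 R _ _ _ T1 (T1 * T2)%type T1 P1 (P1 \x P2)%E id fst) => //.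
move=> A mA; rewrite (_ : fst @^-1` A = A `*` setT); last first.
  by apply/seteqP; split=> [[x y]|[x y] []].
by rewrite /= product_measure1E //= (probability_setT P2) mule1.
Qed.

Lemma Rfubini (f : T1 * T2 -> R) : L1 (P1 \x P2)%E f ->
  (forall x, L1 P2 (fun y => f (x, y))) ->
  \int[(P1 \x P2)%E]_z f z = \int[P1]_x \int[P2]_y f (x, y) /\
  L1 P1 (fun x => \int[P2]_y f (x, y)).
Proof.
move=> Lf Lfx.
have e : fubini_F P2 (EFin \o f) = EFin \o (fun x => \int[P2]_y f (x, y)).
  apply/funext => x; rewrite /fubini_F /= /Rintegral fineK //.
  by apply: (integrable_fin_num measurableT); exact: Lfx.
split; last by have := integrable_fubini_F Lf; rewrite e.
by rewrite {1}/Rintegral -fubini1 // e.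
Qed.

End Fubini.

Definition addt (R : realType) n (y z : n.-tuple R) : n.-tuple R :=
  [tuple tnth y i + tnth z i | i < n].

(** Componentwise positive part: it makes almost surely nonnegative vectors surely nonnegative
    without changing their law. *)
Definition post (R : realType) n (y : n.-tuple R) : n.-tuple R :=
  [tuple Num.max 0 (tnth y i) | i < n].

Lemma measurable_mktuple (d : measure_display) (T : measurableType d) (R : realType) n
    (f : 'I_n -> T -> R) : (forall i, measurable_fun setT (f i)) ->
  measurable_fun setT (fun w => [tuple f i w | i < n]).
Proof.
move=> mf; apply/measurable_fun_tnthP => i.
by rewrite (_ : _ \o _ = f i) //; apply/funext => w /=; rewrite tnth_mktuple.
Qed.

Lemma measurable_tnth_comp (d : measure_display) (T : measurableType d) (R : realType) n
    (W : T -> n.-tuple R) i : measurable_fun setT W ->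
  measurable_fun setT (fun w => tnth (W w) i).
Proof. by move=> mW; exact: (measurableT_comp (measurable_tnth i)). Qed.

Lemma measurable_post (R : realType) n : measurable_fun setT (@post R n).
Proof.
apply: measurable_mktuple => i; apply: measurable_maxr; first exact: measurable_cst.
exact: measurable_tnth.
Qed.

Lemma eq_probability_ae (d : measure_display) (T : measurableType d) (R : realType)
    (P : probability T R) (N A B : set T) : measurable A -> measurable B ->
  P.-negligible N -> (forall w, ~ N w -> A w <-> B w) -> P A = P B.
Proof.
move=> mA mB nN AB.
have e C : measurable C -> P C = (\int[P]_x (EFin \o \1_C) x)%E.
  by move=> mC; rewrite integral_indic // setIT.
rewrite !e //; apply: ae_eq_integral => //.
- by apply/measurable_EFinP; exact: measurable_indic.
- by apply/measurable_EFinP; exact: measurable_indic.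
- apply: negligibleS nN => w /=; apply: contra_notP => nN _ /=.
  have wAB : (w \in A) = (w \in B) by apply/idP/idP => /set_mem h; apply/mem_set; apply AB.
  by rewrite !indicE wAB.
Qed.

Definition nonneg_iid_parts (R : realType) n (d d' : measure_display)
    (T : measurableType d) (P : probability T R) (W : T -> n.-tuple R)
    (S : measurableType d') (Q : probability S R) m (V : 'I_m -> S -> n.-tuple R) :=
  [/\ forall k, measurable_fun setT (V k),
      forall k w i, 0 <= tnth (V k w) i,
      mutually_independent Q V,
      forall j k A, measurable A -> Q (V j @^-1` A) = Q (V k @^-1` A)
    & same_law P W Q (fun w => sum_tuple (fun k => V k w))].

Lemma measurable_sum_tuple (R : realType) n (d : measure_display)
    (S : measurableType d) m (V : 'I_m -> S -> n.-tuple R) :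
  (forall k, measurable_fun setT (V k)) ->
  measurable_fun setT (fun w => sum_tuple (fun k => V k w)).
Proof.
move=> mV; apply: measurable_mktuple => i; apply: measurable_sum => k.
exact: measurable_tnth_comp.
Qed.

(** If coordinate [i] of a part were negative with probability [q], by independence all parts would
    be negative there with probability [q ^ m], and so would their nonnegative sum. Hence [q = 0],
    and positive parts may be taken. *)
Lemma infinitely_divisible_nonneg_parts (R : realType) n (d : measure_display)
    (T : measurableType d) (P : probability T R) (W : T -> n.-tuple R) :
  measurable_fun setT W -> (forall w i, 0 <= tnth (W w) i) ->
  infinitely_divisible_law (pushforward P W) ->
  forall m, (0 < m)%N -> exists (d' : measure_display) (S : measurableType d')
    (Q : probability S R) (V : 'I_m -> S -> n.-tuple R), nonneg_iid_parts P W Q V.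
Proof.
move=> mW W0 idW m m0; have [d' [S [Q [Y [indY idY sumY]]]]] := idW m m0.
exists d', S, Q, (fun k w => post (Y k w)).
have mY k : measurable_fun setT (Y k) by exact: measurable_funPT.
have mV k : measurable_fun setT (fun w => post (Y k w)).
  exact: (measurableT_comp (@measurable_post R n)).
have mneg i : measurable [set y : n.-tuple R | tnth y i < 0].
  rewrite (_ : [set y | _] = (fun y => tnth y i) @^-1` [set` `]-oo, 0[]); last first.
    by apply/seteqP; split=> y /=; rewrite in_itv.
  by rewrite -[X in measurable X]setTI; apply: measurable_tnth.
have mYA k A : measurable A -> measurable (Y k @^-1` A).
  by move=> mA; rewrite -[X in measurable X]setTI; exact: mY.
have neg0 i k : Q (Y k @^-1` [set y | tnth y i < 0]) = 0%E.
  pose B := [set y : n.-tuple R | tnth y i < 0].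
  have e := indY (fun=> B) (fun=> mneg i).
  have le0 : (Q (\bigcap_(k in [set: 'I_m]) (Y k @^-1` B)) <= 0)%E.
    have <- : pushforward P W B = 0%E.
      rewrite /pushforward (_ : _ @^-1` _ = set0) ?measure0 //.
      by apply/seteqP; split=> // w; rewrite /B /= ltNge W0.
    rewrite (sumY _ (mneg i)); apply: le_measure; rewrite ?inE.
    - by apply: fin_bigcap_measurable => // j _; apply: mYA; exact: mneg.
    - rewrite -[X in measurable X]setTI.
      by apply: measurable_sum_tuple => //; exact: mneg.
    - move=> w h; rewrite /B /= tnth_mktuple.
      have h' j : tnth (Y j w) i < 0 by exact: h.
      rewrite (bigD1 k) //=; apply: (@lt_le_trans _ _ 0) => //.
      by apply: ltr_wnDr => //; apply: sumr_le0 => j _; exact: ltW.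
  move: le0; rewrite e.
  rewrite (eq_bigr (fun=> Q (Y k @^-1` B))); last by move=> j _; apply: idY; exact: mneg.
  have f : Q (Y k @^-1` B) \is a fin_num by apply: fin_num_measure; apply: mYA; exact: mneg.
  rewrite -(fineK f) prodEFin prodr_const card_ord lee_fin => h.
  congr EFin; apply: contrapT => /eqP; rewrite neq_lt => /orP[|].
    by rewrite ltNge fine_ge0 // measure_ge0.
  by move=> /(exprn_gt0 m); rewrite ltNge h.
split.
- exact: mV.
- by move=> k w i; rewrite tnth_mktuple le_max lexx.
- move=> A mA.
  by apply: (indY (fun k => @post R n @^-1` A k)) => k;
    rewrite -[X in measurable X]setTI; exact: measurable_post.
- move=> j k A mA; apply: (idY j k (@post R n @^-1` A)).
  by rewrite -[X in measurable X]setTI; exact: measurable_post.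
- move=> A mA; have := sumY A mA; rewrite /pushforward => ->.
  apply: (@eq_probability_ae _ _ _ _ (~` [set w | forall k i, 0 <= tnth (Y k w) i])).
  + by rewrite -[X in measurable X]setTI; apply: measurable_sum_tuple.
  + by rewrite -[X in measurable X]setTI; apply: measurable_sum_tuple.
  + have : \forall w \ae Q, forall k i, 0 <= tnth (Y k w) i.
      apply: filter_forall => k; apply: filter_forall => i.
      rewrite /almost_everywhere /=; apply/negligibleP; last first.
        rewrite -[RHS](neg0 i k); congr (Q _); apply/seteqP; split=> w /=.
          by move=> /negP; rewrite -ltNge.
        by rewrite ltNge => /negP.
      rewrite (_ : ~` _ = Y k @^-1` [set y | tnth y i < 0]); first by apply: mYA; exact: mneg.
      apply/seteqP; split=> w /=; first by move=> /negP; rewrite -ltNge.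
      by rewrite ltNge => /negP.
    exact.
  + move=> w /contrapT h.
    rewrite /preimage /= (_ : sum_tuple (fun k => Y k w) = sum_tuple (fun k => post (Y k w))) //.
    apply: eq_from_tnth => i; rewrite !tnth_mktuple; apply: eq_bigr => k _.
    by rewrite tnth_mktuple max_r //; exact: h.
Qed.

Lemma measurable_addt (d : measure_display) (T : measurableType d) (R : realType) n
    (X Y : T -> n.-tuple R) : measurable_fun setT X -> measurable_fun setT Y ->
  measurable_fun setT (fun w => addt (X w) (Y w)).
Proof.
by move=> mX mY; apply: measurable_mktuple => i; apply: measurable_funD;
  exact: measurable_tnth_comp.
Qed.

Lemma Rfubini_addt (R : realType) n (d d' : measure_display)
    (S : measurableType d) (T : measurableType d') (Q : probability S R)
    (P : probability T R) (v : S -> R) (X : S -> n.-tuple R) (U : T -> n.-tuple R)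
    (f : n.-tuple R -> R) :
  L1 Q v -> measurable_fun setT X -> measurable_fun setT U -> bmf f ->
  \int[(Q \x P)%E]_z (v z.1 * f (addt (X z.1) (U z.2))) =
    \int[Q]_w (v w * \int[P]_u f (addt (X w) (U u))) /\
  L1 Q (fun w => v w * \int[P]_u f (addt (X w) (U u))).
Proof.
move=> Lv mX mU bf.
have bg : bmf (fun z : S * T => f (addt (X z.1) (U z.2))).
  apply: bmf_comp bf; apply: measurable_addt.
    exact: (measurableT_comp mX measurable_fst).
  exact: (measurableT_comp mU measurable_snd).
have bgx x : bmf (fun u => f (addt (X x) (U u))).
  by apply: bmf_comp bf; apply: measurable_addt => //; exact: measurable_cst.
have Lp : L1 (Q \x P)%E (fun z => v z.1 * f (addt (X z.1) (U z.2))).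
  by apply: L1M => //; exact: (L1_fst P Lv).
have Lpx x : L1 P (fun u => v x * f (addt (X x) (U u))).
  by apply: L1Z; exact: L1_bmf.
have e x : \int[P]_u (v x * f (addt (X x) (U u))) = v x * \int[P]_u f (addt (X x) (U u)).
  by rewrite RintZ //; exact: L1_bmf.
have [-> L] := Rfubini Lp Lpx.
split; first by apply: eq_Rintegral => x _; exact: e.
by move: L; rewrite /=; congr (L1 Q _); apply/funext => x; rewrite /= e.
Qed.

(** * Exchangeability and independence of the parts *)

Section IidParts.
Context (R : realType) (n : nat) (d d' : measure_display).
Context (T : measurableType d) (P : probability T R) (W : T -> n.-tuple R).
Context (S : measurableType d') (Q : probability S R).
Context (m : nat) (V : 'I_m.+1 -> S -> n.-tuple R).
Context (mW : measurable_fun setT W) (W_ge0 : forall w i, 0 <= tnth (W w) i).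
Context (LW : forall i, L1 P (fun w => tnth (W w) i)).
Context (partsV : nonneg_iid_parts P W Q V).

Let sumV w := sum_tuple (fun k => V k w).
Let VT w := [tuple V k w | k < m.+1].

Let mV k : measurable_fun setT (V k).
Proof. by have [h _ _ _ _] := partsV; exact: h. Qed.

Let V_ge0 k w i : 0 <= tnth (V k w) i.
Proof. by have [_ h _ _ _] := partsV; exact: h. Qed.

Let sumV_law : same_law P W Q sumV.
Proof. by have [_ _ _ _ h] := partsV. Qed.

Let msumV : measurable_fun setT sumV.
Proof. exact: measurable_sum_tuple. Qed.

Let mVk i k : measurable_fun setT (fun w => tnth (V k w) i).
Proof. exact: measurable_tnth_comp. Qed.

Let mVA k A : measurable A -> measurable (V k @^-1` A).
Proof. by move=> mA; rewrite -[X in measurable X]setTI; exact: mV. Qed.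

Let LV i k : L1 Q (fun w => tnth (V k w) i).
Proof.
apply: (@L1_le _ _ _ _ _ (fun w => tnth (sumV w) i)) => //.
  move=> w; rewrite ger0_norm // tnth_mktuple (bigD1 k) //= lerDl.
  by apply: sumr_ge0.
by apply: (same_law_L1 mW msumV sumV_law (measurable_tnth i)); exact: LW.
Qed.

Let rect_V (A : 'I_m.+1 -> set (n.-tuple R)) : (forall k, measurable (A k)) ->
  Q [set w | forall k, A k (V k w)] = (\prod_(k < m.+1) Q (V k @^-1` A k))%E.
Proof.
move=> mA; have [_ _ h _ _] := partsV; rewrite -h //; congr (Q _).
by apply/seteqP; split=> w /= hw k; [move=> _; exact: hw|exact: hw].
Qed.

Let measurable_mkVT (d1 : measure_display) (S1 : measurableType d1)
    (U : 'I_m.+1 -> S1 -> n.-tuple R) : (forall k, measurable_fun setT (U k)) ->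
  measurable_fun setT (fun w => [tuple U k w | k < m.+1]).
Proof.
move=> mU; apply/measurable_fun_tnthP => k.
by rewrite (_ : _ \o _ = U k) //; apply/funext => w /=; rewrite tnth_mktuple.
Qed.

(** The law of the tuple is a product of identical factors. Involutions cover the transpositions of
    [ord0] and [k] used below. *)
Lemma parts_exchangeable (s : 'I_m.+1 -> 'I_m.+1) : involutive s ->
  same_law Q VT Q (fun w => [tuple V (s k) w | k < m.+1]).
Proof.
move=> sK; apply: rectangles_same_law; [exact: measurable_mkVT|exact: measurable_mkVT|].
move=> A mA.
have -> : [set w | forall k, A k (tnth (VT w) k)] = [set w | forall k, A k (V k w)].
  by apply/seteqP; split=> w /= h k; have := h k; rewrite tnth_mktuple.
have -> : [set w | forall k, A k (tnth [tuple V (s k) w | k < m.+1] k)] =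
    [set w | forall k, A (s k) (V k w)].
  apply/seteqP; split=> w /= h k; last by have := h (s k); rewrite sK tnth_mktuple.
  by have := h (s k); rewrite tnth_mktuple sK.
have mAs k : measurable (A (s k)) by exact: mA.
rewrite (rect_V mA); have -> := rect_V mAs.
rewrite [RHS](reindex_inj (inv_inj sK)) /=; apply: eq_bigr => k _.
by rewrite sK; have [_ _ _ h _] := partsV; exact: h.
Qed.

(** Two independent copies of the space supply the head and the remaining parts; independence of the
    head becomes a product measure, ready for Fubini. *)
Lemma parts_split : same_law Q VT (Q \x Q)%E
  (fun w => [tuple V k (if k == ord0 then w.1 else w.2) | k < m.+1]).
Proof.
have m2 : measurable_fun setT
    (fun w : S * S => [tuple V k (if k == ord0 then w.1 else w.2) | k < m.+1]).
  apply: measurable_mkVT => k; case: (k == ord0).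
  - exact: (measurableT_comp (mV k) measurable_fst).
  - exact: (measurableT_comp (mV k) measurable_snd).
apply: rectangles_same_law => //; first exact: measurable_mkVT.
move=> A mA.
have -> : [set w | forall k, A k (tnth (VT w) k)] = [set w | forall k, A k (V k w)].
  by apply/seteqP; split=> w /= h k; have := h k; rewrite tnth_mktuple.
(* On the second factor the head is left free. *)
pose A' (k : 'I_m.+1) := if k == ord0 then setT else A k.
have mA' k : measurable (A' k) by rewrite /A'; case: ifP.
rewrite (_ : [set w : S * S | _] =
    (V ord0 @^-1` A ord0) `*` [set w | forall k, A' k (V k w)]); last first.
  apply/seteqP; split=> -[w1 w2] /= h.
    split=> [|k]; first by have := h ord0; rewrite tnth_mktuple eqxx.
    by have := h k; rewrite tnth_mktuple /A'; case: ifP.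
  move=> k; rewrite tnth_mktuple; case: h => h0 /(_ k).
  by rewrite /A'; case: eqP => [->|].
have mrect : measurable [set w | forall k, A' k (V k w)].
  rewrite (_ : [set w | _] = \bigcap_(k in [set: 'I_m.+1]) (V k @^-1` A' k)).
    by apply: fin_bigcap_measurable => // k _; exact: mVA.
  by apply/seteqP; split=> w /= hw k; [move=> _; exact: hw|exact: hw].
rewrite /= product_measure1E //; last exact: mVA.
rewrite (rect_V mA) big_ord_recl; congr (_ * _)%E.
apply: (eq_trans _ (esym (rect_V mA'))); rewrite big_ord_recl.
by rewrite /A' /= preimage_setT (probability_setT Q) mul1e.
Qed.

Let head_fun i (f : n.-tuple R -> R) (v : m.+1.-tuple (n.-tuple R)) : R :=
  tnth (tnth v ord0) i * f (sum_tuple (fun k => tnth v k)).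

Let measurable_head_fun i f : measurable_fun setT f -> measurable_fun setT (head_fun i f).
Proof.
move=> mf; apply: measurable_funM.
  exact: (measurableT_comp (measurable_tnth i) (measurable_tnth ord0)).
apply: (measurableT_comp mf); apply: measurable_sum_tuple => k.
exact: measurable_tnth.
Qed.

Let head_funE i f w : head_fun i f (VT w) = tnth (V ord0 w) i * f (sumV w).
Proof.
rewrite /head_fun tnth_mktuple; congr (_ * f _).
by apply: eq_from_tnth => j; rewrite !tnth_mktuple; apply: eq_bigr => k _; rewrite tnth_mktuple.
Qed.

Let bmf_sumV (f : n.-tuple R -> R) : bmf f -> bmf (fun w => f (sumV w)).
Proof. exact: bmf_comp. Qed.

Let L1_head i f : bmf f -> L1 Q (head_fun i f \o VT).
Proof.
move=> bf; rewrite (_ : _ \o _ = fun w => tnth (V ord0 w) i * f (sumV w)).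
  by apply: L1M; [exact: LV|exact: bmf_sumV].
by apply/funext => w; rewrite /= head_funE.
Qed.

(** Exchanging [ord0] and [k] leaves the total unchanged, so the [m.+1] terms obtained by expanding
    [W] into its parts have equal integrals. *)
Lemma parts_head_integral i f : bmf f ->
  m.+1%:R * \int[Q]_w (tnth (V ord0 w) i * f (sumV w)) =
  \int[P]_w (tnth (W w) i * f (W w)).
Proof.
move=> bf; have [mf _] := bf.
have -> : \int[P]_w (tnth (W w) i * f (W w)) = \int[Q]_w (tnth (sumV w) i * f (sumV w)).
  apply: (same_law_integral mW msumV sumV_law (F := fun y => tnth y i * f y)).
    by apply: measurable_funM => //; exact: measurable_tnth.
  by apply: L1M; [exact: LW|exact: bmf_comp].
under [RHS]eq_Rintegral do rewrite tnth_mktuple mulr_suml.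
rewrite Rint_sum; last by move=> k; apply: L1M; [exact: LV|exact: bmf_sumV].
rewrite (eq_bigr (fun=> \int[Q]_w (tnth (V ord0 w) i * f (sumV w)))).
  by rewrite sumr_const card_ord mulr_natl.
move=> k _; pose s (l : 'I_m.+1) := if l == ord0 then k else if l == k then ord0 else l.
have sK : involutive s.
  move=> l; rewrite /s; have [->|l0] := eqVneq l ord0.
    by rewrite eqxx; case: eqP.
  by have [->|lk] := eqVneq l k; rewrite ?eqxx // (negbTE l0) (negbTE lk).
have mhf := measurable_head_fun i mf.
have := same_law_integral (measurable_mkVT mV) (measurable_mkVT (fun k => mV (s k)))
  (parts_exchangeable sK) mhf (L1_head i bf).
under eq_Rintegral do rewrite -/(VT _) head_funE.
move=> ->; apply: eq_Rintegral => w _; rewrite /head_fun tnth_mktuple {1}/s eqxx.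
congr (_ * f _); apply: eq_from_tnth => j; rewrite !tnth_mktuple.
rewrite [RHS](reindex_inj (inv_inj sK)); apply: eq_bigr => l _.
by rewrite tnth_mktuple sK.
Qed.

Lemma parts_head_mean i :
  m.+1%:R * \int[Q]_w tnth (V ord0 w) i = \int[P]_w tnth (W w) i.
Proof.
have := @parts_head_integral i (fun=> 1) (@bmf_cst _ _ R 1).
by under eq_Rintegral do rewrite mulr1; under [in RHS]eq_Rintegral do rewrite mulr1.
Qed.

(** A nonnegative part is at most the total, so its biased tail is bounded uniformly in [m] by that
    of [W]: the source of tightness for the limit. *)
Lemma parts_head_tail i j K :
  m.+1%:R * \int[Q]_w (tnth (V ord0 w) i * ((K < tnth (V ord0 w) j)%R)%:R) <=
  \int[P]_w (tnth (W w) i * ((K < tnth (W w) j)%R)%:R).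
Proof.
have bK : bmf (fun y : n.-tuple R => ((K < tnth y j)%R)%:R : R).
  by apply: bmf_bool; apply: measurable_fun_ltr; [exact: measurable_cst|exact: measurable_tnth].
rewrite -(parts_head_integral i bK) ler_wpM2l //.
apply: le_Rint; [|by apply: L1M; [exact: LV|exact: (bmf_sumV bK)]|].
  by apply: L1M; [exact: LV|exact: (bmf_comp (mV ord0) bK)].
move=> w; rewrite ler_wpM2l //.
have [h|//] := boolP (K < tnth (V ord0 w) j).
rewrite (_ : K < tnth (sumV w) j) //; apply: (lt_le_trans h).
by rewrite tnth_mktuple (bigD1 ord0) //= lerDl sumr_ge0.
Qed.

(* W is an independent copy of the sum of all the parts: using it in place of the
   sum of the other parts shifts the argument of f by one part only. *)
Lemma parts_head_shift i (f : n.-tuple R -> R) (M : R) : measurable_fun setT f ->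
  0 <= M -> (forall y, `|f y| <= M) ->
  (forall y z, `|f y - f z| <= M * \sum_(j < n) `|tnth y j - tnth z j|) ->
  `|m.+1%:R * \int[Q]_w (tnth (V ord0 w) i * \int[P]_u f (addt (V ord0 w) (W u)))
    - \int[P]_w (tnth (W w) i * f (W w))| <=
  \int[P]_w tnth (W w) i * (M * \sum_(j < n) \int[P]_w tnth (W w) j) / m.+1%:R.
Proof.
move=> mf M0 fM fL; have bf : bmf f by split=> //; exists M.
rewrite -(parts_head_integral i bf) -mulrBr normrM ger0_norm //.
pose tailV w := [tuple \sum_(k < m.+1 | k != ord0) tnth (V k w) j | j < n].
pose tl := fun w => tailV w.
have mtl : measurable_fun setT tl.
  apply: measurable_mktuple => j.
  rewrite (_ : (fun w => _) = fun w => \sum_(k < m.+1) (if k != ord0 then tnth (V k w) j else 0)).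
    by apply: measurable_sum => k; case: (k != ord0) => //; exact: measurable_cst.
  by apply/funext => w; rewrite -big_mkcond.
have maddt (y : n.-tuple R) (d1 : measure_display) (S1 : measurableType d1)
    (X : S1 -> n.-tuple R) : measurable_fun setT X -> measurable_fun setT (fun w => addt y (X w)).
  by move=> mX; apply: measurable_addt => //; exact: measurable_cst.
have e1 : \int[Q]_w (tnth (V ord0 w) i * f (sumV w)) =
    \int[Q]_w (tnth (V ord0 w) i * \int[Q]_u f (addt (V ord0 w) (tl u))) /\
    L1 Q (fun w => tnth (V ord0 w) i * \int[Q]_u f (addt (V ord0 w) (tl u))).
  have mhf := measurable_head_fun i mf.
  have m2 : measurable_fun setT
      (fun w : S * S => [tuple V k (if k == ord0 then w.1 else w.2) | k < m.+1]).
    apply: measurable_mkVT => k; case: (k == ord0).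
    - exact: (measurableT_comp (mV k) measurable_fst).
    - exact: (measurableT_comp (mV k) measurable_snd).
  have := same_law_integral (measurable_mkVT mV) m2 parts_split mhf (L1_head i bf).
  under eq_Rintegral do rewrite -/(VT _) head_funE.
  move=> ->.
  have hE w : head_fun i f [tuple V k (if k == ord0 then w.1 else w.2) | k < m.+1] =
      tnth (V ord0 w.1) i * f (addt (V ord0 w.1) (tl w.2)).
    rewrite /head_fun tnth_mktuple eqxx; congr (_ * f _).
    apply: eq_from_tnth => j; rewrite !tnth_mktuple (bigD1 ord0) //= tnth_mktuple eqxx.
    by congr (_ + _); apply: eq_bigr => k /negbTE k0; rewrite tnth_mktuple k0.
  under eq_Rintegral do rewrite hE.
  exact: Rfubini_addt.
have e2 y : \int[P]_u f (addt y (W u)) = \int[Q]_u f (addt y (sumV u)).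
  apply: (same_law_integral mW msumV sumV_law (F := fun z => f (addt y z))).
    by apply: (measurableT_comp mf); apply: maddt; exact: measurable_id.
  by apply: L1_bmf; apply: bmf_comp bf; exact: maddt.
(* [sumV u] and [tl u] differ by the head alone, whose mean is that of [W] divided by [m.+1]. *)
have dE y : `|\int[Q]_u f (addt y (sumV u)) - \int[Q]_u f (addt y (tl u))| <=
    M * \sum_(j < n) \int[Q]_w tnth (V ord0 w) j.
  have b1 : bmf (fun u => f (addt y (sumV u))) by apply: bmf_comp bf; exact: maddt.
  have b2 : bmf (fun u => f (addt y (tl u))) by apply: bmf_comp bf; exact: maddt.
  rewrite -RexpB // -Rint_sum; last by move=> j; exact: LV.
  have Ls : L1 Q (fun w => \sum_(j < n) tnth (V ord0 w) j) by apply: L1_sum => j; exact: LV.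
  rewrite -RintZ //; apply: Rint_norm_le.
  - by apply: L1_bmf; exact: bmfB.
  - exact: L1Z.
  - move=> w; apply: (le_trans (fL _ _)); rewrite ler_wpM2l //; apply: ler_sum => j _.
    rewrite !tnth_mktuple (bigD1 ord0) //= opprD addrACA subrr add0r addrK.
    by rewrite ger0_norm.
have [e1a L1b] := e1; rewrite e1a.
have [_ L1a] := Rfubini_addt Q (LV i ord0) (mV ord0) msumV bf.
under eq_Rintegral do rewrite e2.
rewrite -RintB //.
pose c := M * \sum_(j < n) \int[Q]_w tnth (V ord0 w) j.
apply: (le_trans (y := m.+1%:R * (c * \int[Q]_w tnth (V ord0 w) i))).
  rewrite ler_wpM2l // -RintZ //; apply: Rint_norm_le; [exact: L1B|exact: L1Z|].
  by move=> w; rewrite -mulrBr normrM ger0_norm // mulrC ler_wpM2r // dE.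
have Ve j : \int[Q]_w tnth (V ord0 w) j = \int[P]_w tnth (W w) j / m.+1%:R.
  by rewrite -parts_head_mean mulrC mulKf.
rewrite mulrCA parts_head_mean /c (eq_bigr (fun j => \int[P]_w tnth (W w) j / m.+1%:R)) //.
rewrite -mulr_suml; set p := \int[P]_w _; set q := \sum_(j < n) _.
by rewrite [leRHS](_ : _ = M * (q / m.+1%:R) * p) //; ring.
Qed.

End IidParts.

(** * The biased law of one part as a positive functional *)

Section HeadFunctional.
Context (R : realType) (d : measure_display) (T : measurableType d).
Context (P : probability T R) (E : Type) (psi : E -> T -> R).
Context (mpsi : forall x, measurable_fun setT (psi x)).
Context (psi_ge0 : forall x w, 0 <= psi x w) (Lpsi : forall x, L1 P (psi x)).
Context (a : E) (c_gt0 : 0 < \int[P]_w psi a w).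
Context (F : seq E).

Let c := \int[P]_w psi a w.
Let tF := in_tuple (a :: F).
Let N := size (a :: F).

Definition covers (x : E) : Prop := exists i : 'I_N, tnth tF i = x.

(** Extension of a vector indexed by [a :: F] to a path on [E], by zero off the list. A position is
    chosen for each covered index, since the list may repeat it. *)
Let ext (v : N.-tuple R) (x : E) : R :=
  if pselect (covers x) is left h then tnth v (projT1 (cid h)) else 0.

Let extE (x : E) : covers x -> exists2 i : 'I_N, tnth tF i = x &
  forall v, ext v x = tnth v i.
Proof.
move=> h; exists (projT1 (cid h)); first exact: projT2 (cid h).
move=> v; rewrite /ext; case: pselect => [h'|//]; by rewrite (Prop_irrelevance h' h).
Qed.

Let ext_ge0 v : (forall i, 0 <= tnth v i) -> forall x, 0 <= ext v x.
Proof. by move=> v0 x; rewrite /ext; case: pselect. Qed.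

Let measurable_ext (d' : measure_display) (S : measurableType d') (V : S -> N.-tuple R) :
  measurable_fun setT V -> measurable_fun setT (fun w => ext (V w) : path_space E R).
Proof.
move=> mV; apply: measurable_path => x; rewrite /ext.
case: pselect => h; last exact: measurable_cst.
exact: measurable_tnth_comp.
Qed.

(* Lam g = (m / c) E[Y_a g(Y)], for Y the first of m iid parts of (psi x)_{x in F}. *)
Lemma head_functional : infinitely_divisible P psi ->
  exists Lam : (path_space E R -> R) -> R,
  [/\ positive_functional Lam, Lam (fun=> 1) = 1,
      forall x K, covers x -> Lam (fun z => ((K < z x)%R)%:R) <=
        c^-1 * \int[P]_w (psi a w * ((K < psi x w)%R)%:R)
    & forall n (y : n.-tuple E) (f : n.-tuple R -> R) (M : R),
        (forall i, covers (tnth y i)) -> measurable_fun setT f ->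
        0 <= M -> (forall y, `|f y| <= M) ->
        (forall y z, `|f y - f z| <= M * \sum_(j < n) `|tnth y j - tnth z j|) ->
        `|Lam (fun z => \int[P]_u f (addt [tuple z (tnth y i) | i < n] (marginal psi y u)))
          - c^-1 * \int[P]_w (psi a w * f (marginal psi y w))| <= M * n.+1%:R / N%:R].
Proof.
move=> idP.
pose W := marginal psi tF.
have WE w i : tnth (W w) i = psi (tnth tF i) w by rewrite tnth_mktuple.
have mW : measurable_fun setT W by exact: measurable_marginal.
have W_ge0 w i : 0 <= tnth (W w) i by rewrite WE.
have LW i : L1 P (fun w => tnth (W w) i).
  by rewrite (_ : (fun w => _) = psi (tnth tF i)) //; apply/funext => w; rewrite WE.
pose s := \sum_(j < N) \int[P]_w tnth (W w) j.
have s_ge0 : 0 <= s by apply: sumr_ge0 => j _; exact: Rint_ge0.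
(* More than [N * s] parts, with [s] the sum of the means, bring the shift error [s / m.+1] below
   [1 / N]. *)
pose m := Num.bound (N%:R * s).
have ms : s / m.+1%:R <= N%:R^-1.
  have := archi_boundP (mulr_ge0 (ler0n R N) s_ge0); rewrite -/m => h.
  rewrite ler_pdivrMr // mulrC ler_pdivlMr // mulrC (le_trans (ltW h)) //.
  by rewrite ler_nat.
have [d' [S [Q [V partsV]]]] := infinitely_divisible_nonneg_parts mW W_ge0 (idP _ tF) (ltn0Sn m).
have [mV V_ge0 _ _ _] := partsV.
have mV0 : measurable_fun setT (V ord0) by exact: mV.
have cE : \int[P]_w tnth (W w) ord0 = c.
  by apply: eq_Rintegral => w _; rewrite WE.
have LV : L1 Q (fun w => tnth (V ord0 w) ord0).
  have [_ _ _ _ slaw] := partsV.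
  have msum := measurable_sum_tuple mV.
  have := same_law_L1 mW msum slaw (measurable_tnth ord0) (LW ord0).
  apply: L1_le; first exact: measurable_tnth_comp.
  move=> w; rewrite ger0_norm //= tnth_mktuple (bigD1 ord0) //= lerDl.
  by apply: sumr_ge0.
have c0 : c != 0 by rewrite gt_eqF.
have bext (g : path_space E R -> R) : bmf g -> bmf (fun w => g (ext (V ord0 w))).
  by move=> bg; apply: (bmf_comp (measurable_ext mV0) bg).
exists (fun g => c^-1 * (m.+1%:R * \int[Q]_w (tnth (V ord0 w) ord0 * g (ext (V ord0 w))))).
split.
- split.
  + move=> f g bf bg; rewrite -!mulrDr; congr (_ * (_ * _)).
    under eq_Rintegral do rewrite mulrDr.
    by rewrite RintD //; apply: L1M => //; exact: bext.
  + move=> r f bf; rewrite [RHS]mulrCA (mulrCA r); congr (_ * (_ * _)).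
    rewrite -RintZ; last by apply: L1M => //; exact: bext.
    by apply: eq_Rintegral => w _; rewrite mulrCA.
  + move=> f bf f0; apply: mulr_ge0; first by rewrite invr_ge0 ltW.
    apply: mulr_ge0 => //; apply: Rint_ge0 => w.
    by apply: mulr_ge0 => //; apply: f0; apply: ext_ge0.
- under eq_Rintegral do rewrite mulr1.
  by rewrite (parts_head_mean mW LW partsV) cE mulVf.
- move=> x K /extE[i xi xE]; apply: ler_wpM2l; first by rewrite invr_ge0 ltW.
  under eq_Rintegral do rewrite xE.
  apply: (le_trans (parts_head_tail mW LW partsV ord0 i K)).
  by under eq_Rintegral do rewrite !WE xi.
- move=> n y f M cy mf M0 fM fL.
  have /choice[idx hidx] : forall i : 'I_n, exists j : 'I_N,
      tnth tF j = tnth y i /\ forall v, ext v (tnth y i) = tnth v j.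
    by move=> i; have [j h1 h2] := extE (cy i); exists j.
  pose f' (v : N.-tuple R) := f [tuple tnth v (idx i) | i < n].
  have mf' : measurable_fun setT f'.
    apply: (measurableT_comp mf); apply: measurable_mktuple => i.
    exact: measurable_tnth.
  (* [idx] need not be injective, which costs a factor up to [n] in the Lipschitz constant; [n.+1]
     also preserves the bound [M] when [n = 0]. *)
  have n0 : 0 <= M * n.+1%:R by rewrite mulr_ge0.
  have fM' v : `|f' v| <= M * n.+1%:R.
    by rewrite (le_trans (fM _)) // ler_peMr // ler1n.
  have fL' v w : `|f' v - f' w| <= M * n.+1%:R * \sum_(j < N) `|tnth v j - tnth w j|.
    apply: (le_trans (fL _ _)); rewrite -mulrA ler_wpM2l //.
    apply: (le_trans (y := \sum_(i < n) \sum_(j < N) `|tnth v j - tnth w j|)).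
      apply: ler_sum => i _; rewrite !tnth_mktuple (bigD1 (idx i)) //= lerDl.
      exact: sumr_ge0.
    rewrite sumr_const card_ord mulr_natl.
    by rewrite mulrS lerDr sumr_ge0.
  have := parts_head_shift mW LW partsV ord0 mf' n0 fM' fL'.
  have tWE w : [tuple tnth (W w) (idx i) | i < n] = marginal psi y w.
    by apply: eq_from_tnth => i; rewrite !tnth_mktuple; have [-> _] := hidx i.
  have e1 w u : f' (addt (V ord0 w) (W u)) =
      f (addt [tuple ext (V ord0 w) (tnth y i) | i < n] (marginal psi y u)).
    rewrite /f'; congr f; apply: eq_from_tnth => i; rewrite !tnth_mktuple.
    by have [-> ->] := hidx i.
  have e2 w : f' (W w) = f (marginal psi y w) by rewrite /f' tWE.
  under eq_Rintegral => w _ do under eq_Rintegral do rewrite e1.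
  under [X in _ - X]eq_Rintegral do rewrite e2 WE.
  rewrite cE -/s => h.
  rewrite -mulrBr normrM ger0_norm; last by rewrite invr_ge0 ltW.
  rewrite ler_pdivrMl //; apply: (le_trans h).
  rewrite [leLHS](_ : _ = c * (M * n.+1%:R * (s / m.+1%:R))); last by rewrite -!mulrA.
  apply: ler_wpM2l; first exact: ltW.
  by apply: ler_wpM2l; [exact: n0|exact: ms].
Qed.

End HeadFunctional.

Lemma tail_integral_cvg (d : measure_display) (T : measurableType d) (R : realType)
    (P : probability T R) (g X : T -> R) : (forall w, 0 <= g w) ->
  L1 P g -> measurable_fun setT X ->
  (fun k : nat => \int[P]_w (g w * ((k%:R < X w)%R)%:R)) @ \oo --> (0 : R).
Proof.
move=> g0 Lg mX.
rewrite -(Rexp_cst P 0); apply: (Rexp_dominated_cvg _ _ Lg) => [k||k w|].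
- apply: measurable_funM; first exact: L1_measurable Lg.
  have [] // := @bmf_bool _ _ R (fun w => k%:R < X w).
  by apply: measurable_fun_ltr; first exact: measurable_cst.
- exact: measurable_cst.
- by case: (_ < _); rewrite ?mulr1 ?mulr0 ?normr0 ?ger0_norm.
- apply: aeW => w; apply: cvg_near_cst; exists (Num.bound `|X w|) => // k /= hk.
  rewrite ltNge (_ : X w <= k%:R) ?mulr0 //.
  rewrite (le_trans (ler_norm _)) // (le_trans (ltW (archi_boundP (normr_ge0 _)))) //.
  by rewrite ler_nat.
Qed.

Lemma measurable_integral_addt (R : realType) n (d : measure_display)
    (T : measurableType d) (P : probability T R) (U : T -> n.-tuple R)
    (f : n.-tuple R -> R) : measurable_fun setT U -> bmf f ->
  measurable_fun setT (fun y => \int[P]_u f (addt y (U u))).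
Proof.
(* Measurability in [y] is extracted from Fubini, with a Dirac mass as an arbitrary probability on
   the [y] side. *)
move=> mU bf; pose Q := (\d_(point : n.-tuple R) : probability (n.-tuple R) R).
have [_ /L1_measurable] := @Rfubini_addt R n _ _ _ _ Q P (fun=> 1) id U f
  (L1_bmf Q (@bmf_cst _ _ R 1)) (@measurable_id _ _ setT) mU bf.
by under eq_fun do rewrite mul1r.
Qed.

Lemma blip_integral_addt (R : realType) n (d : measure_display)
    (T : measurableType d) (P : probability T R) (U : T -> n.-tuple R)
    (f : n.-tuple R -> R) : measurable_fun setT U -> blip f ->
  blip (fun y => \int[P]_u f (addt y (U u))).
Proof.
move=> mU bf; have [mf [M [M0 fM fL]]] := bf.
have bfy y : bmf (fun u => f (addt y (U u))).
  by apply: bmf_comp (blip_bmf bf); apply: measurable_addt => //; exact: measurable_cst.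
split; first by apply: measurable_integral_addt => //; exact: blip_bmf.
exists M; split=> // [y|y z]; first exact: Rexp_norm_le.
rewrite -RexpB //; apply: Rexp_norm_le; first exact: bmfB.
move=> u; apply: (le_trans (fL _ _)); rewrite ler_wpM2l //; apply: ler_sum => i _.
by rewrite !tnth_mktuple opprD addrACA subrr addr0.
Qed.

Lemma sigma_process_preimage (d d' : measure_display) (T : measurableType d)
    (T' : measurableType d') (R : realType) (E : Type) (X : E -> T -> R) (p : T' -> T) :
  (forall x, measurable_fun setT (X x)) ->
  forall A, sigma_process (fun x => X x \o p) A ->
  exists2 B, measurable B & A = p @^-1` B.
Proof.
move=> mX; apply: smallest_sub.
- split.
  + by exists set0; [exact: measurable0|rewrite preimage_set0].
  + move=> _ [B mB ->]; exists (~` B); first exact: measurableC.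
    by rewrite setTD preimage_setC.
  + move=> F hF; have /choice[G hG] : forall k, exists B, measurable B /\ F k = p @^-1` B.
      by move=> k; have [B mB e] := hF k; exists B.
    exists (\bigcup_k G k); first by apply: bigcup_measurable => k _; have [] := hG k.
    by rewrite preimage_bigcup; apply: eq_bigcup => // k _; have [] := hG k.
- move=> _ [x [B mB ->]]; exists (X x @^-1` B) => //.
  by rewrite -[X in measurable X]setTI; exact: mX.
Qed.

Definition size_bias_decomposition (R : realType) (d : measure_display)
    (T : measurableType d) (P : probability T R) (E : Type) (psi : E -> {RV P >-> R})
    (a : E) : Prop :=
  exists (d' : measure_display) (T' : measurableType d')
       (P' : probability T' R) (psi' l : E -> {RV P' >-> R}),
       [/\ eq_law P psi P' psi',
           independent_processes P' psi' l
         & eq_law (size_biased P (psi a)) psi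
                  P' (fun x w => psi' x w + l x w)].

(** * From infinite divisibility to the independent summand *)

Section Forward.
Context (R : realType) (d : measure_display) (T : measurableType d).
Context (P : probability T R) (E : Type) (psi : E -> {RV P >-> R}).
Context (psi_ge0 : forall x w, 0 <= psi x w) (Lpsi : forall x, L1 P (psi x)).
Context (a : E) (c_gt0 : 0 < \int[P]_w psi a w).

Let c := \int[P]_w psi a w.
Let mpsi x : measurable_fun setT (psi x). Proof. exact: measurable_funPT. Qed.

Lemma bias_functional : infinitely_divisible P psi ->
  exists L : (path_space E R -> R) -> R,
  [/\ positive_functional L, L (fun=> 1) = 1,
      forall i e, 0 < e -> exists K : R, L (fun z : path_space E R => ((K < z i)%R)%:R) <= e
    & forall n (y : n.-tuple E) f, blip f ->
        L (fun z => \int[P]_u f (addt [tuple z (tnth y i) | i < n] (marginal psi y u))) =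
        c^-1 * \int[P]_w (psi a w * f (marginal psi y w))].
Proof.
move=> idP.
have /choice[Lam hLam] := fun F => head_functional mpsi psi_ge0 Lpsi c_gt0 F idP.
(* The error of a head functional is of order one over the length of its list, so besides covering
   [F0] the list must be long; repeating [a] reaches any length even if [E] is finite. *)
pose G : set_system (seq E) := filter_from setT
  (fun F0 : seq E => [set F | (forall x, List.In x F0 -> covers a F x) /\ (size F0 <= size F)%N]).
have inT (x : E) (F : seq E) : List.In x F -> exists i : 'I_(size F), tnth (in_tuple F) i = x.
  elim: F => //= b F IH [->|/IH[i hi]]; first by exists ord0.
  by exists (lift ord0 i); rewrite -hi !(tnth_nth x).
have covI (x : E) (F : seq E) : List.In x F -> covers a F x.
  by move=> xF; apply: inT; right.
have GF : ProperFilter G.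
  apply: filter_from_proper.
    apply: filter_from_filter; first by exists [::].
    move=> F1 F2 _ _; exists (F1 ++ F2) => // F [hF sF]; split; split.
    - by move=> x xF; apply: hF; apply/List.in_or_app; left.
    - by rewrite (leq_trans _ sF) // size_cat leq_addr.
    - by move=> x xF; apply: hF; apply/List.in_or_app; right.
    - by rewrite (leq_trans _ sF) // size_cat leq_addl.
  by move=> F0 _; exists F0; split=> // x; exact: covI.
have [U [UU GU]] := ultraFilterLemma GF.
have pLam F : positive_functional (Lam F) by have [] := hLam F.
have c1 : (fun F => Lam F (fun=> 1)) @ U --> (1 : R).
  by apply: cvg_near_cst; apply: nearW => F; have [] := hLam F.
have [L [pL Lu cL]] := functional_limit UU pLam c1.
have Ucov (s : seq E) k : U [set F | (forall x, List.In x s -> covers a F x) /\ (k <= size F)%N].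
  apply: GU; exists (s ++ nseq k a) => // F [hF sF]; split.
    by move=> x xF; apply: hF; apply/List.in_or_app; left.
  by rewrite (leq_trans _ sF) // size_cat size_nseq leq_addl.
exists L; split=> //.
- move=> x e e0; have := tail_integral_cvg (psi_ge0 a) (Lpsi a) (mpsi x).
  move=> /cvgrPdist_lt /(_ (c * e) (mulr_gt0 c_gt0 e0))[k0 _ /(_ k0 (leqnn _))] h.
  exists k0%:R; have lim := cL _ (bmf_gt k0%:R x).
  rewrite -(cvg_lim (@Rhausdorff R) lim); apply: limr_le; first exact: cvgP lim.
  apply: filterS (Ucov [:: x] 0%N) => F [hF _].
  have [_ _ tl _] := hLam F; apply: (le_trans (tl _ _ (hF x (or_introl erefl)))).
  rewrite ler_pdivrMl //; move: h; rewrite sub0r normrN => h.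
  by rewrite (le_trans (ler_norm _)) // ltW.
- move=> n y f bf; have [mf [M [M0 fM fL]]] := bf.
  have mU : measurable_fun setT (marginal psi y) by exact: measurable_marginal.
  have bH := blip_integral_addt P mU bf.
  have lim := cL _ (@bmf_blip E R n y _ bH).
  apply: (@cvg_unique _ (@Rhausdorff R) _ _ _ _ lim).
  apply/cvgrPdist_le => e e0.
  pose k := Num.bound (M * n.+1%:R / e).
  apply: filterS (Ucov (tval y) k) => F [hF sF].
  have [_ _ _ /(_ n y f M)] := hLam F; rewrite distrC => /(_ _ mf M0 fM fL) h.
  have cy i : covers a F (tnth y i).
    apply: hF; rewrite (tnth_nth (tnth y i)); have := ltn_ord i.
    rewrite -[X in (_ < X)%N](size_tuple y); elim: (tval y) (nat_of_ord i) => // b s IH [|j] /=.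
      by left.
    by rewrite ltnS => /IH; right.
  apply: (le_trans (h cy)); rewrite ler_pdivrMr //.
  have Me : 0 <= M * n.+1%:R / e by rewrite divr_ge0 ?mulr_ge0 // ltW.
  have := archi_boundP Me; rewrite -/k ltr_pdivrMr // => hk.
  apply: (le_trans (ltW hk)); rewrite mulrC; apply: ler_wpM2l; first exact: ltW.
  by rewrite ler_nat /=; exact: leqW.
Qed.

(** On a product space [Z] is read from the first factor and [psi] from the second. Integrating
    [psi] out leaves a bounded Lipschitz function of [Z], for which the representation of [L] is
    valid; the identity for [L] becomes the equality of laws. *)
Lemma forward_decomposition : infinitely_divisible P psi ->
  size_bias_decomposition psi a.
Proof.
move=> idP; have [L [pL Lu Lt Lf]] := bias_functional idP.
have [d2 [Om [mu [Z HZ]]]] := functional_representation pL Lu Lt.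
pose P' : probability (Om * T)%type R := (mu \x P)%E.
have mZ x : measurable_fun setT (Z x) by exact: measurable_funPT.
have mpsi' x : measurable_fun setT (psi x \o snd : Om * T -> R).
  exact: (measurableT_comp (mpsi x) measurable_snd).
have ml x : measurable_fun setT (Z x \o fst : Om * T -> R).
  exact: (measurableT_comp (mZ x) measurable_fst).
exists _, (Om * T)%type, P', (fun x => mfun_Sub (mem_set (mpsi' x))),
  (fun x => mfun_Sub (mem_set (ml x))).
have prodE (A : set Om) (B : set T) : measurable A -> measurable B ->
   P' (fst @^-1` A `&` snd @^-1` B) = (mu A * P B)%E.
  move=> mA mB; rewrite -product_measure1E //; congr (P' _).
have sndE (B : set T) : measurable B -> P' (snd @^-1` B) = P B.
  move=> mB; rewrite -[RHS]mul1e -(probability_setT mu) -prodE //.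
  by rewrite preimage_setT setTI.
have fstE (A : set Om) : measurable A -> P' (fst @^-1` A) = mu A.
  move=> mA; rewrite -[RHS]mule1 -(probability_setT P) -prodE //.
  by rewrite preimage_setT setIT.
split.
- move=> n x A mA; rewrite /pushforward.
  rewrite (_ : marginal _ x @^-1` A = snd @^-1` (marginal psi x @^-1` A)) //.
  rewrite sndE // -[X in measurable X]setTI; exact: measurable_marginal.
- move=> A B sA sB.
  have [A' mA' ->] := sigma_process_preimage mpsi sA.
  have [B' mB' ->] := sigma_process_preimage mZ sB.
  by rewrite setIC prodE // sndE // fstE // muleC.
- move=> n x A mA; rewrite /pushforward /size_biased.
  have cE : fine 'E_P[psi a] = c by rewrite expectation_def.
  rewrite cE.
  have mW2 : measurable_fun setT (marginal (fun x (w : Om * T) => psi x w.2 + Z x w.1) x).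
    apply: measurable_marginal => y; apply: measurable_funD; [exact: mpsi'|exact: ml].
  have Lc : L1 P (fun w => psi a w / c).
    by under eq_fun do rewrite mulrC; exact: L1Z.
  have psic_ge0 w : 0 <= psi a w / c by rewrite divr_ge0 // ltW.
  have mX : measurable_fun setT (marginal Z x) by exact: measurable_marginal.
  have mU : measurable_fun setT (marginal psi x) by exact: measurable_marginal.
  have L1c : L1 P' (fun=> 1) by apply: L1_bmf; exact: bmf_cst.
  rewrite (blip_determines psic_ge0 (fun=> ler01) Lc L1c mU mW2) //.
    rewrite integral_cst ?mul1e //.
    by rewrite -[X in measurable X]setTI; exact: mW2.
  move=> h bh; have [e _] := Rfubini_addt P (L1_bmf mu (@bmf_cst _ _ R 1)) mX mU (blip_bmf bh).
  have -> : \int[P']_w (1 * h (marginal (fun x (w : Om * T) => psi x w.2 + Z x w.1) x w)) =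
      \int[P']_z (1 * h (addt (marginal Z x z.1) (marginal psi x z.2))).
    apply: eq_Rintegral => z _; congr (1 * h _); apply: eq_from_tnth => i.
    by rewrite !tnth_mktuple addrC.
  rewrite e; under [RHS]eq_Rintegral do rewrite mul1r.
  have -> := HZ n x _ (blip_integral_addt P mU bh).
  rewrite Lf // -RintZ; last by apply: L1M => //; apply: (bmf_comp mU); exact: blip_bmf.
  by apply: eq_Rintegral => w _; rewrite mulrAC mulrC mulrA.
Qed.
End Forward.

(** * Roots of generating series *)

(* Comparing logarithmic derivatives in t: both Q ^+ m and the series of the
   p d satisfy y' = r(t) y. *)
Section SeriesRoot.
Context (R : realType) (A : comAlgType R) (m : nat) (p r q : nat -> A).
Context (pS : forall d, d.+1%:R *: p d.+1 = \sum_(j < d.+1) r j * p (d - j)%N).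
Context (qS : forall d, (m * d.+1)%:R *: q d.+1 = \sum_(j < d.+1) r j * q (d - j)%N).
Context (q0 : q 0 ^+ m = p 0) (m0 : (0 < m)%N).

Lemma series_root (D d : nat) : (d <= D)%N -> ((\poly_(i < D.+1) q i) ^+ m)`_d = p d.
Proof.
pose Q := \poly_(i < D.+1) q i; pose r' := \poly_(i < D) r i; rewrite -/Q.
have QE i : (i <= D)%N -> Q`_i = q i by move=> iD; rewrite coef_poly ltnS iD.
(* Everything is compared below degree [D], where the truncation of [q] is not seen. *)
have coef_congr (u v w : {poly A}) : (forall i, (i < D)%N -> v`_i = w`_i) ->
    forall i, (i < D)%N -> (u * v)`_i = (u * w)`_i.
  move=> vw i iD; rewrite !coefM; apply: eq_bigr => j _; rewrite vw //.
  by rewrite (leq_ltn_trans _ iD) // leq_subr.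
have dQ i : (i < D)%N -> (Q^`() *+ m)`_i = (r' * Q)`_i.
  move=> iD; rewrite coefMn coef_deriv QE // -mulrnA mulnC -scaler_nat qS coefM.
  apply: eq_bigr => j _; rewrite coef_poly QE; last by rewrite (leq_trans (leq_subr _ _)) // ltnW.
  by rewrite (leq_ltn_trans _ iD) // -ltnS.
have dQm i : (i < D)%N -> ((Q ^+ m)^`())`_i = (r' * Q ^+ m)`_i.
  move=> iD.
  have -> : (Q ^+ m)^`() = Q ^+ m.-1 * (Q^`() *+ m) by rewrite deriv_exp mulrnAr mulrC.
  by rewrite (coef_congr _ _ (r' * Q)) // mulrCA -exprSr prednK.
elim/ltn_ind: d => -[|d] IH dD.
  rewrite -q0; elim: m => [|k IHk]; first by rewrite !expr0 coef1.
  by rewrite !exprS coefM big_ord1 IHk QE.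
have := dQm d dD; rewrite coef_deriv coefM => e.
have : d.+1%:R *: (Q ^+ m)`_d.+1 = d.+1%:R *: p d.+1.
  rewrite scaler_nat e pS; apply: eq_bigr => j _; rewrite coef_poly IH.
  - by rewrite (leq_ltn_trans _ dD) // -ltnS.
  - by rewrite ltnS leq_subr.
  - by rewrite (leq_trans (leq_subr _ _)) // ltnW.
by move=> /(congr1 (fun x => d.+1%:R^-1 *: x)); rewrite !scalerA mulVf ?scale1r // pnatr_eq0.
Qed.

End SeriesRoot.

(** Course-of-values recursion: the next coefficient depends on all previous ones, so their list is
    carried along. It solves [m q' = r q] as power series with constant term [a]. *)
Fixpoint root_prefix (R : realType) (A : comAlgType R) (m : nat) (r : nat -> A)
    (a : A) (d : nat) : seq A :=
  if d is d'.+1 then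
    let s := root_prefix m r a d' in
    rcons s ((m * d)%:R^-1 *: \sum_(j < d) r j * nth 0 s (d' - j)%N)
  else [:: a].

Definition root_coef (R : realType) (A : comAlgType R) (m : nat) (r : nat -> A)
    (a : A) (d : nat) : A := nth 0 (root_prefix m r a d) d.

Section RootCoef.
Context (R : realType) (A : comAlgType R) (m : nat) (r : nat -> A) (a : A).
Local Notation q := (root_coef m r a).

Lemma size_root_prefix d : size (root_prefix m r a d) = d.+1.
Proof. by elim: d => //= d IH; rewrite size_rcons IH. Qed.

Lemma nth_root_prefix d i : (i <= d)%N -> nth 0 (root_prefix m r a d) i = q i.
Proof.
elim: d => [|d IH]; first by rewrite leqn0 => /eqP ->.
rewrite leq_eqVlt => /predU1P[->//|id].
by rewrite /= nth_rcons size_root_prefix id IH.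
Qed.

Lemma root_coefS d : q d.+1 =
  (m * d.+1)%:R^-1 *: \sum_(j < d.+1) r j * q (d - j)%N.
Proof.
rewrite {1}/root_coef /= nth_rcons size_root_prefix ltnn eqxx; congr (_ *: _).
by apply: eq_bigr => j _; rewrite nth_root_prefix // leq_subr.
Qed.

Lemma root_coef_rec d : (0 < m)%N ->
  (m * d.+1)%:R *: q d.+1 = \sum_(j < d.+1) r j * q (d - j)%N.
Proof.
by move=> m0; rewrite root_coefS scalerA mulfV ?scale1r // pnatr_eq0 -lt0n muln_gt0 m0.
Qed.

End RootCoef.

(** * Multivariate polynomials as finite measures on multi-indices *)

Section MpolyFunctional.
Context (R : realType) (n : nat).
Local Notation mp := (mpoly n R).
Local Notation mon := (multinom n).
Implicit Types (p q : mp) (k : mon) (h : mon -> R).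

Definition mp_nonneg p := forall k, 0 <= mcoeff k p.

Lemma mp_nonnegD p q : mp_nonneg p -> mp_nonneg q -> mp_nonneg (p + q).
Proof. by move=> hp hq k; rewrite mcoeffD addr_ge0. Qed.

Lemma mp_nonnegZ c p : 0 <= c -> mp_nonneg p -> mp_nonneg (c *: p).
Proof. by move=> c0 hp k; rewrite mcoeffZ mulr_ge0. Qed.

Lemma mp_nonnegM p q : mp_nonneg p -> mp_nonneg q -> mp_nonneg (p * q).
Proof.
by move=> hp hq k; rewrite mcoeffM sumr_ge0 // => i _; rewrite mulr_ge0.
Qed.

Lemma mp_nonneg_sum (I : Type) (s : seq I) (P : pred I) (F : I -> mp) :
  (forall i, P i -> mp_nonneg (F i)) -> mp_nonneg (\sum_(i <- s | P i) F i).
Proof.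
move=> hF; elim/big_ind: _ => [k|p q|//]; first by rewrite mcoeff0.
exact: mp_nonnegD.
Qed.

Lemma mp_nonnegX k : mp_nonneg (mpolyX R k).
Proof. by move=> k'; rewrite mcoeffX. Qed.

Lemma mp_nonneg1 : mp_nonneg 1.
Proof. by rewrite -mpolyX0; exact: mp_nonnegX. Qed.

Lemma mp_nonneg_exp p d : mp_nonneg p -> mp_nonneg (p ^+ d).
Proof.
by move=> hp; elim: d => [|d IH]; rewrite ?expr0 ?exprS; [exact: mp_nonneg1|exact: mp_nonnegM].
Qed.

(** The linear form sending the monomial [k] to [h k]. For nonnegative coefficients it is the
    integral of [h] against the measure putting mass [mcoeff k p] at [k]. *)
Definition mp_eval h p : R := \sum_(k <- msupp p) mcoeff k p * h k.

Lemma mp_evalwE B h p : (msize p <= B)%N ->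
  mp_eval h p = \sum_(k : bmultinom n B) mcoeff k p * h k.
Proof.
move=> pB; rewrite /mp_eval.
have inj : injective (@bmnm n B) by exact: val_inj.
rewrite (bigID (fun k : bmultinom n B => bmnm k \in msupp p)) /= [X in _ + X]big1 ?addr0; last first.
  by move=> k /memN_msupp_eq0 ->; rewrite mul0r.
rewrite -[RHS](big_map (@bmnm n B) (fun k => k \in msupp p) (fun k => mcoeff k p * h k)).
rewrite -[RHS]big_filter; apply: perm_big; apply: uniq_perm.
- exact: msupp_uniq.
- by apply: filter_uniq; rewrite map_inj_uniq // index_enum_uniq.
- move=> k; rewrite mem_filter; case kp : (k \in msupp p) => //=.
  have kB : (mdeg k < B)%N by rewrite (leq_trans (msize_mdeg_lt kp)).
  by apply/esym/mapP; exists (BMultinom kB); rewrite ?mem_index_enum.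
Qed.

Lemma mp_evalD h p q : mp_eval h (p + q) = mp_eval h p + mp_eval h q.
Proof.
pose B := maxn (msize p) (msize q).
rewrite (@mp_evalwE B) ?msizeD_le // (@mp_evalwE B h p) ?leq_maxl // (@mp_evalwE B h q) ?leq_maxr //.
by rewrite -big_split; apply: eq_bigr => k _; rewrite mcoeffD mulrDl.
Qed.

Lemma mp_evalZ h c p : mp_eval h (c *: p) = c * mp_eval h p.
Proof.
rewrite (@mp_evalwE (msize p)) ?msizeZ_le // (@mp_evalwE (msize p)) // mulr_sumr.
by apply: eq_bigr => k _; rewrite mcoeffZ mulrA.
Qed.

Lemma mp_eval0 h : mp_eval h 0 = 0.
Proof. by rewrite /mp_eval msupp0 big_nil. Qed.

Lemma mp_eval_sum (I : Type) (s : seq I) (P : pred I) h (F : I -> mp) :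
  mp_eval h (\sum_(i <- s | P i) F i) = \sum_(i <- s | P i) mp_eval h (F i).
Proof. by apply: (big_morph _ (mp_evalD h) (mp_eval0 h)). Qed.

Lemma mp_evalX h k : mp_eval h (mpolyX R k) = h k.
Proof. by rewrite /mp_eval msuppX big_seq1 mcoeffX eqxx mul1r. Qed.

Lemma mp_eval_add h h' p : mp_eval (fun k => h k + h' k) p = mp_eval h p + mp_eval h' p.
Proof. by rewrite -big_split; apply: eq_bigr => k _; rewrite mulrDr. Qed.

Lemma mp_eval_scale h c p : mp_eval (fun k => c * h k) p = c * mp_eval h p.
Proof. by rewrite mulr_sumr; apply: eq_bigr => k _; rewrite mulrCA. Qed.

Lemma mp_eval_norm_le h h' p : mp_nonneg p -> (forall k, `|h k| <= h' k) ->
  `|mp_eval h p| <= mp_eval h' p.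
Proof.
move=> p0 hh; apply: (le_trans (ler_norm_sum _ _ _)); apply: ler_sum => k _.
by rewrite normrM (ger0_norm (p0 k)) ler_wpM2l.
Qed.

Lemma mp_eval_mulX h j p :
  mp_eval h (mpolyX R (mnm1 j) * p) = mp_eval (fun k => h (mnm_add k (mnm1 j))) p.
Proof.
rewrite {1}(mpolyE p) mulr_sumr mp_eval_sum; apply: eq_bigr => k _.
by rewrite -scalerAr mp_evalZ -mpolyXD mp_evalX addmC.
Qed.

(** Total mass is evaluation at a point, hence a ring morphism: the mass of a power is the power of
    the mass. *)
Lemma mp_eval_meval p : mp_eval (fun=> 1) p = meval (fun=> 1) p.
Proof.
rewrite mevalE; apply: eq_bigr => k _; congr (_ * _).
by rewrite big1 // => i _; rewrite expr1n.
Qed.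

Lemma mcoeff_le_eval1 p k : mp_nonneg p -> mcoeff k p <= mp_eval (fun=> 1) p.
Proof.
move=> p0; have [kp|kp] := boolP (k \in msupp p); last first.
  by rewrite memN_msupp_eq0 // sumr_ge0 // => i _; rewrite mulr1.
rewrite /mp_eval (bigD1_seq k) ?msupp_uniq //= mulr1 lerDl sumr_ge0 // => i _.
by rewrite mulr1.
Qed.

(** The power is the generating polynomial of a sum of [m] independent multi-indices; each [K] lists
    their values. *)
Lemma mp_eval_exp (m B : nat) h (Q : mp) : (msize Q <= B)%N ->
  mp_eval h (Q ^+ m) = \sum_(K : {ffun 'I_m -> bmultinom n B})
    (\prod_(j < m) mcoeff (K j) Q) * h (\big[@mnm_add n/@mnm0 n]_(j < m) K j).
Proof.
move=> QB; rewrite {1}(mpolywE QB) -[m in LHS]card_ord -prodr_const.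
rewrite bigA_distr_bigA mp_eval_sum; apply: eq_bigr => K _.
rewrite (_ : \prod_(i in 'I_m) _ = (\prod_(j < m) mcoeff (K j) Q) *:
   mpolyX R (\big[@mnm_add n/@mnm0 n]_(j < m) K j)); last first.
  rewrite scaler_prod; congr (_ *: _).
  by rewrite (big_morph _ (@mpolyXD n R) (mpolyX0 n R)).
by rewrite mp_evalZ mp_evalX.
Qed.

End MpolyFunctional.

(** * Poisson generating polynomials *)

Lemma coef_exp_le (R : realType) (u v : {poly R}) m :
  (forall i, 0 <= u`_i <= v`_i) -> forall i, 0 <= (u ^+ m)`_i <= (v ^+ m)`_i.
Proof.
move=> uv; elim: m => [|m IH] i.
  by rewrite !expr0 lexx andbT coef1 ler0n.
rewrite !exprS !coefM; apply/andP; split.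
  by apply: sumr_ge0 => j _; rewrite mulr_ge0 //; [case/andP: (uv j)|case/andP: (IH (i - j)%N)].
apply: ler_sum => j _; have /andP[u0 le1] := uv j; have /andP[h0 le2] := IH (i - j)%N.
exact: ler_pM.
Qed.

(** Coefficients of the power of a truncation grow with the truncation, and the one of degree [i]
    settles at [p i]. So the mass of the power is at most a partial sum of [p]. *)
Lemma root_mass_le1 (R : realType) (m : nat) (p q : nat -> R) :
  (forall d, 0 <= q d) ->
  (forall D d, (d <= D)%N -> ((\poly_(i < D.+1) q i) ^+ m)`_d = p d) ->
  (forall B, \sum_(e < B) p e <= 1) ->
  forall D, (\sum_(d < D.+1) q d) ^+ m <= 1.
Proof.
move=> q0 root p1 D; pose Q D := \poly_(i < D.+1) q i.
have -> : \sum_(d < D.+1) q d = (Q D).[1].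
  by rewrite horner_poly; apply: eq_bigr => i _; rewrite expr1n mulr1.
rewrite -horner_exp horner_coef; set S := size _.
apply: le_trans (p1 S); apply: ler_sum => i _; rewrite expr1n mulr1.
rewrite -(root (maxn D i) i) ?leq_maxr //.
have := @coef_exp_le R (Q D) (Q (maxn D i)) m _ i => /(_ _)/andP[] // j.
rewrite !coef_poly; case: (ltnP j D.+1) => jD; last first.
  by rewrite lexx /=; case: ifP.
by rewrite (leq_trans jD) ?ltnS ?leq_maxl // q0 lexx.
Qed.

(** * Truncated roots and their mass defect *)

Section Approximants.
Context (R : realType) (n m : nat) (p q : nat -> mpoly n R).
Context (root : forall D d, (d <= D)%N -> ((\poly_(i < D.+1) q i) ^+ m)`_d = p d).
Context (q_ge0 : forall d, mp_nonneg (q d)).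
Context (p1 : forall B, \sum_(e < B) mp_eval (fun=> 1) (p e) <= 1).

Let Q D := \sum_(d < D.+1) q d.

Lemma approximant_nonneg D : mp_nonneg (Q D).
Proof. by apply: mp_nonneg_sum => d _. Qed.

Lemma approximant_mass_le1 D : mp_eval (fun=> 1) (Q D) ^+ m <= 1.
Proof.
rewrite mp_eval_sum; apply: (@root_mass_le1 R m (fun d => mp_eval (fun=> 1) (p d))
  (fun d => mp_eval (fun=> 1) (q d))) => //.
  by move=> d; apply: sumr_ge0 => k _; rewrite mulr1; exact: q_ge0.
move=> D' d dD; rewrite -(root dD) mp_eval_meval -coef_map /= rmorphXn /=.
congr (nth 0 (_ ^+ m : {poly R}) d); apply/polyP => i; rewrite coef_map !coef_poly.
by case: ifP => _; rewrite ?mp_eval_meval ?raddf0.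
Qed.

(** [Q D] is the truncated root with its grading variable set to 1. Up to degree [D] in that
    variable its power has coefficients [p d]; [e] gathers the higher ones, built from products of
    nonnegative polynomials. *)
Lemma approximant_split D : exists2 e, mp_nonneg e &
  Q D ^+ m = \sum_(d < D.+1) p d + e.
Proof.
pose P := \poly_(i < D.+1) q i.
have -> : Q D = P.[1].
  by rewrite horner_poly; apply: eq_bigr => i _; rewrite expr1n mulr1.
rewrite -horner_exp (@horner_coef_wide _ (maxn D.+1 (size (P ^+ m)))) ?leq_maxr //.
rewrite -(big_mkord xpredT (fun i => (P ^+ m)`_i * 1 ^+ i)) (big_cat_nat (n := D.+1)) ?leq_maxl //=.
exists (\sum_(D.+1 <= i < maxn D.+1 (size (P ^+ m))) (P ^+ m)`_i * 1 ^+ i).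
  apply: mp_nonneg_sum => i _; rewrite expr1n mulr1.
  elim: m i => [|k IH] i; first by rewrite expr0 coef1; case: (i == 0%N); [exact: mp_nonneg1|move=> ?; rewrite mcoeff0].
  rewrite exprS coefM; apply: mp_nonneg_sum => j _; apply: mp_nonnegM => //.
  by rewrite coef_poly; case: ifP => // _ ?; rewrite mcoeff0.
rewrite big_mkord; congr (_ + _); apply: eq_bigr => i _.
by rewrite expr1n mulr1 -(@root D i) // -ltnS.
Qed.

Lemma approximant_mass_ge D :
  \sum_(d < D.+1) mp_eval (fun=> 1) (p d) <= mp_eval (fun=> 1) (Q D) ^+ m.
Proof.
have -> : mp_eval (fun=> 1) (Q D) ^+ m = mp_eval (fun=> 1) (Q D ^+ m).
  by rewrite !mp_eval_meval rmorphXn.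
have [e e0 ->] := approximant_split D; rewrite mp_evalD mp_eval_sum lerDl.
by apply: sumr_ge0 => k _; rewrite mulr1; exact: e0.
Qed.

(** The power of [Q D] has mass at most one, so what it contains beyond the [p d] weighs at most the
    mass they miss. *)
Lemma approximant_eval D (h : multinom n -> R) (M : R) : (forall k, `|h k| <= M) ->
  `|mp_eval h (Q D ^+ m) - \sum_(d < D.+1) mp_eval h (p d)| <=
  M * (1 - \sum_(d < D.+1) mp_eval (fun=> 1) (p d)).
Proof.
move=> hM; have M0 : 0 <= M by exact: le_trans (normr_ge0 _) (hM (@mnm0 n)).
have [e e0 E] := approximant_split D.
have E1 : mp_eval (fun=> 1) e <= 1 - \sum_(d < D.+1) mp_eval (fun=> 1) (p d).
  rewrite lerBrDl -mp_eval_sum -mp_evalD -E.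
  by have := approximant_mass_le1 D; rewrite !mp_eval_meval rmorphXn.
rewrite E mp_evalD -mp_eval_sum addrAC subrr add0r.
apply: (le_trans (mp_eval_norm_le (h' := fun=> M * 1) e0 _)).
  by move=> k; rewrite mulr1.
by rewrite mp_eval_scale ler_wpM2l.
Qed.

End Approximants.

Section PoissonCoefficients.
Context (R : realType) (n : nat).
Implicit Types (y z : n.-tuple R) (t : R).

Definition lin_mp y : mpoly n R := \sum_(i < n) tnth y i *: mpolyX R (mnm1 i).

Definition tsum y : R := \sum_(i < n) tnth y i.

Definition pois (x : R) (d : nat) : R := expR (- x) * x ^+ d / d`!%:R.

(* Generating polynomial, in degree d, of independent Poisson variables with
   means t * y_i. *)
Definition poisson_mp t y (d : nat) : mpoly n R :=
  (expR (- (t * tsum y)) * t ^+ d / d`!%:R) *: lin_mp y ^+ d.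

(** [poisson_mp t y] lists the coefficients in [u] of [exp (- t * tsum y) * exp (t * u * lin_mp y)];
    this is its differential equation in [u]. *)
Lemma poisson_mpS t y d :
  d.+1%:R *: poisson_mp t y d.+1 = t *: (lin_mp y * poisson_mp t y d).
Proof.
rewrite /poisson_mp -scalerAr -exprS !scalerA; congr (_ *: _).
rewrite factS natrM exprS invfM.
have : d.+1%:R != 0 :> R by rewrite pnatr_eq0.
have : d`!%:R != 0 :> R by rewrite pnatr_eq0 -lt0n fact_gt0.
by move: (d.+1%:R) (d`!%:R) => u v u0 v0; field; rewrite u0 v0.
Qed.

Lemma poisson_mp0 t y : poisson_mp t y 0 = expR (- (t * tsum y)) *: 1.
Proof. by rewrite /poisson_mp !expr0 fact0 mulr1 divr1. Qed.

Lemma lin_mp_addt y z : lin_mp (addt y z) = lin_mp y + lin_mp z.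
Proof.
by rewrite -big_split; apply: eq_bigr => i _; rewrite tnth_mktuple scalerDl.
Qed.

Lemma tsum_addt y z : tsum (addt y z) = tsum y + tsum z.
Proof. by rewrite -big_split; apply: eq_bigr => i _; rewrite tnth_mktuple. Qed.

(** Superposition of independent Poisson vectors: the means add, the series multiply. *)
Lemma poisson_mp_addt t y z d : poisson_mp t (addt y z) d =
  \sum_(b < d.+1) poisson_mp t z b * poisson_mp t y (d - b)%N.
Proof.
rewrite /poisson_mp lin_mp_addt exprDn scaler_sumr; apply: eq_bigr => -[b /= bd] _.
have {}bd : (b <= d)%N by rewrite -ltnS.
have scale_eq c1 c2 c (u v : mpoly n R) k : c * k%:R = c1 * c2 ->
    c *: (v * u *+ k) = (c1 *: u) * (c2 *: v).
  by move=> e; rewrite -scalerAl -scalerAr scalerA -e -scaler_nat scalerA (mulrC u).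
apply: scale_eq; rewrite tsum_addt mulrDr opprD expRD -{1}(subnK bd) exprD.
have f0 k : k`!%:R != 0 :> R by rewrite pnatr_eq0 -lt0n fact_gt0.
have -> : d`!%:R = 'C(d, b)%:R * (b`!%:R * (d - b)`!%:R) :> R.
  by rewrite -!natrM bin_fact.
have c0 : 'C(d, b)%:R != 0 :> R by rewrite pnatr_eq0 -lt0n bin_gt0.
by field; rewrite c0 !f0.
Qed.

Lemma lin_mp_nonneg y : (forall i, 0 <= tnth y i) -> mp_nonneg (lin_mp y).
Proof.
move=> y0; apply: mp_nonneg_sum => i _; apply: mp_nonnegZ => //; exact: mp_nonnegX.
Qed.

Lemma poisson_mp_nonneg t y d : 0 <= t -> (forall i, 0 <= tnth y i) ->
  mp_nonneg (poisson_mp t y d).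
Proof.
move=> t0 y0; apply: mp_nonnegZ; last by apply: mp_nonneg_exp; exact: lin_mp_nonneg.
by rewrite divr_ge0 // mulr_ge0 ?expR_ge0 // exprn_ge0.
Qed.

Lemma mp_eval_lin_mul h y p : mp_eval h (lin_mp y * p) =
  \sum_(j < n) tnth y j * mp_eval (fun k => h (mnm_add k (mnm1 j))) p.
Proof.
rewrite mulr_suml mp_eval_sum; apply: eq_bigr => j _.
by rewrite -scalerAl mp_evalZ mp_eval_mulX.
Qed.

(** Multiplying by [lin_mp y] adds one event of type [j] with weight [tnth y j], and only [j = i]
    moves coordinate [i]. This gives the recursions for moments. *)
Lemma mp_eval_coord_lin_mul (g : nat -> R) i y p :
  mp_eval (fun k => g (k i)) (lin_mp y * p) =
  tsum y * mp_eval (fun k => g (k i)) p +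
  tnth y i * mp_eval (fun k => g (k i).+1 - g (k i)) p.
Proof.
rewrite mp_eval_lin_mul /tsum (bigD1 i) //= (bigD1 (P := predT) i) //= mulrDl.
have -> : mp_eval (fun k => g (mnm_add k (mnm1 i) i)) p =
    mp_eval (fun k => g (k i)) p + mp_eval (fun k => g (k i).+1 - g (k i)) p.
  rewrite -mp_eval_add; apply: eq_bigr => k _.
  by rewrite mnmDE mnm1E eqxx addn1 addrC subrK.
rewrite mulrDr -!addrA; congr (_ + _); rewrite addrC; congr (_ + _).
rewrite mulr_suml; apply: eq_bigr => j /negbTE ji; congr (_ * _).
by apply: eq_bigr => k _; rewrite mnmDE mnm1E ji addn0.
Qed.

Lemma mp_eval1_lin_exp y e : mp_eval (fun=> 1) (lin_mp y ^+ e) = tsum y ^+ e.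
Proof.
rewrite mp_eval_meval rmorphXn; congr (_ ^+ e); rewrite /= -mp_eval_meval.
rewrite mp_eval_sum; apply: eq_bigr => i _.
by rewrite mp_evalZ mp_evalX mulr1.
Qed.

Lemma mp_eval1_exp0 h : mp_eval h (1 : mpoly n R) = h (@mnm0 n).
Proof. by rewrite -mpolyX0 mp_evalX. Qed.

Lemma mean_lin_exp i y e :
  mp_eval (fun k => (k i)%:R) (lin_mp y ^+ e) = e%:R * tnth y i * tsum y ^+ e.-1.
Proof.
elim: e => [|e IH]; first by rewrite expr0 mp_eval1_exp0 mnm0E !mul0r.
rewrite exprS (mp_eval_coord_lin_mul (fun k => k%:R)) IH.
under [X in _ + _ * X]eq_bigr do rewrite -natr1 addrAC subrr add0r.
rewrite -/(mp_eval (fun=> 1) _) mp_eval1_lin_exp -natr1 /=.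
by case: e {IH} => [|e] /=; rewrite ?exprS; ring.
Qed.

(** The increment of this moment is twice the coordinate, so the recursion closes on
    [mean_lin_exp]. *)
Lemma factorial_moment_lin_exp i y e :
  mp_eval (fun k => (k i)%:R * (k i)%:R - (k i)%:R) (lin_mp y ^+ e) =
  e%:R * e.-1%:R * tnth y i ^+ 2 * tsum y ^+ e.-2.
Proof.
elim: e => [|e IH]; first by rewrite expr0 mp_eval1_exp0 mnm0E !mul0r subrr.
rewrite exprS (mp_eval_coord_lin_mul (fun k => k%:R * k%:R - k%:R)) IH.
have -> : mp_eval (fun k : multinom n => (k i).+1%:R * (k i).+1%:R - (k i).+1%:R -
    ((k i)%:R * (k i)%:R - (k i)%:R)) (lin_mp y ^+ e) =
    2 * mp_eval (fun k => (k i)%:R) (lin_mp y ^+ e).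
  by rewrite -mp_eval_scale; apply: eq_bigr => k _; congr (_ * _); rewrite -natr1; ring.
rewrite mean_lin_exp.
by case: e {IH} => [|[|e]] /=; rewrite -?natr1 ?exprS ?expr0 /=; ring.
Qed.

Lemma pois_ge0 x d : 0 <= x -> 0 <= pois x d.
Proof. by move=> x0; rewrite divr_ge0 // mulr_ge0 ?expR_ge0 // exprn_ge0. Qed.

Lemma mp_eval1_poisson t y d : mp_eval (fun=> 1) (poisson_mp t y d) = pois (t * tsum y) d.
Proof.
by rewrite /poisson_mp mp_evalZ mp_eval1_lin_exp /pois exprMn; ring.
Qed.

Lemma pois_cvg x : 0 <= x -> (fun D => \sum_(d < D) pois x d) @ \oo --> (1 : R).
Proof.
move=> x0; have -> : (fun D => \sum_(d < D) pois x d) =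
    (fun D => expR (- x) * series (exp_coeff x) D).
  apply/funext => D; rewrite /series /= big_mkord mulr_sumr; apply: eq_bigr => d _.
  by rewrite /pois /exp_coeff /= mulrA.
rewrite -[X in _ --> X](mulVf (lt0r_neq0 (expR_gt0 x))) -expRN.
by apply: cvgMr; exact: is_cvg_series_exp_coeff.
Qed.

Lemma pois_sum_le1 x D : 0 <= x -> \sum_(d < D) pois x d <= 1.
Proof.
move=> x0; have h := pois_cvg x0.
rewrite -(cvg_lim (@Rhausdorff R) h).
apply: (@nondecreasing_cvgn_le R (fun D => \sum_(d < D) pois x d)); last exact: cvgP h.
apply/nondecreasing_seqP => k; rewrite big_ord_recr /= lerDl.
exact: pois_ge0.
Qed.

Lemma poissonS x d : pois x d.+1 = x / d.+1%:R * pois x d.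
Proof.
rewrite /pois exprS factS natrM.
have : d.+1%:R != 0 :> R by rewrite pnatr_eq0.
have : d`!%:R != 0 :> R by rewrite pnatr_eq0 -lt0n fact_gt0.
by move: (d.+1%:R) (d`!%:R) => u v u0 v0; field; rewrite u0 v0.
Qed.

(** Over all degrees the sum is the variance [a = t * tnth y i] of a Poisson variable. Partial sums
    telescope to [a] times a Poisson partial sum plus a boundary term, nonpositive once the degree
    passes the mean. *)
Lemma poisson_variance t y i D : 0 <= t -> (forall j, 0 <= tnth y j) ->
  \sum_(d < D) mp_eval (fun k => ((k i)%:R - t * tnth y i) ^+ 2) (poisson_mp t y d)
  <= t * tnth y i.
Proof.
move=> t0 y0; pose s := tsum y; have s0 : 0 <= s by exact: sumr_ge0.
pose a := t * tnth y i; have a0 : 0 <= a by rewrite mulr_ge0.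
pose V d := mp_eval (fun k => ((k i)%:R - a) ^+ 2) (poisson_mp t y d).
have V0 d : 0 <= V d.
  apply: sumr_ge0 => k _; rewrite mulr_ge0 ?sqr_ge0 //; exact: poisson_mp_nonneg.
have ts0 : 0 <= t * s by rewrite mulr_ge0.
pose F D := \sum_(d < D) pois (t * s) d.
have VE d : V d = a ^+ 2 * (if d is d'.+2 then pois (t * s) d' else 0) +
    (a - 2 * a ^+ 2) * (if d is d'.+1 then pois (t * s) d' else 0) + a ^+ 2 * pois (t * s) d.
  have -> : V d = mp_eval (fun k => (k i)%:R * (k i)%:R - (k i)%:R) (poisson_mp t y d) +
      (1 - 2 * a) * mp_eval (fun k => (k i)%:R) (poisson_mp t y d) +
      a ^+ 2 * mp_eval (fun=> 1) (poisson_mp t y d).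
    rewrite -!mp_eval_scale -!mp_eval_add; apply: eq_bigr => k _; congr (_ * _).
    by ring.
  rewrite mp_eval1_poisson /poisson_mp !mp_evalZ mean_lin_exp factorial_moment_lin_exp.
  rewrite -/s; congr (_ + _); case: d => [|[|d]].
  - by rewrite !mul0r !mulr0.
  - by rewrite /pois /a fact0 /= (_ : 1`! = 1%N) //; field.
  - rewrite /pois /a !factS !natrM !exprMn !exprS /=.
    have : d.+1%:R != 0 :> R by rewrite pnatr_eq0.
    have : d.+2%:R != 0 :> R by rewrite pnatr_eq0.
    have : d`!%:R != 0 :> R by rewrite pnatr_eq0 -lt0n fact_gt0.
    move: (d.+1%:R) (d.+2%:R) (d`!%:R) => d1 d2 f f0 d20 d10; rewrite expr0.
    by field; rewrite d10 d20 f0.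
have sumV B : \sum_(d < B.+2) V d =
    a ^+ 2 * (pois (t * s) B.+1 - pois (t * s) B) + a * F B.+1.
  elim: B => [|B IH].
    by rewrite /F !big_ord_recr !big_ord0 /= !VE; ring.
  by rewrite big_ord_recr IH VE /F !big_ord_recr /=; ring.
(* Beyond the mean [t * s] the weights [pois] decrease, which gives the boundary term its sign;
   lengthening the sum only increases it. *)
pose B := maxn D (Num.bound (t * s)).
apply: (le_trans (y := \sum_(d < B.+2) V d)).
  have DB : (D <= B.+2)%N by rewrite (leq_trans (leq_maxl _ (Num.bound (t * s)))) // -/B (leq_trans (leqnSn _)).
  rewrite -(big_mkord xpredT V) -(big_mkord xpredT V) (big_cat_nat (n := D) (p := B.+2)) //=.
  by rewrite lerDl sumr_ge0.
rewrite sumV -/a.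
have F1 : a * F B.+1 <= a by rewrite ler_piMr // pois_sum_le1.
have : pois (t * s) B.+1 <= pois (t * s) B.
  rewrite poissonS ler_piMl ?pois_ge0 // ler_pdivrMr // mul1r.
  rewrite (le_trans (ltW (archi_boundP ts0))) // ler_nat.
  by rewrite (leq_trans (leq_maxr D _)).
rewrite -subr_le0 => h; have : a ^+ 2 * (pois (t * s) B.+1 - pois (t * s) B) <= 0.
  by rewrite mulr_ge0_le0 // sqr_ge0.
by move=> h2; lra.
Qed.

(** With [t = N ^ 2] the rescaled counts have means [tnth y i] and variances [tnth y i / N ^ 2]. The
    factor of [h y] is truncated at the same [D], so that only fluctuations are left. *)
Lemma poisson_lipschitz (N : nat) y (h : n.-tuple R -> R) (M : R) D :
  (0 < N)%N -> (forall j, 0 <= tnth y j) -> 0 <= M ->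
  (forall y z, `|h y - h z| <= M * \sum_(i < n) `|tnth y i - tnth z i|) ->
  `|\sum_(d < D) mp_eval (fun k => h [tuple (k i)%:R / N%:R ^+ 2 | i < n])
       (poisson_mp (N%:R ^+ 2) y d)
    - h y * \sum_(d < D) pois (N%:R ^+ 2 * tsum y) d| <=
  M * \sum_(i < n) (tnth y i + 1) / (2 * N%:R).
Proof.
move=> N0 y0 M0 hL; have N0' : 0 < N%:R :> R by rewrite ltr0n.
set t := N%:R ^+ 2; have t0 : 0 <= t by rewrite exprn_ge0.
have nz : N%:R != 0 :> R by rewrite gt_eqF.
rewrite mulr_sumr -sumrB.
pose H (k : multinom n) := h [tuple (k i)%:R / t | i < n] - h y.
have E d : mp_eval (fun k => h [tuple (k i)%:R / t | i < n]) (poisson_mp t y d) -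
    h y * pois (t * tsum y) d = mp_eval H (poisson_mp t y d).
  rewrite -mp_eval1_poisson -mulN1r mulrA -mp_eval_scale -mp_eval_add.
  by apply: eq_bigr => k _; congr (_ * _); rewrite /H mulr1 mulN1r.
under eq_bigr do rewrite E.
pose G i (k : multinom n) : R := ((k i)%:R - t * tnth y i) ^+ 2 / (2 * N%:R ^+ 3) + 1 / (2 * N%:R).
have HG (k : multinom n) : `|H k| <= M * \sum_(i < n) G i k.
  apply: (le_trans (hL _ _)); rewrite ler_wpM2l //; apply: ler_sum => i _.
  rewrite tnth_mktuple /G; set u := (k i)%:R - t * tnth y i.
  have -> : (k i)%:R / t - tnth y i = u / N%:R ^+ 2 by rewrite /u /t; field.
  (* AM-GM: 2 |u| N <= u^2 + N^2 *)
  rewrite normrM (ger0_norm (x := (N%:R ^+ 2)^-1)) ?invr_ge0 ?exprn_ge0 //.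
  rewrite -subr_ge0 -(real_normK (num_real u)).
  have -> : `|u| ^+ 2 / (2 * N%:R ^+ 3) + 1 / (2 * N%:R) - `|u| / N%:R ^+ 2 =
      (`|u| - N%:R) ^+ 2 / (2 * N%:R ^+ 3) by field.
  by rewrite divr_ge0 ?sqr_ge0 // mulr_ge0 // exprn_ge0.
apply: (le_trans (ler_norm_sum _ _ _)).
apply: (le_trans (y := \sum_(d < D) mp_eval (fun k => M * \sum_(i < n) G i k) (poisson_mp t y d))).
  by apply: ler_sum => d _; apply: mp_eval_norm_le => //; exact: poisson_mp_nonneg.
under eq_bigr do rewrite mp_eval_scale.
rewrite -mulr_sumr ler_wpM2l //.
have -> : \sum_(d < D) mp_eval (fun k => \sum_(i < n) G i k) (poisson_mp t y d) =
    \sum_(i < n) \sum_(d < D) mp_eval (G i) (poisson_mp t y d).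
  rewrite exchange_big /=; apply: eq_bigr => d _.
  rewrite /mp_eval exchange_big /=; apply: eq_bigr => k _; by rewrite mulr_sumr.
apply: ler_sum => i _.
have -> : \sum_(d < D) mp_eval (G i) (poisson_mp t y d) =
    (2 * N%:R ^+ 3)^-1 * \sum_(d < D) mp_eval (fun k => ((k i)%:R - t * tnth y i) ^+ 2) (poisson_mp t y d)
    + (2 * N%:R)^-1 * \sum_(d < D) pois (t * tsum y) d.
  rewrite mulr_sumr [(2 * N%:R)^-1 * _]mulr_sumr -big_split; apply: eq_bigr => d _ /=.
  rewrite -mp_eval1_poisson -!mp_eval_scale -mp_eval_add; apply: eq_bigr => k _.
  by congr (_ * _); rewrite /G mulr1 mul1r mulrC.
have s0 : 0 <= t * tsum y by rewrite mulr_ge0 // sumr_ge0.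
rewrite [leRHS]mulrDl; apply: lerD; last by rewrite mul1r ler_piMr ?invr_ge0 ?mulr_ge0 // pois_sum_le1.
have -> : tnth y i / (2 * N%:R) = (2 * N%:R ^+ 3)^-1 * (t * tnth y i) by rewrite /t; field.
by rewrite ler_wpM2l ?invr_ge0 ?mulr_ge0 ?exprn_ge0 // poisson_variance.
Qed.

End PoissonCoefficients.

(** * The summand of a size-biased process *)

Lemma measurable_ltr_set (d : measure_display) (T : measurableType d) (R : realType)
    (f g : T -> R) : measurable_fun setT f -> measurable_fun setT g ->
  measurable [set w | f w < g w].
Proof.
move=> mf mg; rewrite (_ : [set w | _] = (fun w => f w < g w) @^-1` [set true]) //.
by rewrite -[X in measurable X]setTI; exact: measurable_fun_ltr.
Qed.

Section WeightedLaw.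
Context (R : realType) (d1 d2 d : measure_display).
Context (T1 : measurableType d1) (T2 : measurableType d2) (S : measurableType d).
Context (P1 : probability T1 R) (P2 : probability T2 R).
Context (G1 : T1 -> R) (W1 : T1 -> S) (G2 : T2 -> R) (W2 : T2 -> S).
Context (G1_ge0 : forall w, 0 <= G1 w) (G2_ge0 : forall w, 0 <= G2 w).
Context (LG1 : L1 P1 G1) (LG2 : L1 P2 G2).
Context (mW1 : measurable_fun setT W1) (mW2 : measurable_fun setT W2).

(** A bounded nonnegative [k * u] is within one of the number of positive integers below it, a sum
    of indicators. Hence [k] times the difference of the two integrals stays bounded, and the
    difference vanishes. *)
Lemma weighted_law_integral :
  (forall A, measurable A ->
    \int[P1]_w (G1 w * \1_A (W1 w)) = \int[P2]_w (G2 w * \1_A (W2 w))) ->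
  forall g, bmf g -> \int[P1]_w (G1 w * g (W1 w)) = \int[P2]_w (G2 w * g (W2 w)).
Proof.
move=> eqA g bg; have [mg [M gM]] := bg.
(* Counting levels requires a nonnegative function; the constant [M] is removed at the end. *)
pose u y := g y + M.
have bu : bmf u by apply: bmfD => //; exact: bmf_cst.
have u0 y : 0 <= u y by have := gM y; rewrite ler_norml /u => /andP[]; lra.
have uM y : u y <= 2 * M by have := gM y; rewrite ler_norml /u => /andP[]; lra.
pose S_ (k N : nat) y : R := \sum_(j < N) ((j.+1%:R < k%:R * u y)%R)%:R.
pose A_ (k j : nat) := [set y | j.+1%:R < k%:R * u y].
have mA k j : measurable (A_ k j).
  apply: measurable_ltr_set; first exact: measurable_cst.
  by have [] := bmfZ k%:R bu.
have SE k N y : S_ k N y = \sum_(j < N) \1_(A_ k j) y.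
  by apply: eq_bigr => j _; rewrite indicE; congr ((nat_of_bool _)%:R); apply/idP/idP; rewrite inE.
have bS k N : bmf (S_ k N).
  rewrite (_ : S_ k N = fun y => \sum_(j < N) \1_(A_ k j) y); last exact/funext/SE.
  by apply: bmf_sum => j; exact: bmf_indic.
have eqS k N : \int[P1]_w (G1 w * S_ k N (W1 w)) = \int[P2]_w (G2 w * S_ k N (W2 w)).
  under eq_Rintegral do rewrite SE mulr_sumr.
  under [RHS]eq_Rintegral do rewrite SE mulr_sumr.
  rewrite !Rint_sum.
  - by apply: eq_bigr => j _; exact: eqA.
  - by move=> j; apply: L1M => //; exact: (bmf_comp mW2 (bmf_indic R (mA _ _))).
  - by move=> j; apply: L1M => //; exact: (bmf_comp mW1 (bmf_indic R (mA _ _))).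
have approx (dT : measure_display) (T : measurableType dT) (P : probability T R)
    (G : T -> R) (W : T -> S) k N : (forall w, 0 <= G w) -> L1 P G -> measurable_fun setT W ->
    2 * M * k%:R <= N%:R ->
    `|\int[P]_w (G w * S_ k N (W w)) - k%:R * \int[P]_w (G w * u (W w))| <= \int[P]_w G w.
  move=> G0 LG mW kN.
  have Lu : L1 P (fun w => G w * u (W w)) by apply: L1M => //; exact: bmf_comp.
  have LS : L1 P (fun w => G w * S_ k N (W w)).
    by apply: L1M => //; exact: (bmf_comp mW (bS k N)).
  rewrite -RintZ // -RintB //; last exact: L1Z.
  apply: Rint_norm_le => //; first by apply: L1B => //; exact: L1Z.
  move=> w; rewrite mulrCA -mulrBr normrM ger0_norm // ler_piMr //.
  have ku0 : 0 <= k%:R * u (W w) by rewrite mulr_ge0.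
  have := count_below_le N ku0; rewrite min_l //.
  by apply: le_trans kN; rewrite mulrC ler_wpM2r.
pose I1 := \int[P1]_w (G1 w * u (W1 w)); pose I2 := \int[P2]_w (G2 w * u (W2 w)).
pose c := \int[P1]_w G1 w + \int[P2]_w G2 w.
have M0 : 0 <= M by apply: le_trans (gM point).
have close (k : nat) : k%:R * `|I1 - I2| <= c.
  have kM : 0 <= 2 * M * k%:R by rewrite !mulr_ge0.
  have kN := ltW (archi_boundP kM).
  have h1 := approx _ _ _ _ _ k _ G1_ge0 LG1 mW1 kN.
  have h2 := approx _ _ _ _ _ k _ G2_ge0 LG2 mW2 kN.
  rewrite -(ger0_norm (ler0n R k)) -normrM mulrBr.
  move: h1 h2; rewrite eqS -/I1 -/I2 /c; set s := \int[P2]_w _; move=> h1 h2.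
  rewrite (_ : k%:R * I1 - k%:R * I2 = (s - k%:R * I2) - (s - k%:R * I1)); last by ring.
  apply: (le_trans (ler_normB _ _)); rewrite addrC; exact: lerD.
have II : I1 = I2.
  apply/eqP; rewrite -subr_eq0 -normr_eq0; apply/eqP/le_anti.
  rewrite normr_ge0 andbT leNgt; apply/negP => p.
  have c0 : 0 <= c / `|I1 - I2|.
    by rewrite divr_ge0 // addr_ge0 // Rint_ge0.
  have := archi_boundP c0; rewrite ltr_pdivrMr // ltNge => /negP; apply.
  exact: close.
have eqT : \int[P1]_w G1 w = \int[P2]_w G2 w.
  have := eqA setT measurableT.
  under eq_Rintegral do rewrite indicT mulr1.
  by under [X in _ = X -> _]eq_Rintegral do rewrite indicT mulr1.
have subE (dT : measure_display) (T : measurableType dT) (P : probability T R)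
    (G : T -> R) (W : T -> S) : L1 P G -> measurable_fun setT W ->
    \int[P]_w (G w * g (W w)) = \int[P]_w (G w * u (W w)) - M * \int[P]_w G w.
  move=> LG mW; rewrite -RintZ // -RintB //.
  - by apply: eq_Rintegral => w _; rewrite /u; ring.
  - by apply: L1M => //; exact: bmf_comp.
  - exact: L1Z.
by rewrite !subE // -/I1 -/I2 II eqT.
Qed.

End WeightedLaw.

Lemma sigma_process_marginal (d : measure_display) (T : measurableType d) (E : Type) (R : realType)
    (X : E -> T -> R) n (x : n.-tuple E) (A : set (n.-tuple R)) :
  measurable A -> sigma_process X (marginal X x @^-1` A).
Proof.
move=> mA; pose G := [set C | exists x : E, exists2 B : set R, measurable B & C = X x @^-1` B].
have mX (y : E) : measurable_fun setT (X y : g_sigma_algebraType G -> R).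
  by move=> _ B mB; rewrite setTI; apply: sub_sigma_algebra; exists y, B.
have := measurable_marginal x mX; move=> /(_ measurableT A mA).
by rewrite setTI.
Qed.

(* If P' (l < - e) > 0, let k be the least integer with P (X < k e) > 0: then
   X + l < (k - 1) e has positive probability. *)
Lemma dominated_summand_ge0 (R : realType) (d d' : measure_display)
    (T : measurableType d) (T' : measurableType d') (P : probability T R)
    (P' : probability T' R) (X : T -> R) (X' l : T' -> R) :
  measurable_fun setT X -> measurable_fun setT X' -> measurable_fun setT l ->
  (forall w, 0 <= X w) ->
  (forall r, P [set w | X w < r] = P' [set w | X' w < r]) ->
  (forall r s, P' ([set w | X' w < r] `&` [set w | l w < s]) =
    (P' [set w | (X' w < r)%R] * P' [set w | (l w < s)%R])%E) ->
  (forall r, P [set w | X w < r] = 0%E -> P' [set w | X' w + l w < r] = 0%E) ->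
  P'.-negligible [set w | l w < 0].
Proof.
move=> mX mX' ml X0 eqX indep dom.
have mlt (dT : measure_display) (S : measurableType dT) (f : S -> R) r :
    measurable_fun setT f -> measurable [set w | f w < r].
  by move=> mf; apply: measurable_ltr_set => //; exact: measurable_cst.
rewrite (_ : [set w | l w < 0] = \bigcup_k [set w | l w < - k.+1%:R^-1]); last first.
  apply/seteqP; split=> w /=.
    move=> lw; have := ltW (lw); rewrite -oppr_ge0 => h.
    exists (Num.bound (- l w)^-1) => //=; rewrite ltrNr invf_plt ?posrE ?oppr_gt0 ?ltr0n //.
    apply: (@lt_le_trans _ _ (Num.bound (- l w)^-1)%:R).
      by apply: archi_boundP; rewrite invr_ge0.
    by rewrite ler_nat.
  by move=> [k _ /=] /lt_le_trans -> //; rewrite oppr_le0 invr_ge0.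
apply: negligible_bigcup => k; apply/negligibleP; first exact: mlt.
set e : R := k.+1%:R^-1; have e0 : 0 < e by rewrite invr_gt0 ltr0n.
have [j Pj] : exists j : nat, P [set w | X w < j%:R * e] != 0%E.
  apply/not_existsP => h.
  have h0 : P.-negligible (\bigcup_(j : nat) [set w | X w < j%:R * e]).
    apply: negligible_bigcup => j; apply/negligibleP; first exact: mlt.
    by apply/eqP/negPn/negP; exact: h.
  have hT : \bigcup_(j : nat) [set w | X w < j%:R * e] = setT.
    apply/seteqP; split=> // w _; have Xe : 0 <= X w / e by rewrite divr_ge0 // ltW.
    by exists (Num.bound (X w / e)) => //=; rewrite -ltr_pdivrMr //; exact: archi_boundP.
  move: h0; rewrite hT => /negligibleP => /(_ measurableT).
  by rewrite /= (probability_setT P) => /eqP; rewrite onee_eq0.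
have ex : exists j : nat, P [set w | X w < j%:R * e] != 0%E by exists j.
case: (ex_minnP ex) => -[|i] Pi mini.
  move: Pi; rewrite mul0r (_ : [set w | _] = set0) ?measure0 ?eqxx //.
  by apply/seteqP; split=> // w /=; rewrite ltNge X0.
have Pi0 : P [set w | X w < i%:R * e] = 0%E.
  by apply/eqP/negPn/negP => /mini; rewrite ltnn.
have le0 : (P' ([set w | (X' w < i.+1%:R * e)%R] `&` [set w | (l w < - e)%R]) <= 0)%E.
  rewrite -(dom _ Pi0); apply: le_measure; rewrite ?inE.
  - by apply: measurableI; exact: mlt.
  - by apply: mlt; exact: measurable_funD.
  - by move=> w /= [h1 h2]; rewrite (_ : i%:R * e = i.+1%:R * e - e); [exact: ltrD|rewrite -natr1; ring].
move: le0; rewrite indep -eqX => le0.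
have : (P [set w | (X w < i.+1%:R * e)%R] * P' [set w | (l w < - e)%R])%E == 0%E.
  by rewrite eq_le le0 mule_ge0 ?measure_ge0.
by rewrite mule_eq0 (negbTE Pi) => /eqP.
Qed.

Section SizeBiasSummand.
Context (R : realType) (d : measure_display) (T : measurableType d).
Context (P : probability T R) (E : Type) (psi : E -> {RV P >-> R}).
Context (psi_ge0 : forall x w, 0 <= psi x w) (Lpsi : forall x, L1 P (psi x)).
Context (a : E) (c_gt0 : 0 < \int[P]_w psi a w).
Context (d' : measure_display) (T' : measurableType d') (P' : probability T' R).
Context (psi' l : E -> {RV P' >-> R}).
Context (eq_psi : eq_law P psi P' psi').
Context (indep : independent_processes P' psi' l).
Context (biased : eq_law (size_biased P (psi a)) psi P' (fun x w => psi' x w + l x w)).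

Let c := \int[P]_w psi a w.

Let mpsi x : measurable_fun setT (psi x). Proof. exact: measurable_funPT. Qed.
Let mpsi' x : measurable_fun setT (psi' x). Proof. exact: measurable_funPT. Qed.
Let ml x : measurable_fun setT (l x). Proof. exact: measurable_funPT. Qed.

Let msum x : measurable_fun setT (fun w => psi' x w + l x w).
Proof. exact: measurable_funD. Qed.

Let Lc : L1 P (fun w => psi a w / c).
Proof. by under eq_fun do rewrite mulrC; exact: L1Z. Qed.

Let psic_ge0 w : 0 <= psi a w / c.
Proof. by rewrite divr_ge0 // ltW. Qed.

Let biasedE n (x : n.-tuple E) A : measurable A ->
  P' (marginal (fun x w => psi' x w + l x w) x @^-1` A) =
  (\int[P]_(w in marginal psi x @^-1` A) (psi a w / c)%:E)%E.
Proof.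
move=> mA; have := biased x mA; rewrite /pushforward /size_biased => <-.
by have -> : fine 'E_P[psi a] = c by rewrite expectation_def.
Qed.

(** The size-biased law has a density, so events null for [psi] are null for [psi' + l]: the
    domination asked by [dominated_summand_ge0], applied to one coordinate. *)
Lemma size_bias_summand_ge0 x : P'.-negligible [set w | l x w < 0].
Proof.
have mlt (r : R) : measurable [set y : 1.-tuple R | tnth y ord0 < r].
  by apply: measurable_ltr_set; [exact: measurable_tnth|exact: measurable_cst].
have ltE (S : Type) (X : E -> S -> R) r :
    [set w | X x w < r] = marginal X [tuple x] @^-1` [set y | tnth y ord0 < r].
  by apply/seteqP; split=> w /=; rewrite /marginal tnth_mktuple.
apply: (@dominated_summand_ge0 _ _ _ _ _ P P' (psi x) (psi' x)) => //.
- by move=> r; rewrite (ltE _ (fun x => psi x)) (ltE _ (fun x => psi' x)); exact: eq_psi.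
- move=> r s; rewrite (ltE _ (fun x => psi' x)) (ltE _ (fun x => l x)).
  by apply: indep; exact: sigma_process_marginal.
- move=> r; rewrite (ltE _ (fun x => psi x)) => P0.
  rewrite (ltE _ (fun x w => psi' x w + l x w)) biasedE //.
  apply: null_set_integral => //.
  + by rewrite -(ltE _ (fun x => psi x)); apply: measurable_ltr_set => //; exact: measurable_cst.
  + by apply: (measurable_funS measurableT) => //; exact: (measurable_int P Lc).
Qed.

(** The equality in law becomes an integral identity with [psi] back on its own space; the iterated
    integral encodes independence. [U] takes positive parts because [l] is nonnegative only almost
    surely. *)
Lemma size_bias_summand n (x : n.-tuple E) :
  exists U : T' -> n.-tuple R, [/\ measurable_fun setT U,
    forall u i, 0 <= tnth (U u) i
  & forall g, bmf g -> \int[P]_w (psi a w * g (marginal psi x w)) =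
      c * \int[P]_w \int[P']_u g (addt (marginal psi x w) (U u))].
Proof.
pose V := marginal (fun x w => psi' x w + l x w) x.
pose U u := post (marginal l x u).
have mW : measurable_fun setT (marginal psi x) by exact: measurable_marginal.
have mW' : measurable_fun setT (marginal psi' x) by exact: measurable_marginal.
have mL : measurable_fun setT (marginal l x) by exact: measurable_marginal.
have mV : measurable_fun setT V by exact: measurable_marginal.
have mU : measurable_fun setT U by exact: (measurableT_comp (@measurable_post R n)).
exists U; split=> // [u i|g bg]; first by rewrite tnth_mktuple le_max lexx.
have L1c : L1 P' (fun=> 1) by apply: L1_bmf; exact: bmf_cst.
have Lpsig : L1 P (fun w => psi a w / c * g (marginal psi x w)).
  by apply: L1M => //; exact: bmf_comp.
have -> : \int[P]_w (psi a w * g (marginal psi x w)) =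
    c * \int[P]_w (psi a w / c * g (marginal psi x w)).
  rewrite -RintZ //; apply: eq_Rintegral => w _.
  by rewrite mulrA mulrCA mulfV ?mulr1 // gt_eqF.
congr (_ * _).
have -> : \int[P]_w (psi a w / c * g (marginal psi x w)) = \int[P']_u (1 * g (V u)).
  apply: (weighted_law_integral psic_ge0 (fun=> ler01) Lc L1c mW mV) => // A mA.
  apply: EFin_inj; rewrite -!weighted_indicE //.
  rewrite integral_cst ?mul1e -?biasedE //.
  by rewrite -[X in measurable X]setTI; exact: mV.
have -> : \int[P']_u (1 * g (V u)) = \int[P']_u g (addt (marginal psi' x u) (U u)).
  have mG : measurable_fun setT (fun u => g (addt (marginal psi' x u) (U u))).
    by have [mg _] := bg; apply: (measurableT_comp mg); exact: measurable_addt.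
  have mgV : measurable_fun setT (fun u => g (V u)).
    by have [mg _] := bg; exact: (measurableT_comp mg).
  under eq_Rintegral do rewrite mul1r.
  rewrite /Rintegral; congr fine; apply: ae_eq_integral => //; try exact/measurable_EFinP.
  have : \forall u \ae P', forall i : 'I_n, 0 <= l (tnth x i) u.
    apply: filter_forall => i; apply: negligibleS (size_bias_summand_ge0 (tnth x i)) => u /=.
    by move=> /negP; rewrite -ltNge.
  apply: (@filterS _ _ (ae_filter_ringOfSetsType P')) => u h _.
  congr (g _)%:E; apply: eq_from_tnth => i.
  by rewrite !tnth_mktuple max_r.
(* The pair is stored as a tuple of length 2, so that independence is compared with the product
   measure on rectangles. *)
pose F (v : 2.-tuple (n.-tuple R)) := g (addt (tnth v ord0) (post (tnth v ord_max))).
have bF : bmf F.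
  apply: bmf_comp bg; apply: measurable_addt; first exact: measurable_tnth.
  exact: (measurableT_comp (@measurable_post R n) (@measurable_tnth _ _ _ _)).
pose X1 u := [tuple if k == ord0 then marginal psi' x u else marginal l x u | k < 2].
pose X2 z := [tuple if k == ord0 then marginal psi x z.1 else marginal l x z.2 | k < 2].
have mX1 : measurable_fun setT X1.
  apply/measurable_fun_tnthP => k.
  rewrite (_ : _ \o _ = if k == ord0 then marginal psi' x else marginal l x).
    by case: ifP.
  by apply/funext => w; rewrite /= tnth_mktuple; case: ifP.
have mX2 : measurable_fun setT X2.
  apply/measurable_fun_tnthP => k.
  rewrite (_ : _ \o _ = if k == ord0 then marginal psi x \o fst else marginal l x \o snd).
    case: ifP => _; first exact: (measurableT_comp mW measurable_fst).
    exact: (measurableT_comp mL measurable_snd).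
  by apply/funext => w; rewrite /= tnth_mktuple; case: ifP.
have sl : same_law P' X1 (P \x P')%E X2.
  apply: rectangles_same_law => // A mA.
  have all2 (Q : 'I_2 -> Prop) : (forall k, Q k) <-> Q ord0 /\ Q ord_max.
    split=> [h|[h0 h1] k]; first by split.
    have [->//|k0] := eqVneq k ord0; suff -> : k = ord_max by [].
    by apply/val_inj; case: k k0 => -[|[|k]].
  have -> : [set w | forall k, A k (tnth (X1 w) k)] =
      marginal psi' x @^-1` A ord0 `&` marginal l x @^-1` A ord_max.
    by apply/seteqP; split=> w /= => [/all2|h]; [|apply/all2]; rewrite !tnth_mktuple.
  have -> : [set w | forall k, A k (tnth (X2 w) k)] =
      (marginal psi x @^-1` A ord0) `*` (marginal l x @^-1` A ord_max).
    by apply/seteqP; split=> w /= => [/all2|h]; [|apply/all2]; rewrite !tnth_mktuple.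
  rewrite indep; [|exact: sigma_process_marginal|exact: sigma_process_marginal].
  rewrite /= product_measure1E.
  - by congr (_ * _)%E; symmetry; exact: eq_psi.
  - by rewrite -[X in measurable X]setTI; exact: mW.
  - by rewrite -[X in measurable X]setTI; exact: mL.
have -> : \int[P']_u g (addt (marginal psi' x u) (U u)) = \int[P']_u F (X1 u).
  by apply: eq_Rintegral => u _; rewrite /F !tnth_mktuple.
rewrite (same_law_integral mX1 mX2 sl) ; last first.
- by apply: L1_bmf; exact: bmf_comp bF.
- by have [] := bF.
have [e _] := Rfubini_addt P' (L1_bmf P (@bmf_cst _ _ R 1)) mW mU bg.
rewrite -[RHS](eq_Rintegral _ (fun w _ => mul1r _)) -e.
by apply: eq_Rintegral => z _; rewrite mul1r /F !tnth_mktuple.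
Qed.

End SizeBiasSummand.

(** * Poissonization of the law *)

(** The alternative depends on [j] and [k] alone, uniformly in [q]: measurability and integrals can
    be treated coefficientwise while [q] varies with the sample point. *)
Lemma mcoeff_mulX (R : realType) n (j : 'I_n) (k : multinom n) :
  (exists2 k' : multinom n, mdeg k = (mdeg k').+1 &
     forall q : mpoly n R, mcoeff k (mpolyX R (mnm1 j) * q) = mcoeff k' q) \/
  (forall q : mpoly n R, mcoeff k (mpolyX R (mnm1 j) * q) = 0).
Proof.
have [[k' ->]|nk] := pselect (exists k', k = mnm_add (mnm1 j) k').
  left; exists k'; first by rewrite mdegD mdeg1.
  by move=> q; rewrite mulrC mcoeffMX.
right=> q; rewrite mcoeffM big1 // => -[[k1 h1] [k2 h2]] /= /eqP e.
rewrite mcoeffX; case: eqP => [e1|]; last by rewrite mul0r.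
by case: nk; exists k2; rewrite e e1.
Qed.

Lemma lin_mp_exp_homog (R : realType) n (y : n.-tuple R) e (k : multinom n) :
  mdeg k != e -> mcoeff k (lin_mp y ^+ e) = 0.
Proof.
elim: e k => [|e IH] k ke.
  by rewrite expr0 -mpolyX0 mcoeffX; case: eqP => // e0; move: ke; rewrite -e0 mdeg0.
rewrite exprS mulr_suml raddf_sum big1 //= => j _.
rewrite -scalerAl mcoeffZ; have [[k' dk ->]|->] := mcoeff_mulX R j k; last by rewrite mulr0.
by rewrite IH ?mulr0 //; apply: contra ke => /eqP <-; rewrite dk.
Qed.

Lemma post_id (R : realType) n (y : n.-tuple R) : (forall i, 0 <= tnth y i) -> post y = y.
Proof. by move=> y0; apply: eq_from_tnth => i; rewrite tnth_mktuple max_r. Qed.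

Section PoissonLaw.
Context (R : realType) (n : nat) (t : R) (t0 : 0 <= t).

Lemma measurable_mcoeff_lin_exp e k :
  measurable_fun setT (fun y : n.-tuple R => mcoeff k (lin_mp y ^+ e)).
Proof.
elim: e k => [|e IH] k.
  by under eq_fun do rewrite expr0; exact: measurable_cst.
rewrite (_ : (fun y => _) = fun y : n.-tuple R =>
    \sum_(j < n) tnth y j * mcoeff k (mpolyX R (mnm1 j) * lin_mp y ^+ e)); last first.
  apply/funext => y; rewrite exprS mulr_suml raddf_sum; apply: eq_bigr => j _ /=.
  by rewrite -scalerAl mcoeffZ.
apply: measurable_sum => j; have [[k' _ kk]|kk] := mcoeff_mulX R j k.
  by under eq_fun do rewrite kk; apply: measurable_funM => //; exact: measurable_tnth.
by under eq_fun do rewrite kk mulr0; exact: measurable_cst.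
Qed.

Lemma measurable_tsum : measurable_fun setT (@tsum R n).
Proof. by apply: measurable_sum => i; exact: measurable_tnth. Qed.

Lemma measurable_pois d : measurable_fun setT (fun y : n.-tuple R => pois (t * tsum y) d).
Proof.
have mt : measurable_fun setT (fun y : n.-tuple R => t * tsum y).
  by apply: measurable_funM => //; exact: measurable_tsum.
rewrite /pois; apply: measurable_funM; last exact: measurable_cst.
apply: measurable_funM; last exact: measurable_funX.
by apply: measurableT_comp => //; exact: measurable_funN.
Qed.

Lemma pois_le1 (x : R) d : 0 <= x -> pois x d <= 1.
Proof.
move=> x0; apply: le_trans (pois_sum_le1 d.+1 x0); rewrite big_ord_recr /= lerDr.
by apply: sumr_ge0 => i _; exact: pois_ge0.
Qed.

Lemma tsum_post_ge0 (y : n.-tuple R) : 0 <= t * tsum (post y).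
Proof. by rewrite mulr_ge0 // sumr_ge0 // => i _; rewrite tnth_mktuple le_max lexx. Qed.

Lemma bmf_pois d : bmf (fun y : n.-tuple R => pois (t * tsum (post y)) d).
Proof.
split; first exact: (measurableT_comp (measurable_pois d) (@measurable_post R n)).
by exists 1 => y; rewrite ger0_norm ?pois_ge0 ?pois_le1 ?tsum_post_ge0.
Qed.

(** The bound by one comes from nonnegative arguments; [post] makes it hold on the whole space, as
    for the test functions of the size-bias identity. *)
Lemma bmf_poisson_coef d k :
  bmf (fun y : n.-tuple R => mcoeff k (poisson_mp t (post y) d)).
Proof.
split.
  apply: (measurableT_comp (f := fun y => mcoeff k (poisson_mp t y d)) _ (@measurable_post R n)).
  rewrite /poisson_mp; under eq_fun do rewrite mcoeffZ.
  apply: measurable_funM; last exact: measurable_mcoeff_lin_exp.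
  apply: measurable_funM; last exact: measurable_cst.
  apply: measurable_funM; last exact: measurable_cst.
  apply: measurableT_comp => //; apply: measurable_funN; apply: measurable_funM.
    exact: measurable_cst.
  exact: measurable_tsum.
exists 1 => y; have y0 i : 0 <= tnth (post y) i by rewrite tnth_mktuple le_max lexx.
have h := poisson_mp_nonneg d t0 y0; rewrite ger0_norm //.
by rewrite (le_trans (mcoeff_le_eval1 _ h)) // mp_eval1_poisson pois_le1 ?tsum_post_ge0.
Qed.

Context (d : measure_display) (T : measurableType d) (P : probability T R).
Context (W : T -> n.-tuple R) (mW : measurable_fun setT W).
Context (W_ge0 : forall w i, 0 <= tnth (W w) i).

(** The coefficients of [poisson_mp] averaged over [W]. Homogeneity of degree [e] makes the finite
    range of multi-indices sufficient. *)
Definition poisson_law e : mpoly n R := \sum_(k : bmultinom n e.+1)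
  (\int[P]_w mcoeff k (poisson_mp t (W w) e)) *: mpolyX R k.

Lemma bmf_poisson_W e k : bmf (fun w => mcoeff k (poisson_mp t (W w) e)).
Proof.
rewrite (_ : (fun w => _) = fun w => mcoeff k (poisson_mp t (post (W w)) e)).
  exact: (bmf_comp mW (bmf_poisson_coef e k)).
by apply/funext => w; rewrite post_id.
Qed.

Lemma bmf_pois_W e : bmf (fun w => pois (t * tsum (W w)) e).
Proof.
rewrite (_ : (fun w => _) = fun w => pois (t * tsum (post (W w))) e).
  exact: (bmf_comp mW (bmf_pois e)).
by apply/funext => w; rewrite post_id.
Qed.

Lemma mcoeff_poisson_law e k :
  mcoeff k (poisson_law e) = \int[P]_w mcoeff k (poisson_mp t (W w) e).
Proof.
rewrite raddf_sum /=; have [ke|ke] := ltnP (mdeg k) e.+1.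
  rewrite (bigD1 (BMultinom ke)) //= mcoeffZ mcoeffX eqxx mulr1 big1 ?addr0 // => k' k'k.
  rewrite mcoeffZ mcoeffX; case: eqP => [e'|]; last by rewrite mulr0.
  by case/eqP: k'k; apply/val_inj.
rewrite big1 => [|k' _]; last first.
  rewrite mcoeffZ mcoeffX; case: eqP => [e'|]; last by rewrite mulr0.
  by move: (bmdeg k'); rewrite e' ltnNge ke.
under eq_Rintegral do rewrite mcoeffZ lin_mp_exp_homog ?mulr0 ?gtn_eqF //.
by rewrite Rexp_cst.
Qed.

Lemma poisson_law_nonneg e : mp_nonneg (poisson_law e).
Proof.
by move=> k; rewrite mcoeff_poisson_law; apply: Rint_ge0 => w; exact: poisson_mp_nonneg.
Qed.

Lemma poisson_mp_eval (h : multinom n -> R) y e :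
  mp_eval h (poisson_mp t y e) = \sum_(k : bmultinom n e.+1) mcoeff k (poisson_mp t y e) * h k.
Proof.
apply: (@mp_evalwE R n e.+1); rewrite msizeE big_seq; apply/bigmax_leqP_seq => k _ kp.
rewrite ltnS leqNgt; apply: contraTN kp => ke.
by rewrite -mcoeff_eq0 mcoeffZ lin_mp_exp_homog ?mulr0 // gtn_eqF.
Qed.

Lemma bmf_poisson_eval h e : bmf (fun w => mp_eval h (poisson_mp t (W w) e)).
Proof.
under eq_fun do rewrite poisson_mp_eval.
apply: bmf_sum => k; apply: bmfM; [exact: bmf_poisson_W|exact: bmf_cst].
Qed.

Lemma poisson_law_eval h e :
  mp_eval h (poisson_law e) = \int[P]_w mp_eval h (poisson_mp t (W w) e).
Proof.
under eq_Rintegral do rewrite poisson_mp_eval.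
rewrite Rexp_sum => [|k]; last by apply: bmfM; [exact: bmf_poisson_W|exact: bmf_cst].
rewrite mp_eval_sum; apply: eq_bigr => k _; rewrite mp_evalZ mp_evalX mulrC.
by rewrite -RexpZ; [apply: eq_Rintegral => w _; rewrite mulrC|exact: bmf_poisson_W].
Qed.

Lemma poisson_law_mass e :
  mp_eval (fun=> 1) (poisson_law e) = \int[P]_w pois (t * tsum (W w)) e.
Proof. by rewrite poisson_law_eval; under eq_Rintegral do rewrite mp_eval1_poisson. Qed.

Lemma bmf_pois_sum B : bmf (fun w => \sum_(e < B) pois (t * tsum (W w)) e).
Proof. by apply: bmf_sum => e; exact: bmf_pois_W. Qed.

Let tW0 w : 0 <= t * tsum (W w).
Proof. by rewrite mulr_ge0 // sumr_ge0. Qed.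

Lemma poisson_law_sum_mass B : \sum_(e < B) mp_eval (fun=> 1) (poisson_law e) =
  \int[P]_w \sum_(e < B) pois (t * tsum (W w)) e.
Proof.
rewrite Rexp_sum => [|e]; last exact: bmf_pois_W.
by apply: eq_bigr => e _; rewrite poisson_law_mass.
Qed.

Lemma poisson_law_sum_mass_le1 B : \sum_(e < B) mp_eval (fun=> 1) (poisson_law e) <= 1.
Proof.
rewrite poisson_law_sum_mass -[leRHS](Rexp_cst P).
apply: le_Rexp; [exact: bmf_pois_sum|exact: bmf_cst|move=> w; exact: pois_sum_le1].
Qed.

Lemma poisson_law_sum_mass_cvg :
  (fun B => \sum_(e < B) mp_eval (fun=> 1) (poisson_law e)) @ \oo --> (1 : R).
Proof.
under eq_fun do rewrite poisson_law_sum_mass.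
rewrite -(Rexp_cst P 1).
apply: (Rexp_dominated_cvg _ _ (L1_bmf P (bmf_cst _ 1))) => [B||B w|].
- by have [] := bmf_pois_sum B.
- exact: measurable_cst.
- by rewrite ger0_norm ?pois_sum_le1 // sumr_ge0 // => e _; exact: pois_ge0.
- by apply: aeW => w; exact: pois_cvg.
Qed.

(** [a] is the mean of [exp (- t * tsum W)], positive because the integrand is; its m-th root is the
    constant term of the root of the series. *)
Lemma poisson_law0 : exists2 a : R, 0 < a & poisson_law 0 = a *: 1.
Proof.
pose f w := expR (- (t * tsum (W w))).
have bf : bmf f.
  have := bmf_pois_W 0; congr bmf; apply/funext => w.
  by rewrite /pois expr0 fact0 mulr1 divr1.
exists (\int[P]_w f w).
  rewrite lt_neqAle eq_sym Rint_ge0 ?andbT; last by move=> w; exact: expR_ge0.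
  apply/eqP => f0.
  have fE : (\int[P]_w `|(f w)%:E|)%E = 0%E.
    under eq_integral do rewrite gee0_abs ?lee_fin ?expR_ge0 //.
    rewrite -(fineK (x := integral _ _ _)); first by rewrite -/(Rintegral P setT f) f0.
    by apply: (integrable_fin_num measurableT); exact: (L1_bmf P bf).
  have mf : measurable_fun setT (EFin \o f) by apply/measurable_EFinP; have [] := bf.
  have := (ae_eq_integral_abs P measurableT mf).1 fE.
  have -> : ae_eq P setT (EFin \o f) (cst 0%E) = P.-negligible setT.
    rewrite /ae_eq /almost_everywhere /=; congr (P.-negligible _).
    apply/seteqP; split=> // w _ /(_ Logic.I) /= [] e.
    by have := expR_gt0 (- (t * tsum (W w))); rewrite -/(f w) e ltxx.
  move=> /negligibleP => /(_ measurableT); rewrite /= (probability_setT P) => /eqP.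
  by rewrite onee_eq0.
apply/mpolyP => k; rewrite mcoeff_poisson_law mcoeffZ mulrC -RexpZ //.
apply: eq_Rintegral => w _; rewrite poisson_mp0 mcoeffZ mulrC //.
Qed.

End PoissonLaw.

(** * The recursion given by size biasing *)

Section BiasSeries.
Context (R : realType) (n : nat) (t : R) (t0 : 0 <= t).
Context (d : measure_display) (T : measurableType d) (P : probability T R).
Context (W : T -> n.-tuple R) (mW : measurable_fun setT W).
Context (W_ge0 : forall w i, 0 <= tnth (W w) i).
Context (LW : forall i, L1 P (fun w => tnth (W w) i)).

Definition size_bias_summand_of (i : 'I_n) := exists (d' : measure_display)
  (T' : measurableType d') (P' : probability T' R) (U : T' -> n.-tuple R),
  [/\ measurable_fun setT U, forall u j, 0 <= tnth (U u) j
  & forall g, bmf g -> \int[P]_w (tnth (W w) i * g (W w)) =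
      (\int[P]_w tnth (W w) i) * \int[P]_w \int[P']_u g (addt (W w) (U u))].

Local Notation p := (poisson_law t P W).

(** Size biasing moves the Poisson coefficient to [W + U], superposition splits it into products,
    and the two integrals separate. So [rho] is the mean times the Poissonized law of [U]. *)
Lemma bias_series i : 0 < \int[P]_w tnth (W w) i -> size_bias_summand_of i ->
  exists2 rho : nat -> mpoly n R, (forall b, mp_nonneg (rho b)) &
    forall e k, \int[P]_w (tnth (W w) i * mcoeff k (poisson_mp t (W w) e)) =
      mcoeff k (\sum_(b < e.+1) rho b * p (e - b)%N).
Proof.
move=> c0 [d' [T' [P' [U [mU U0 HU]]]]].
set c := \int[P]_w tnth (W w) i in c0 HU.
exists (fun b => c *: poisson_law t P' U b).
  by move=> b; apply: mp_nonnegZ; [exact: ltW|exact: poisson_law_nonneg].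
move=> e k.
have eqW w : mcoeff k (poisson_mp t (W w) e) = mcoeff k (poisson_mp t (post (W w)) e).
  by rewrite post_id.
under eq_Rintegral do rewrite eqW.
rewrite (HU _ (bmf_poisson_coef t0 e k)).
have -> : \sum_(b < e.+1) c *: poisson_law t P' U b * p (e - b)%N =
    c *: \sum_(b < e.+1) poisson_law t P' U b * p (e - b)%N.
  by rewrite scaler_sumr; apply: eq_bigr => b _; rewrite scalerAl.
rewrite mcoeffZ; congr (_ * _).
have addE w u : mcoeff k (poisson_mp t (post (addt (W w) (U u))) e) =
    \sum_(b < e.+1) mcoeff k (poisson_mp t (U u) b * poisson_mp t (W w) (e - b)%N).
  rewrite post_id; first by rewrite poisson_mp_addt raddf_sum.
  by move=> j; rewrite tnth_mktuple addr_ge0.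
under eq_Rintegral => w _ do under eq_Rintegral do rewrite addE.
pose F b (pr : multinom n * multinom n) (w : T) (u : T') : R :=
  mcoeff pr.1 (poisson_mp t (U u) b) * mcoeff pr.2 (poisson_mp t (W w) (e - b)%N).
have bFu b pr w : bmf (F b pr w).
  by apply: bmfM; [exact: bmf_poisson_W|exact: bmf_cst].
have FE b pr w : \int[P']_u F b pr w u =
    mcoeff pr.1 (poisson_law t P' U b) * mcoeff pr.2 (poisson_mp t (W w) (e - b)%N).
  rewrite mcoeff_poisson_law // mulrC -RexpZ; last exact: bmf_poisson_W.
  by apply: eq_Rintegral => u _; rewrite mulrC.
have bFw b pr : bmf (fun w => \int[P']_u F b pr w u).
  under eq_fun do rewrite FE; apply: bmfM; [exact: bmf_cst|exact: bmf_poisson_W].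
have sumE b w : \int[P']_u mcoeff k (poisson_mp t (U u) b * poisson_mp t (W w) (e - b)%N) =
    mcoeff k (poisson_law t P' U b * poisson_mp t (W w) (e - b)%N).
  under eq_Rintegral do rewrite mcoeffM -big_filter.
  rewrite (Rexp_sum P' _ (fun q => bFu b (bmnm q.1, bmnm q.2) w)) mcoeffM -[RHS]big_filter.
  by apply: eq_bigr => q _; rewrite (FE b (bmnm q.1, bmnm q.2)).
have -> : \int[P]_w \int[P']_u
    (\sum_(b < e.+1) mcoeff k (poisson_mp t (U u) b * poisson_mp t (W w) (e - b)%N)) =
    \int[P]_w \sum_(b < e.+1) mcoeff k (poisson_law t P' U b * poisson_mp t (W w) (e - b)%N).
  apply: eq_Rintegral => w _; rewrite Rexp_sum.
    by apply: eq_bigr => b _; exact: sumE.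
  move=> b; under eq_fun do rewrite mcoeffM -big_filter.
  by apply: bmf_sum => q; exact: (bFu b (bmnm q.1, bmnm q.2) w).
have bG b q : bmf (fun w => mcoeff q.1 (poisson_law t P' U b) *
    mcoeff q.2 (poisson_mp t (W w) (e - b)%N)).
  by apply: bmfM; [exact: bmf_cst|exact: bmf_poisson_W].
rewrite Rexp_sum => [|b]; last first.
  under eq_fun do rewrite mcoeffM -big_filter.
  by apply: bmf_sum => q; exact: (bG b (bmnm q.1, bmnm q.2)).
rewrite [RHS]raddf_sum; apply: eq_bigr => b _ /=.
under eq_Rintegral do rewrite mcoeffM -big_filter.
rewrite (Rexp_sum P _ (fun q => bG b (bmnm q.1, bmnm q.2))) mcoeffM -[RHS]big_filter.
apply: eq_bigr => q _; rewrite RexpZ; last exact: bmf_poisson_W.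
by rewrite -mcoeff_poisson_law.
Qed.

Context (bias : forall i, 0 < \int[P]_w tnth (W w) i -> size_bias_summand_of i).

(** A nonnegative coordinate of mean zero makes these integrals vanish, so [rho = 0] serves where no
    decomposition is given. *)
Lemma bias_series_total i : exists2 rho : nat -> mpoly n R, (forall b, mp_nonneg (rho b)) &
    forall e k, \int[P]_w (tnth (W w) i * mcoeff k (poisson_mp t (W w) e)) =
      mcoeff k (\sum_(b < e.+1) rho b * p (e - b)%N).
Proof.
have [c0|c0] := ltP 0 (\int[P]_w tnth (W w) i); first exact: bias_series (bias c0).
exists (fun=> 0) => [b k|e k]; first by rewrite mcoeff0.
under eq_bigr do rewrite mul0r; rewrite big1 // mcoeff0.
have [mg [M gM]] := bmf_poisson_W t0 mW W_ge0 e k.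
apply/eqP; rewrite -normr_eq0 eq_le normr_ge0 andbT.
have M0 : 0 <= M by apply: le_trans (gM point).
apply: (le_trans (y := \int[P]_w (M * tnth (W w) i))).
  apply: Rint_norm_le.
  - by apply: L1M => //; exact: bmf_poisson_W.
  - exact: L1Z.
  - by move=> w; rewrite normrM (ger0_norm (W_ge0 w i)) mulrC ler_wpM2r.
by rewrite RintZ // mulr_ge0_le0.
Qed.

(** Averaging [poisson_mpS] over [W] gives the integrals of [bias_series] multiplied by [t] and the
    variable of index [i]; collecting them over [i] defines [r]. *)
Lemma poisson_law_rec : exists2 r : nat -> mpoly n R, (forall j, mp_nonneg (r j)) &
  forall e, e.+1%:R *: p e.+1 = \sum_(j < e.+1) r j * p (e - j)%N.
Proof.
have /choice[rho rhoP] : forall i, exists rho : nat -> mpoly n R, (forall b, mp_nonneg (rho b)) /\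
    forall e k, \int[P]_w (tnth (W w) i * mcoeff k (poisson_mp t (W w) e)) =
      mcoeff k (\sum_(b < e.+1) rho b * p (e - b)%N).
  by move=> i; have [rho h1 h2] := bias_series_total i; exists rho.
pose r j := t *: \sum_(i < n) mpolyX R (mnm1 i) * rho i j.
exists r => [j|e].
  apply: mp_nonnegZ => //; apply: mp_nonneg_sum => i _; apply: mp_nonnegM.
    exact: mp_nonnegX.
  by have [h _] := rhoP i; exact: h.
apply/mpolyP => k.
have -> : \sum_(j < e.+1) r j * p (e - j)%N =
    t *: \sum_(i < n) mpolyX R (mnm1 i) * \sum_(j < e.+1) rho i j * p (e - j)%N.
  under eq_bigr do rewrite -scalerAl mulr_suml.
  rewrite -scaler_sumr exchange_big; congr (_ *: _); apply: eq_bigr => i _.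
  by rewrite mulr_sumr; apply: eq_bigr => j _; rewrite mulrA.
rewrite !mcoeffZ mcoeff_poisson_law //.
rewrite -RexpZ; last exact: bmf_poisson_W.
have E w : e.+1%:R * mcoeff k (poisson_mp t (W w) e.+1) =
    t * \sum_(i < n) tnth (W w) i * mcoeff k (mpolyX R (mnm1 i) * poisson_mp t (W w) e).
  rewrite -mcoeffZ poisson_mpS mcoeffZ; congr (_ * _).
  rewrite mulr_suml raddf_sum; apply: eq_bigr => i _ /=.
  by rewrite -scalerAl mcoeffZ.
under eq_Rintegral do rewrite E.
have LWX i : L1 P (fun w => tnth (W w) i * mcoeff k (mpolyX R (mnm1 i) * poisson_mp t (W w) e)).
  apply: L1M => //; have [[k' _ kk]|kk] := mcoeff_mulX R i k.
    by under eq_fun do rewrite kk; exact: bmf_poisson_W.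
  by under eq_fun do rewrite kk; exact: bmf_cst.
rewrite RintZ; last exact: L1_sum.
congr (_ * _); rewrite Rint_sum // raddf_sum; apply: eq_bigr => i _ /=.
have [[k' _ kk]|kk] := mcoeff_mulX R i k.
  by under eq_Rintegral do rewrite kk; rewrite kk; have [_ ->] := rhoP i.
by under eq_Rintegral do rewrite kk mulr0; rewrite kk Rexp_cst.
Qed.

Lemma poisson_law_root m : (0 < m)%N -> exists2 q : nat -> mpoly n R,
  (forall e, mp_nonneg (q e)) &
  forall D e, (e <= D)%N -> ((\poly_(i < D.+1) q i) ^+ m)`_e = p e.
Proof.
move=> m0; have [r r0 rE] := poisson_law_rec.
have [a a0 pa] := poisson_law0 t0 P mW W_ge0.
pose b := a `^ m%:R^-1.
have bm : b ^+ m = a.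
  by rewrite -powR_mulrn ?powR_ge0 // -powRrM mulVf ?powRr1 ?ltW // pnatr_eq0 -lt0n.
pose q := root_coef m r (b *: (1 : mpoly n R)).
exists q.
- elim/ltn_ind => -[|e] IH.
    by apply: mp_nonnegZ; [exact: powR_ge0|exact: mp_nonneg1].
  rewrite /q root_coefS; apply: mp_nonnegZ; first by rewrite invr_ge0.
  apply: mp_nonneg_sum => j _; apply: mp_nonnegM => //; apply: IH.
  by rewrite ltnS leq_subr.
- move=> D e eD; apply: (series_root rE (fun e => root_coef_rec _ _ _ m0)) => //.
  by rewrite pa /q /root_coef /= exprZn expr1n bm.
Qed.

End BiasSeries.

(** * Rate of approximation by powers of polynomials *)

Section RootApproximation.
Context (R : realType) (n : nat).
Context (d : measure_display) (T : measurableType d) (P : probability T R).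
Context (W : T -> n.-tuple R) (mW : measurable_fun setT W).
Context (W_ge0 : forall w i, 0 <= tnth (W w) i).
Context (LW : forall i, L1 P (fun w => tnth (W w) i)).
Context (bias : forall i, 0 < \int[P]_w tnth (W w) i -> size_bias_summand_of P W i).

Definition lattice_point N (k : multinom n) : n.-tuple R :=
  [tuple (k i)%:R / N%:R ^+ 2 | i < n].

Let p (N : nat) := poisson_law (N%:R ^+ 2) P W.
(** The 2 pays twice for a missing mass of at most [1 / N], in the truncated root and in the
    truncated Poisson law; the sum is the Poisson fluctuation. *)
Let C := 2 + \sum_(i < n) (\int[P]_w tnth (W w) i + 1) / 2.

(** The error has two sources: the mass lost by stopping at degree [D], and the fluctuation of
    [poisson_lipschitz] averaged over [W]. *)
Lemma poisson_law_approx (N D : nat) (h : n.-tuple R -> R) (M : R) : (0 < N)%N ->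
  measurable_fun setT h -> 0 <= M -> (forall y, `|h y| <= M) ->
  (forall y z, `|h y - h z| <= M * \sum_(i < n) `|tnth y i - tnth z i|) ->
  `|\sum_(e < D) mp_eval (h \o lattice_point N) (p N e) - \int[P]_w h (W w)| <=
  M * (1 - \sum_(e < D) mp_eval (fun=> 1) (p N e)) +
  M * (\sum_(i < n) (\int[P]_w tnth (W w) i + 1) / 2) / N%:R.
Proof.
move=> N0 mh M0 hM hL; rewrite /p; set t := N%:R ^+ 2.
have t0 : 0 <= t by rewrite exprn_ge0.
have bh : bmf (fun w => h (W w)) by apply: (bmf_comp mW); split=> //; exists M.
pose F w : R := \sum_(e < D) pois (t * tsum (W w)) e.
have bF : bmf F by exact: bmf_pois_sum.
have F1 w : F w <= 1 by apply: pois_sum_le1; rewrite mulr_ge0 // sumr_ge0.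
pose S_ w := \sum_(e < D) mp_eval (h \o lattice_point N) (poisson_mp t (W w) e).
have bS : bmf S_ by apply: bmf_sum => e; exact: bmf_poisson_eval.
have -> : \sum_(e < D) mp_eval (h \o lattice_point N) (poisson_law t P W e) = \int[P]_w S_ w.
  rewrite Rexp_sum => [|e]; last exact: bmf_poisson_eval.
  by apply: eq_bigr => e _; rewrite poisson_law_eval.
have -> : \sum_(e < D) mp_eval (fun=> 1) (poisson_law t P W e) = \int[P]_w F w by exact: poisson_law_sum_mass.
have LG : L1 P (fun w => \sum_(i < n) (tnth (W w) i + 1) / (2 * N%:R)).
  apply: L1_sum => i; under eq_fun do rewrite mulrC; apply: L1Z.
  by apply: L1D => //; apply: L1_bmf; exact: bmf_cst.
have bhF : bmf (fun w => h (W w) * F w) by exact: bmfM.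
rewrite (_ : \int[P]_w S_ w - \int[P]_w h (W w) =
  (\int[P]_w (h (W w) * F w) - \int[P]_w h (W w)) +
  (\int[P]_w S_ w - \int[P]_w (h (W w) * F w))); last by ring.
apply: (le_trans (ler_normD _ _)); apply: lerD.
- rewrite -RexpB //; have b1 : bmf (fun w => M * (1 - F w)).
    by apply: bmfZ; apply: bmfB => //; exact: bmf_cst.
  apply: (le_trans (y := \int[P]_w (M * (1 - F w)))).
    apply: Rint_norm_le; [by apply: L1_bmf; exact: bmfB|exact: L1_bmf|].
    move=> w; rewrite -[X in _ - X]mulr1 -mulrBr normrM distrC (ger0_norm (x := 1 - _)) ?subr_ge0 //.
    by rewrite ler_wpM2r // subr_ge0.
  by rewrite RexpZ ?RexpB ?Rexp_cst //; [exact: bmf_cst|apply: bmfB => //; exact: bmf_cst].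
- rewrite -RexpB //.
  apply: (le_trans (y := \int[P]_w (M * \sum_(i < n) (tnth (W w) i + 1) / (2 * N%:R)))).
    apply: Rint_norm_le; [by apply: L1_bmf; exact: bmfB|exact: L1Z|].
    by move=> w; exact: poisson_lipschitz.
  rewrite RintZ // Rint_sum; last first.
    move=> i; under eq_fun do rewrite mulrC; apply: L1Z.
    by apply: L1D => //; apply: L1_bmf; exact: bmf_cst.
  rewrite -[leRHS]mulrA ler_wpM2l // mulr_suml; apply: ler_sum => i _.
  under eq_Rintegral do rewrite mulrC.
  rewrite RintZ; last by apply: L1D => //; apply: L1_bmf; exact: bmf_cst.
  rewrite RintD //; last by apply: L1_bmf; exact: bmf_cst.
  by rewrite Rexp_cst mulrC invfM mulrA.
Qed.

Lemma root_approximation (N m : nat) : (0 < N)%N -> (0 < m)%N ->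
  exists Q : mpoly n R,
  [/\ mp_nonneg Q, 1 - N%:R^-1 <= mp_eval (fun=> 1) Q ^+ m <= 1
  & forall (h : n.-tuple R -> R) (M : R), measurable_fun setT h -> 0 <= M ->
      (forall y, `|h y| <= M) ->
      (forall y z, `|h y - h z| <= M * \sum_(i < n) `|tnth y i - tnth z i|) ->
    `|mp_eval (h \o lattice_point N) (Q ^+ m) - \int[P]_w h (W w)| <= M * C / N%:R].
Proof.
move=> N0 m0; have t0 : 0 <= N%:R ^+ 2 :> R by rewrite exprn_ge0.
have [q q0 qroot] := poisson_law_root t0 mW W_ge0 LW bias m0.
have p1 := poisson_law_sum_mass_le1 t0 P mW W_ge0.
(* [D] is chosen after [N], so that truncation misses at most [1 / N] of the mass. *)
have [D massD] : exists D : nat, 1 - N%:R^-1 <= \sum_(e < D.+1) mp_eval (fun=> 1) (p N e).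
  have := poisson_law_sum_mass_cvg t0 P mW W_ge0.
  have Ni : 0 < N%:R^-1 :> R by rewrite invr_gt0 ltr0n.
  move=> /cvgrPdist_le /(_ _ Ni)[D _ /(_ D.+1 (leqnSn _))] h; exists D.
  by have := le_trans (ler_norm _) h; rewrite /p; lra.
exists (\sum_(e < D.+1) q e); split.
- exact: approximant_nonneg q0 D.
- rewrite (approximant_mass_le1 qroot q0 p1 D) andbT.
  exact: le_trans massD (approximant_mass_ge qroot q0 D).
- move=> h M mh M0 hM hL.
  have e1 := @approximant_eval R n m (p N) q qroot q0 p1 D (h \o lattice_point N) M (fun k => hM _).
  have e2 := @poisson_law_approx N D.+1 h M N0 mh M0 hM hL.
  have tail : M * (1 - \sum_(e < D.+1) mp_eval (fun=> 1) (p N e)) <= M / N%:R.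
    by rewrite ler_wpM2l //; move: massD; lra.
  rewrite -(subrKA (\sum_(e < D.+1) mp_eval (h \o lattice_point N) (p N e))).
  apply: (le_trans (ler_normD _ _)); apply: (le_trans (lerD e1 e2)).
  rewrite /C [M * (2 + _)]mulrDr (mulrDl _ _ N%:R^-1) addrA lerD2r.
  by rewrite (_ : M * 2 / N%:R = M / N%:R + M / N%:R); [exact: lerD|ring].
Qed.

End RootApproximation.

(** * Convolution roots as lattice limits *)

Section BlipClosure.
Context (R : realType).

Lemma blip_cst n (c : R) : blip (fun _ : n.-tuple R => c).
Proof.
split; first exact: measurable_cst.
by exists `|c|; split=> // y z; rewrite subrr normr0 mulr_ge0 // sumr_ge0.
Qed.

Lemma blipD n (f g : n.-tuple R -> R) : blip f -> blip g -> blip (fun y => f y + g y).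
Proof.
move=> [mf [M [M0 fM fL]]] [mg [N [N0 gN gL]]]; split; first exact: measurable_funD.
exists (M + N); split=> [|y|y z]; first exact: addr_ge0.
  by rewrite (le_trans (ler_normD _ _)) // lerD.
by rewrite opprD addrACA (le_trans (ler_normD _ _)) // mulrDl lerD.
Qed.

Lemma blipM n (f g : n.-tuple R -> R) : blip f -> blip g -> blip (fun y => f y * g y).
Proof.
move=> [mf [M [M0 fM fL]]] [mg [N [N0 gN gL]]]; split; first exact: measurable_funM.
exists (2 * (M * N)); have MN : 0 <= M * N by exact: mulr_ge0.
split=> [|y|y z]; first exact: mulr_ge0.
  rewrite normrM (le_trans (ler_pM _ _ (fM y) (gN y))) //.
  by rewrite ler_peMl // ler1n.
rewrite (_ : _ - _ = f y * (g y - g z) + g z * (f y - f z)); last by ring.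
apply: (le_trans (ler_normD _ _)); rewrite !normrM.
set s := \sum_(i < n) _; rewrite (_ : 2 * (M * N) * s = M * (N * s) + N * (M * s)); last by ring.
by apply: lerD; apply: ler_pM.
Qed.

Lemma blip_prod n (I : Type) (s : seq I) (F : I -> n.-tuple R -> R) :
  (forall i, blip (F i)) -> blip (fun y => \prod_(i <- s) F i y).
Proof.
move=> bF; elim: s => [|i s IH].
  by under eq_fun do rewrite big_nil; exact: blip_cst.
by under eq_fun do rewrite big_cons; exact: blipM.
Qed.

Lemma blip_comp n k (h : n.-tuple R -> R) (f : k.-tuple R -> n.-tuple R) :
  measurable_fun setT f ->
  (forall y z, \sum_(i < n) `|tnth (f y) i - tnth (f z) i| <= \sum_(i < k) `|tnth y i - tnth z i|) ->
  blip h -> blip (h \o f).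
Proof.
move=> mf fL [mh [M [M0 hM hL]]]; split; first exact: measurableT_comp.
exists M; split=> // [y|y z]; first exact: hM.
by rewrite (le_trans (hL _ _)) // ler_wpM2l.
Qed.

(** A Lipschitz substitute for the indicator of [K < tnth y i], for passing tails to limits known on
    Lipschitz functions. *)
Lemma blip_coord_ramp n (i : 'I_n) (K : R) :
  blip (fun y : n.-tuple R => Num.min 1 (Num.max 0 (tnth y i - K))).
Proof.
split.
  apply: measurable_minr; first exact: measurable_cst.
  apply: measurable_maxr; first exact: measurable_cst.
  by apply: measurable_funB; [exact: measurable_tnth|exact: measurable_cst].
exists 1; split=> // [y|y z].
  by rewrite ger0_norm ?ge_min ?lexx // le_min ler01 le_max lexx.
rewrite mul1r (bigD1 i) //=; apply: (@le_trans _ _ `|tnth y i - tnth z i|); last first.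
  by rewrite lerDl sumr_ge0.
set a := tnth y i; set b := tnth z i.
case: (leP (a - K) 0) => h1; case: (leP (b - K) 0) => h2; first by rewrite subrr normr0.
all: rewrite ![Num.min 1 _]minEle; case: ifP => h3; case: ifP => h4;
  rewrite ler_norml; apply/andP; split; have := ler_norm (a - b);
  have := ler_norm (- (a - b)); rewrite normrN; lra.
Qed.

End BlipClosure.

Lemma blip_same_law (R : realType) n (d1 d2 : measure_display)
    (T1 : measurableType d1) (P1 : probability T1 R)
    (T2 : measurableType d2) (P2 : probability T2 R)
    (W1 : T1 -> n.-tuple R) (W2 : T2 -> n.-tuple R) :
  measurable_fun setT W1 -> measurable_fun setT W2 ->
  (forall h, blip h -> \int[P1]_w h (W1 w) = \int[P2]_w h (W2 w)) ->
  same_law P1 W1 P2 W2.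
Proof.
move=> mW1 mW2 eqh A mA.
have i1 := L1_bmf P1 (@bmf_cst _ _ R 1); have i2 := L1_bmf P2 (@bmf_cst _ _ R 1).
have := blip_determines (fun=> ler01) (fun=> ler01) i1 i2 mW1 mW2 _ mA.
rewrite !integral_cst ?mul1e.
- by apply=> h bh; under eq_Rintegral do rewrite mul1r;
    under [RHS]eq_Rintegral do rewrite mul1r; exact: eqh.
- by rewrite -[X in measurable X]setTI; exact: mW2.
- by rewrite -[X in measurable X]setTI; exact: mW1.
Qed.

Section BlipIndependence.
Context (R : realType) (n m : nat) (d : measure_display) (T : measurableType d).
Context (P : probability T R) (Y : 'I_m -> T -> n.-tuple R).
Context (mY : forall j, measurable_fun setT (Y j)).
Context (prodY : forall h : 'I_m -> n.-tuple R -> R, (forall j, blip (h j)) ->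
  \int[P]_w (\prod_(j < m) h j (Y j w)) = \prod_(j < m) \int[P]_w h j (Y j w)).

(* Lipschitz factors are replaced by indicators one at a time. *)
Let mixed r (f : 'I_m -> n.-tuple R -> R) := forall j : 'I_m,
  if (j < r)%N then exists2 A : set (n.-tuple R), measurable A & f j = \1_A
  else blip (f j) /\ forall y, 0 <= f j y.

Let mixed_bmf r f j : mixed r f -> bmf (f j).
Proof.
move=> /(_ j); case: ifP => _; last by move=> [/blip_bmf].
by move=> [A mA ->]; exact: bmf_indic.
Qed.

Let mixed_ge0 r f j y : mixed r f -> 0 <= f j y.
Proof.
move=> /(_ j); case: ifP => _; last by move=> [_].
by move=> [A mA ->]; rewrite indicE.
Qed.

(** The product of the other factors is a nonnegative weight. By induction it acts on Lipschitz
    functions of [Y a] like the constant [c], so [blip_determines] allows an indicator in slot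
    [a]. *)
Let mixed_prod r f : (r <= m)%N -> mixed r f ->
  \int[P]_w (\prod_(j < m) f j (Y j w)) = \prod_(j < m) \int[P]_w f j (Y j w).
Proof.
elim: r f => [|r IH] f rm hf; first by apply: prodY => j; have [] := hf j.
pose a := Ordinal rm; pose G w := \prod_(j < m | j != a) f j (Y j w).
have bf j : bmf (fun w => f j (Y j w)) by apply: (bmf_comp (mY j)); exact: mixed_bmf hf.
have bG : bmf G.
  rewrite /G; under eq_fun do rewrite -big_filter.
  by apply: bmf_prod.
have G0 w : 0 <= G w by apply: prodr_ge0 => j _; exact: mixed_ge0 hf.
pose c := \prod_(j < m | j != a) \int[P]_w f j (Y j w).
have c0 : 0 <= c by apply: prodr_ge0 => j _; apply: Rint_ge0 => w; exact: mixed_ge0 hf.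
have step h : blip h -> (forall y, 0 <= h y) ->
    \int[P]_w (G w * h (Y a w)) = c * \int[P]_w h (Y a w).
  move=> bh h0; pose f' j := if j == a then h else f j.
  have hf' : mixed r f'.
    move=> j; rewrite /f'; have [->|ja] := eqVneq j a; first by rewrite ltnn.
    have := hf j; rewrite ltnS leq_eqVlt (_ : (j == r :> nat) = false) //.
    by apply: contra_neqF ja => /eqP jr; apply/val_inj.
  have := IH f' (ltnW rm) hf'.
  rewrite [RHS](bigD1 a) //= /f' eqxx.
  have -> : \prod_(j < m | j != a) \int[P]_w (if j == a then h else f j) (Y j w) = c.
    by apply: eq_bigr => j /negbTE ->.
  rewrite mulrC => <-; apply: eq_Rintegral => w _.
  rewrite [RHS](bigD1 a) //= eqxx mulrC; congr (_ * _).
  by apply: eq_bigr => j /negbTE ->.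
(* [step] wants [h] nonnegative: it is applied to [h + M] and to [M], and linearity cancels the
   constant. *)
have eqh h : blip h -> \int[P]_w (G w * h (Y a w)) = \int[P]_w (c * h (Y a w)).
  move=> bh; have [mh [M [M0 hM _]]] := bh.
  have b1 : blip (fun y => h y + M) by apply: blipD => //; exact: blip_cst.
  have bhY : bmf (fun w => h (Y a w)) by apply: (bmf_comp (mY a)); exact: blip_bmf.
  have := step _ b1 (fun y => _); rewrite RexpZ // => /(_ _).
  have e1 := step (fun=> M) (blip_cst n M) (fun=> M0).
  have p y : 0 <= h y + M by have := hM y; rewrite ler_norml => /andP[]; lra.
  move=> /(_ p).
  under eq_Rintegral do rewrite mulrDr.
  have bM : bmf (fun _ : T => M) by exact: bmf_cst.
  rewrite (RexpD P (bmfM bG bhY) (bmfM bG bM)) e1 (RexpD P bhY bM) mulrDr.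
  exact: addIr.
have [A mA fA] : exists2 A : set (n.-tuple R), measurable A & f a = \1_A.
  by have := hf a; rewrite /= ltnSn.
have iG := L1_bmf P bG; have ic := L1_bmf P (@bmf_cst _ _ R c).
have := blip_determines G0 (fun=> c0) iG ic (mY a) (mY a) eqh mA.
rewrite !weighted_indicE // => -[e].
rewrite (bigD1 a) //= -/c mulrC -RexpZ // fA -e.
by apply: eq_Rintegral => w _; rewrite (bigD1 a) //= fA mulrC.
Qed.

Lemma blip_mutually_independent : mutually_independent P Y.
Proof.
move=> A mA; have mYA j : measurable (Y j @^-1` A j).
  by rewrite -[X in measurable X]setTI; exact: mY.
have hf : mixed m (fun j => \1_(A j)).
  by move=> j; rewrite ltn_ord; exists (A j).
have := mixed_prod (leqnn m) hf.
have E j : \int[P]_w (\1_(A j) (Y j w) : R) = fine (P (Y j @^-1` A j)).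
  by rewrite -Rexp_indic //; apply: eq_Rintegral => w _; rewrite !indicE.
under [RHS]eq_bigr do rewrite E.
have -> : \int[P]_w (\prod_(j < m) \1_(A j) (Y j w)) =
    fine (P (\bigcap_(k in [set: 'I_m]) (Y k @^-1` A k))).
  rewrite -Rexp_indic; last by apply: fin_bigcap_measurable.
  apply: eq_Rintegral => w _; rewrite [RHS]indicE.
  have [wA|] := boolP (w \in _).
    rewrite big1 // => j _; rewrite indicE mem_set //.
    by move: wA; rewrite inE => /(_ j Logic.I).
  move=> /negP; rewrite inE => nw.
  have [j nj] : exists j, ~ A j (Y j w).
    by apply/existsNP => h; apply: nw => j _; exact: h.
  by rewrite (bigD1 j) //= indicE memNset // mul0r.
have f j : P (Y j @^-1` A j) \is a fin_num by apply: fin_num_measure; exact: mYA.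
move=> e; rewrite -[LHS]fineK; last first.
  by apply: fin_num_measure; apply: fin_bigcap_measurable.
rewrite e -prodEFin; apply: eq_bigr => j _; exact: fineK.
Qed.

End BlipIndependence.

Section LatticeFunctional.
Context (R : realType) (n m N : nat) (Q : mpoly n R) (Q_ge0 : mp_nonneg Q).

(* Expectation of g under m independent lattice-valued vectors with (defective)
   generating polynomial Q. *)
Definition lattice_functional (g : path_space ('I_m * 'I_n)%type R -> R) : R :=
  \sum_(K : {ffun 'I_m -> bmultinom n (msize Q)})
    (\prod_(j < m) mcoeff (K j) Q) *
    g (fun ji => tnth (lattice_point R N (K ji.1)) ji.2).

Lemma lattice_functional_positive : positive_functional lattice_functional.
Proof.
split.
- by move=> f g _ _; rewrite -big_split; apply: eq_bigr => K _; rewrite mulrDr.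
- by move=> c f _; rewrite mulr_sumr; apply: eq_bigr => K _; rewrite mulrCA.
- move=> f _ f0; apply: sumr_ge0 => K _; rewrite mulr_ge0 ?prodr_ge0 //.
  by apply: f0 => ji; rewrite tnth_mktuple divr_ge0 // exprn_ge0.
Qed.

Lemma lattice_functional_prod (h : 'I_m -> n.-tuple R -> R) :
  lattice_functional (fun z => \prod_(j < m) h j [tuple z (j, i) | i < n]) =
  \prod_(j < m) mp_eval (h j \o lattice_point R N) Q.
Proof.
under [RHS]eq_bigr do rewrite (mp_evalwE _ (leqnn _)).
rewrite bigA_distr_bigA; apply: eq_bigr => K _; rewrite -big_split.
apply: eq_bigr => j _ /=; congr (_ * h j _).
by apply: eq_from_tnth => i; rewrite !tnth_mktuple.
Qed.

Lemma lattice_functional_sum (h : n.-tuple R -> R) :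
  lattice_functional (fun z => h [tuple \sum_(j < m) z (j, i) | i < n]) =
  mp_eval (h \o lattice_point R N) (Q ^+ m).
Proof.
rewrite (mp_eval_exp _ _ (leqnn _)); apply: eq_bigr => K _; congr (_ * h _).
apply: eq_from_tnth => i; rewrite !tnth_mktuple.
have -> : (\big[@mnm_add n/@mnm0 n]_(j < m) K j) i = (\sum_(j < m) (K j : multinom n) i)%N.
  apply: (big_morph (fun k : multinom n => k i)); last exact: mnm0E.
  by move=> k k'; rewrite mnmDE.
rewrite natr_sum mulr_suml; apply: eq_bigr => j _; by rewrite tnth_mktuple.
Qed.

End LatticeFunctional.

Lemma cvg_prod_seq (R : realType) (J K : Type) (F : set_system J) (s : seq K)
    (f : K -> J -> R) (l : K -> R) : Filter F ->
  (forall i, f i @ F --> l i) ->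
  (fun j => \prod_(i <- s) f i j) @ F --> \prod_(i <- s) l i.
Proof.
move=> FF fl; elim: s => [|k s IH].
  by rewrite big_nil; under eq_fun do rewrite big_nil; exact: cvg_cst.
by rewrite big_cons; under eq_fun do rewrite big_cons; exact: cvgM.
Qed.

Section LatticeLimit.
Context (R : realType) (n m : nat).
Context (d : measure_display) (T : measurableType d) (P : probability T R).
Context (W : T -> n.-tuple R) (mW : measurable_fun setT W).
Context (Q : nat -> mpoly n R) (Q_ge0 : forall N, mp_nonneg (Q N)).
Context (U : set_system nat) (UU : UltraFilter U).
Context (mass : (fun N => mp_eval (fun=> 1) (Q N) ^+ m) @ U --> (1 : R)).
Context (sumQ : forall h, blip h ->
  (fun N => mp_eval (h \o lattice_point R N.+1) (Q N ^+ m)) @ U --> \int[P]_w h (W w)).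

Let Lam N := @lattice_functional R n m N.+1 (Q N).
Local Notation I := ('I_m * 'I_n)%type.

(** A part is at most the sum of the parts, whose lattice laws converge on Lipschitz functions to
    the law of [W]. *)
Lemma lattice_tight (L : (path_space I R -> R) -> R) (ji : I) (e : R) :
  (forall f, bmf f -> (fun N => Lam N f) @ U --> L f) -> 0 < e ->
  exists K : R, L (fun z : path_space I R => ((K < z ji)%R)%:R) <= e.
Proof.
move=> cL e0; case: ji => j i; have mWi : measurable_fun setT (fun w => tnth (W w) i).
  exact: measurable_tnth_comp.
have := tail_integral_cvg (fun=> ler01) (L1_bmf P (@bmf_cst _ _ R 1)) mWi.
move=> /cvgrPdist_le /(_ _ e0)[k _ /(_ k (leqnn _))]; rewrite sub0r normrN => hk.
(* The ramp starts at [k] and equals 1 from [k + 1] on, so it lies between the indicators of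
   exceeding [k + 1] and of exceeding [k]. *)
exists (k%:R + 1); pose h (y : n.-tuple R) := Num.min 1 (Num.max 0 (tnth y i - k%:R)) : R.
have bh : blip h by exact: blip_coord_ramp.
have le_int : \int[P]_w h (W w) <= e.
  apply: le_trans (le_trans (ler_norm _) hk); apply: le_Rexp.
  - by apply: (bmf_comp mW); exact: blip_bmf.
  - apply: bmfM; first exact: bmf_cst.
    by apply: bmf_bool; apply: measurable_fun_ltr => //; exact: measurable_cst.
  - move=> w; rewrite mul1r /h; case: ltP => hw; first by rewrite ge_min lexx.
    by rewrite max_l ?subr_le0 // min_r.
apply: le_trans le_int.
have lim1 := cL _ (bmf_gt (k%:R + 1) (j, i)).
rewrite -(cvg_lim (@Rhausdorff R) lim1) -(cvg_lim (@Rhausdorff R) (sumQ bh)).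
apply: ler_lim; [exact: cvgP lim1|exact: cvgP (sumQ bh)|].
apply: nearW => N; rewrite -lattice_functional_sum; apply: ler_sum => K _.
rewrite ler_wpM2l ?prodr_ge0 //; first by move=> ? _; exact: Q_ge0.
pose z (ji : I) := tnth (lattice_point R N.+1 (K ji.1)) ji.2.
change (((k%:R + 1 < z (j, i))%R)%:R <= h [tuple \sum_(j' < m) z (j', i') | i' < n]).
have z0 ji : 0 <= z ji by rewrite /z tnth_mktuple divr_ge0 // exprn_ge0.
have sz : z (j, i) <= \sum_(j' < m) z (j', i) by rewrite (bigD1 j) //= lerDl sumr_ge0.
rewrite /h tnth_mktuple; case: ltP => hz.
  rewrite le_min lexx /= le_max; apply/orP; right.
  by move: sz hz; lra.
by rewrite le_min ler01 le_max lexx.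
Qed.

(** All [m * n] coordinates are represented on one space, giving a joint limit of the parts. For
    Lipschitz functions the product rule, equidistribution and the law of the sum hold along the
    lattice up to mass defects, which vanish in the limit. *)
Lemma lattice_limit_law : exists (d' : measure_display) (S : measurableType d')
    (P' : probability S R) (Y : 'I_m -> {RV P' >-> n.-tuple R}),
  [/\ mutually_independent P' Y,
      forall j k, same_law P' (Y j) P' (Y k)
    & same_law P W P' (fun w => sum_tuple (fun k => Y k w))].
Proof.
have pLam N : positive_functional (Lam N) by exact: lattice_functional_positive.
have LamP h N : Lam N (fun z => \prod_(j < m) h j [tuple z (j, i) | i < n]) =
    \prod_(j < m) mp_eval (h j \o lattice_point R N.+1) (Q N) by exact: lattice_functional_prod.
have eqU (f g : nat -> R) (a : R) : (forall N, f N = g N) -> f @ U --> a -> g @ U --> a.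
  by move=> /funext ->.
have c1 : (fun N => Lam N (fun=> 1)) @ U --> (1 : R).
  apply: eqU mass => N; symmetry.
  have := LamP (fun _ _ => 1) N; under eq_fun do rewrite big1_eq.
  by move=> ->; rewrite prodr_const card_ord.
have [L [pL Lu cL]] := functional_limit UU pLam c1.
have Lt ji e : 0 < e -> exists K : R, L (fun z : path_space I R => ((K < z ji)%R)%:R) <= e.
  exact: lattice_tight.
have [d' [S [P' [Z HZ]]]] := functional_representation pL Lu Lt.
(* One tuple lists all pairs of a part and a coordinate, so that functions of several parts are
   tested together. *)
pose x := [tuple enum_val k | k < #|{: I}|].
have xE ji : tnth x (enum_rank ji) = ji by rewrite tnth_mktuple enum_rankK.
pose sel j (v : #|{: I}|.-tuple R) := [tuple tnth v (enum_rank (j, i)) | i < n].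
pose tot (v : #|{: I}|.-tuple R) := [tuple \sum_(j < m) tnth v (enum_rank (j, i)) | i < n].
have sumI (f : 'I_#|{: I}| -> R) :
    \sum_k f k = \sum_(i < n) \sum_(j < m) f (enum_rank (j, i)).
  rewrite (reindex (@enum_rank {: I})) /=; last by apply: onW_bij; exact: enum_rank_bij.
  by rewrite exchange_big pair_bigA; apply: eq_bigr => -[].
have bsel j h : blip h -> blip (h \o sel j).
  apply: blip_comp; first by apply: measurable_mktuple => i; exact: measurable_tnth.
  move=> y z; rewrite sumI; apply: ler_sum => i _; rewrite !tnth_mktuple (bigD1 j) //= lerDl.
  exact: sumr_ge0.
have btot h : blip h -> blip (h \o tot).
  apply: blip_comp.
    by apply: measurable_mktuple => i; apply: measurable_sum => j; exact: measurable_tnth.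
  move=> y z; rewrite sumI; apply: ler_sum => i _; rewrite !tnth_mktuple -sumrB.
  exact: ler_norm_sum.
have mY j : measurable_fun setT (fun w => [tuple Z (j, i) w | i < n]).
  by apply: measurable_mktuple => i; exact: measurable_funPT.
pose Y j : {RV P' >-> n.-tuple R} := mfun_Sub (mem_set (mY j)).
have YE j w : Y j w = [tuple Z (j, i) w | i < n] by [].
have prodL (h : 'I_m -> n.-tuple R -> R) : (forall j, blip (h j)) ->
    (fun N => \prod_(j < m) mp_eval (h j \o lattice_point R N.+1) (Q N)) @ U -->
    \int[P']_w \prod_(j < m) h j (Y j w).
  move=> bh; pose H (v : #|{: I}|.-tuple R) := \prod_(j < m) (h j \o sel j) v.
  have bH : blip H by apply: blip_prod => j; exact: bsel.
  have HE (z : I -> R) : H [tuple z (tnth x k) | k < _] = \prod_(j < m) h j [tuple z (j, i) | i < n].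
    apply: eq_bigr => j _; congr (h j _); apply: eq_from_tnth => i.
    by rewrite !tnth_mktuple enum_rankK.
  have := cL _ (bmf_blip x bH); rewrite -HZ //.
  have -> : \int[P']_w H [tuple Z (tnth x i) w | i < _] = \int[P']_w \prod_(j < m) h j (Y j w).
    by apply: eq_Rintegral => w _; rewrite (HE (fun ji => Z ji w)).
  by apply: eqU => N; rewrite -LamP; congr (Lam N); apply/funext => z; rewrite HE.
have singleL j h : blip h ->
    (fun N => mp_eval (h \o lattice_point R N.+1) (Q N) * mp_eval (fun=> 1) (Q N) ^+ m.-1) @ U -->
    \int[P']_w h (Y j w).
  move=> bh; have := prodL (fun k => if k == j then h else fun=> 1).
  have -> : \int[P']_w \prod_(k < m) (if k == j then h else fun=> 1) (Y k w) = \int[P']_w h (Y j w).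
    apply: eq_Rintegral => w _; rewrite (bigD1 j) //= eqxx big1 ?mulr1 // => k /negbTE -> //.
  have -> : (fun N => \prod_(k < m) mp_eval ((if k == j then h else fun=> 1) \o lattice_point R N.+1) (Q N)) =
      (fun N => mp_eval (h \o lattice_point R N.+1) (Q N) * mp_eval (fun=> 1) (Q N) ^+ m.-1).
    apply/funext => N; rewrite (bigD1 j) //= eqxx; congr (_ * _).
    rewrite (eq_bigr (fun=> mp_eval (fun=> 1) (Q N))) => [|k /negbTE -> //].
    by rewrite prodr_const cardC1 card_ord.
  by apply=> k; case: ifP => // _; exact: blip_cst.
(* Each one-part limit carries the mass to the power [m.-1]; over [m] parts this is the power [m.-1]
   of the mass of [Q N ^+ m], which tends to one. *)
have prodY (h : 'I_m -> n.-tuple R -> R) : (forall j, blip (h j)) ->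
    \int[P']_w (\prod_(j < m) h j (Y j w)) = \prod_(j < m) \int[P']_w h j (Y j w).
  move=> bh; have l1 := prodL h bh.
  have l2 := @cvg_prod_seq R _ _ U (index_enum 'I_m) _ _ _ (fun j => singleL j _ (bh j)).
  have mass1 : (fun N => (mp_eval (fun=> 1) (Q N) ^+ m) ^+ m.-1) @ U --> (1 : R).
    elim: m.-1 => [|k IH]; first by under eq_fun do rewrite expr0; exact: cvg_cst.
    have h1 : (fun N => mp_eval (fun=> 1) (Q N) ^+ m * (mp_eval (fun=> 1) (Q N) ^+ m) ^+ k) @ U --> (1 * 1 : R).
      exact: cvgM mass IH.
    by rewrite mulr1 in h1; apply: (eqU _ _ _ _ h1) => N; rewrite exprS.
  have l3 := cvgM l1 mass1; rewrite mulr1 in l3.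
  apply: (cvg_unique (@Rhausdorff R) (l3 _)); apply: eqU (l2 _) => N; rewrite big_split /=; congr (_ * _).
  by rewrite prodr_const card_ord exprAC.
exists d', S, P', Y; split.
- by apply: blip_mutually_independent => // j; exact: mY.
- move=> j k; apply: blip_same_law; [exact: mY|exact: mY|move=> h bh].
  exact: (cvg_unique (@Rhausdorff R) (singleL j h bh) (singleL k h bh)).
- apply: blip_same_law => //; first by apply: measurable_sum_tuple => j; exact: mY.
  move=> h bh; have bH := btot h bh.
  have HE (z : I -> R) : (h \o tot) [tuple z (tnth x k) | k < _] = h [tuple \sum_(j < m) z (j, i) | i < n].
    rewrite /=; congr h; apply: eq_from_tnth => i; rewrite !tnth_mktuple.
    by apply: eq_bigr => j _; rewrite !tnth_mktuple enum_rankK.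
  have := cL _ (bmf_blip x bH); rewrite -HZ //.
  have -> : \int[P']_w (h \o tot) [tuple Z (tnth x i) w | i < _] =
      \int[P']_w h (sum_tuple (fun k => Y k w)).
    apply: eq_Rintegral => w _; rewrite (HE (fun ji => Z ji w)); congr h.
    by apply: eq_from_tnth => i; rewrite !tnth_mktuple; apply: eq_bigr => j _; rewrite YE tnth_mktuple.
  have -> : (fun N => Lam N (fun z : path_space I R => (h \o tot) [tuple z (tnth x i) | i < _])) =
      (fun N => mp_eval (h \o lattice_point R N.+1) (Q N ^+ m)).
    apply/funext => N; rewrite -lattice_functional_sum.
    by congr (Lam N); apply/funext => z; rewrite HE.
  by move=> lim; exact: (cvg_unique (@Rhausdorff R) (sumQ bh) lim).
Qed.

End LatticeLimit.

(** * Infinite divisibility from the size-bias decompositions *)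

Section BiasedDivisible.
Context (R : realType) (n : nat).
Context (d : measure_display) (T : measurableType d) (P : probability T R).
Context (W : T -> n.-tuple R) (mW : measurable_fun setT W).
Context (W_ge0 : forall w i, 0 <= tnth (W w) i).
Context (LW : forall i, L1 P (fun w => tnth (W w) i)).
Context (bias : forall i, 0 < \int[P]_w tnth (W w) i -> size_bias_summand_of P W i).

(** The joint lattice functionals are only relatively compact, so [N] follows an ultrafilter finer
    than the neighbourhoods of infinity; limits in [N] persist along it. *)
Lemma size_bias_infinitely_divisible : infinitely_divisible_law (pushforward P W).
Proof.
move=> m m0; have /choice[Q hQ] := fun N => root_approximation mW W_ge0 LW bias (ltn0Sn N) m0.
have [U [UU subU]] := @ultraFilterLemma nat \oo _.
have toU (f : nat -> R) (l : R) : f @ \oo --> l -> f @ U --> l.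
  by move=> fl V /fl; exact: subU.
have invN : (fun N => N.+1%:R^-1) @ \oo --> (0 : R) by exact: cvg_harmonic.
have mass : (fun N => mp_eval (fun=> 1) (Q N) ^+ m) @ U --> (1 : R).
  apply: toU; apply: (@squeeze_cvgr _ _ _ _ (fun N => 1 - N.+1%:R^-1) (fun=> 1)).
  - by apply: nearW => N; have [_ h _] := hQ N.
  - by rewrite -[X in _ --> X]subr0; apply: cvgB => //; exact: cvg_cst.
  - exact: cvg_cst.
have sumQ h : blip h ->
    (fun N => mp_eval (h \o lattice_point R N.+1) (Q N ^+ m)) @ U --> \int[P]_w h (W w).
  move=> [mh [M [M0 hM hL]]]; apply: toU.
  set C := 2 + \sum_(i < n) (\int[P]_w tnth (W w) i + 1) / 2.
  have c0 : (fun N => M * C * N.+1%:R^-1) @ \oo --> (0 : R).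
    by rewrite -[X in _ --> X](mulr0 (M * C)); exact: cvgMr.
  apply/cvgrPdist_le => e e0; move/cvgrPdist_le: c0 => /(_ e e0); apply: filterS => N.
  rewrite sub0r normrN => h1; rewrite distrC; apply: le_trans (le_trans (ler_norm _) h1).
  by have [_ _ h2] := hQ N; exact: h2.
have [d' [S [P' [Y [indY idY sumY]]]]] :=
  lattice_limit_law mW (fun N => let: And3 h _ _ := hQ N in h) UU mass sumQ.
by exists d', S, P', Y; split.
Qed.

End BiasedDivisible.

Lemma biased_divisible (R : realType) (d : measure_display) (T : measurableType d)
    (P : probability T R) (E : Type) (psi : E -> {RV P >-> R}) :
  (forall x w, 0 <= psi x w) -> (forall x, L1 P (psi x)) ->
  (forall a, 0 < \int[P]_w psi a w -> size_bias_decomposition psi a) ->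
  infinitely_divisible P psi.
Proof.
move=> psi0 Lpsi H n x; have WE i w : tnth (marginal psi x w) i = psi (tnth x i) w.
  by rewrite tnth_mktuple.
apply: size_bias_infinitely_divisible.
- by apply: measurable_marginal => y; exact: measurable_funPT.
- by move=> w i; rewrite WE.
- by move=> i; under eq_fun do rewrite WE.
- move=> i c0; have ci : 0 < \int[P]_w psi (tnth x i) w.
    by move: c0; under eq_Rintegral do rewrite WE.
  have [d' [T' [P' [psi' [l [h1 h2 h3]]]]]] := H _ ci.
  have [U [mU U0 HU]] := size_bias_summand psi0 Lpsi ci h1 h2 h3 x.
  exists d', T', P', U; split=> // g bg.
  under eq_Rintegral do rewrite WE; under [X in _ = X * _]eq_Rintegral do rewrite WE.
  exact: HU.
Qed.

(* The process l is allowed to live on another probability space than psi, one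
   that carries a copy psi' of psi: the space of psi may be too small to
   support any nonconstant variable independent of psi. *)
Theorem lemma6p1 (R : realType) (d : measure_display) (T : measurableType d)
    (P : probability T R) (E : Type) (psi : E -> {RV P >-> R})
    (psi_ge0 : forall x w, 0 <= psi x w)
    (psi_fin : forall x, ('E_P[psi x] < +oo)%E) :
  infinitely_divisible P psi <->
  (forall a : E, (0 < 'E_P[psi a])%E ->
     exists (d' : measure_display) (T' : measurableType d')
       (P' : probability T' R) (psi' l : E -> {RV P' >-> R}),
       [/\ eq_law P psi P' psi',
           independent_processes P' psi' l
         & eq_law (size_biased P (psi a)) psi
                  P' (fun x w => psi' x w + l x w)]).
Proof.
have Lpsi x : L1 P (psi x).
  apply/integrableP; split; first by apply/measurable_EFinP; exact: measurable_funPT.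
  have := psi_fin x; rewrite expectation_def; apply: le_lt_trans.
  by rewrite le_eqVlt; apply/orP; left; apply/eqP; apply: eq_integral => w _; rewrite gee0_abs ?lee_fin.
have EE x : ('E_P[psi x] = (\int[P]_w psi x w)%R%:E)%E.
  by rewrite expectation_def /Rintegral fineK //; exact: (integrable_fin_num measurableT (Lpsi x)).
split=> [idP a|H].
  by rewrite EE lte_fin => c0; exact: forward_decomposition idP.
by apply: biased_divisible => // a c0; apply: H; rewrite EE lte_fin.
Qed.
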